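(* For the $\mathfrak{S}_n$-action on the triangulation $K_n$ of the simplex $\Sigma_n$ we have $$1+\sum_{n\ge1}\mathrm{ch}\left(\mathbb{C}(K_n),t\right)z^n=\frac{H(\mathbf{x};z)\left(H(\mathbf{x};tz)-tH(\mathbf{x};z)\right)}{H(\mathbf{x};tz)^2-tH(\mathbf{x};z)^2}$$ and $$1+\sum_{n\ge1}\mathrm{ch}\left(L_{V_n}(K_n),t\right)z^n=\frac{H(\mathbf{x};tz)-tH(\mathbf{x};z)}{H(\mathbf{x};tz)^2-tH(\mathbf{x};z)^2}.$$ Moreover, the pair $(K_n,\mathfrak{S}_n)$ satisfies the local equivariant Gal phenomenon for every $n\ge1$.
   Context: $\mathbf{x}=(x_1,x_2,\dots)$, $H(\mathbf{x};z)=\sum_{n\ge0}h_n(\mathbf{x})z^n$ is the generating function of the complete homogeneous symmetric functions, and $\mathrm{ch}$ is the Frobenius characteristic map, sending the irreducible complex $\mathfrak{S}_n$-representation indexed by $\lambda\vdash n$ to the Schur function $s_\lambda(\mathbf{x})$ (so the trivial representation goes to $h_n$). The identities are between formal power series in $z$ whose coefficients are polynomials in $t$ over the ring of symmetric functions. Let $V_n=\{\varepsilon_1,\dots,\varepsilon_n\}$ be the set of unit coordinate vectors of $\mathbb{R}^n$ and $\Sigma_n$ their convex hull; $\mathfrak{S}_n$ acts by permuting coordinates. Let $\Gamma$ be a triangulation of $\Sigma_n$ (a geometric simplicial complex subdividing $\Sigma_n$) with vertex set $V_\Gamma$. Let $S=\mathbb{C}[x_v:v\in V_\Gamma]$ and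 let $\mathbb{C}[\Gamma]=S/I_\Gamma$ be the face ring of $\Gamma$, where $I_\Gamma$ is generated by the square-free monomials corresponding to the non-faces of $\Gamma$. For $i\in\{1,\dots,n\}$ put $\theta_i=\sum_{v\in V_\Gamma}\langle v,\varepsilon_i\rangle x_v$, with $\langle\,,\rangle$ the standard inner product, let $\Theta$ be the ideal of $\mathbb{C}[\Gamma]$ generated by $\theta_1,\dots,\theta_n$, and let $\mathbb{C}(\Gamma)=\mathbb{C}[\Gamma]/\Theta$, a finite-dimensional graded $\mathbb{C}$-vector space. The local face module $L_{V_n}(\Gamma)$ is the image in $\mathbb{C}(\Gamma)$ of the ideal of $\mathbb{C}[\Gamma]$ generated by the square-free monomials corresponding to the faces of $\Gamma$ lying in the interior of $\Sigma_n$ (faces not contained in any proper face of $\Sigma_n$), with the induced grading. If a subgroup $G$ of $\mathfrak{S}_n$ acts simplicially on $\Gamma$, then $G$ acts on the graded spaces $\mathbb{C}(\Gamma)$ and $L_{V_n}(\Gamma)$. For $G=\mathfrak{S}_n$ write $\mathrm{ch}(\mathbb{C}(\Gamma),t)=\sum_{i=0}^n\mathrm{ch}(\mathbb{C}(\Gamma)_i)\,t^i$ and $\mathrm{ch}(L_{V_n}(\Gamma),t)=\sum_{i=0}^n\mathrm{ch}(L_{V_n}(\Gamma)_i)\,t^i$. The pair $(\Gamma,G)$ satisfies the local equivariant Gal phenomenon if there exist non-virtual (actual) $G$-representations $M_k$, $0\le k\le\lfloor n/2\rfloor$, such that $\sum_{i=0}^n(L_{V_n}(\Gamma))_i\,t^i=\sum_{k=0}^{\lfloor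 n/2\rfloor}M_k\,t^k(1+t)^{n-2k}$ as polynomials in $t$ with coefficients in the representation ring of $G$. $K_n$ is the barycentric subdivision of the standard cubical subdivision of $\Sigma_n$. The latter is the subdivision whose nonempty faces are in inclusion-preserving bijection with the nonempty closed intervals $[A,B]$, $\varnothing\ne A\subseteq B\subseteq\{1,\dots,n\}$, of the poset of nonempty subsets of $\{1,\dots,n\}$ ordered by inclusion; the face of $[A,B]$ is the convex hull of the barycenters of the faces $\{\varepsilon_i:i\in C\}$ of $\Sigma_n$ with $A\subseteq C\subseteq B$. Thus $K_n$ has one vertex (the barycenter of the corresponding cubical face) for each nonempty closed interval, its faces correspond to chains of such intervals under inclusion, and $\mathfrak{S}_n$ acts on $K_n$ by permuting $\{1,\dots,n\}$. *)

(* Defs.v *)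
From HB Require Import structures.
From mathcomp Require Import all_boot all_order all_algebra all_fingroup.
From mathcomp Require Import all_character.
From mathcomp Require Import mpoly complex.
From mathcomp Require Import boolp reals.

Set Implicit Arguments.
Unset Strict Implicit.
Unset Printing Implicit Defensive.

Import GRing.Theory.
Local Open Scope ring_scope.

Record fps (A : Type) := Fps { fps_coef : nat -> A }.

Section FormalPowerSeries.
Variable A : comNzRingType.
Implicit Types f g h : fps A.

Lemma fpsP f g : (forall n, fps_coef f n = fps_coef g n) -> f = g.
Proof. by case: f g => [f] [g] /= fg; congr Fps; apply: funext. Qed.

HB.instance Definition _ := gen_eqMixin (fps A).
HB.instance Definition _ := gen_choiceMixin (fps A).

Definition fps_add f g := Fps (fun n => fps_coef f n + fps_coef g n).
Definition fps_opp f := Fps (fun n => - fps_coef f n).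
Definition fpsC (a : A) := Fps (fun n => if n is 0 then a else 0).
Definition fps_mul f g :=
  Fps (fun n => \sum_(i < n.+1) fps_coef f i * fps_coef g (n - i)%N).

Fact fps_addA : associative fps_add.
Proof. by move=> f g h; apply: fpsP => n /=; rewrite addrA. Qed.
Fact fps_addC : commutative fps_add.
Proof. by move=> f g; apply: fpsP => n /=; rewrite addrC. Qed.
Fact fps_add0 : left_id (fpsC 0) fps_add.
Proof. by move=> f; apply: fpsP => -[|n] /=; rewrite add0r. Qed.
Fact fps_addN : left_inverse (fpsC 0) fps_opp fps_add.
Proof. by move=> f; apply: fpsP => -[|n] /=; rewrite addNr. Qed.

HB.instance Definition _ :=
  GRing.isZmodule.Build (fps A) fps_addA fps_addC fps_add0 fps_addN.

Definition fps_trunc f n : {poly A} := \poly_(i < n) fps_coef f i.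

Lemma fps_mul_trunc f g n i : (i < n)%N ->
  fps_coef (fps_mul f g) i = (fps_trunc f n * fps_trunc g n)`_i.
Proof.
move=> ltin; rewrite coefM /=; apply: eq_bigr => -[j /= ltji] _.
by rewrite !coef_poly (leq_ltn_trans _ ltin) // (leq_ltn_trans (leq_subr _ _) ltin).
Qed.

Fact fps_mulA : associative fps_mul.
Proof.
move=> f g h; apply: fpsP => n.
rewrite [LHS](@fps_mul_trunc _ _ n.+1) // [RHS](@fps_mul_trunc _ _ n.+1) //.
transitivity ((fps_trunc f n.+1 * fps_trunc g n.+1 * fps_trunc h n.+1)`_n).
  rewrite -mulrA !coefM; apply: eq_bigr => -[i /= lti] _; congr (_ * _).
  by rewrite coef_poly ltnS leq_subr (@fps_mul_trunc _ _ n.+1) // ltnS leq_subr.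
rewrite [LHS]coefM [RHS]coefM; apply: eq_bigr => -[i /= lti] _; congr (_ * _).
by rewrite coef_poly lti (@fps_mul_trunc _ _ n.+1).
Qed.

Fact fps_mulC : commutative fps_mul.
Proof.
by move=> f g; apply: fpsP => n; rewrite !(@fps_mul_trunc _ _ n.+1) // mulrC.
Qed.

Fact fps_mul1 : left_id (fpsC 1) fps_mul.
Proof.
move=> f; apply: fpsP => n /=; rewrite big_ord_recl /= mul1r subn0 big1 ?addr0 //.
by move=> i _; rewrite mul0r.
Qed.

Fact fps_mulDl : left_distributive fps_mul fps_add.
Proof.
move=> f g h; apply: fpsP => n /=; rewrite -big_split /=.
by apply: eq_bigr => i _; rewrite mulrDl.
Qed.

Fact fps_oner_neq0 : fpsC 1 != 0.
Proof.
by apply/eqP => /(congr1 (fun f => fps_coef f 0)) /eqP; rewrite oner_eq0.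
Qed.

HB.instance Definition _ := GRing.Zmodule_isComNzRing.Build (fps A)
  fps_mulA fps_mulC fps_mul1 fps_mulDl fps_oner_neq0.

(** [F = P / Q] in a ring where [Q] need not be a unit: the quotient is
    meaningful as soon as [Q] is not a zero divisor, and is then the unique [F]
    with [F * Q = P]. *)
Definition is_quotient (B : comNzRingType) (F P Q : B) := GRing.lreg Q /\ F * Q = P.

End FormalPowerSeries.

(** A symmetric function in [x_1, x_2, ...] is a family of symmetric polynomials
    [f N] in [N] variables, of bounded degree, with
    [f N.+1 (x_1, ..., x_N, 0) = f N]. *)

Definition drop_last (F : fieldType) N : N.+1.-tuple {mpoly F[N]} :=
  [tuple if unlift ord_max i is Some j then 'X_j else 0 | i < N.+1].
Arguments drop_last {F} N.

Definition is_symfun (F : fieldType) (f : forall N, {mpoly F[N]}) :=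
  [/\ forall N, f N \is symmetric,
      forall N, f N.+1 \mPo drop_last N = f N
    & exists d, forall N, (msize (f N) <= d)%N].

Record symfun (F : fieldType) := SymFun {
  sf_val : forall N, {mpoly F[N]};
  sf_axiom : is_symfun sf_val }.

Section SymmetricFunctions.
Variable F : fieldType.
Implicit Types f g h : symfun F.

Lemma symfunP f g : (forall N, sf_val f N = sf_val g N) -> f = g.
Proof.
case: f g => [f Pf] [g Pg] /= fg.
have {}fg : f = g by apply: functional_extensionality_dep.
by case: g / fg in Pg *; congr SymFun; apply: Prop_irrelevance.
Qed.

HB.instance Definition _ := gen_eqMixin (symfun F).
HB.instance Definition _ := gen_choiceMixin (symfun F).

Fact sf_const_subproof (c : F) : is_symfun (fun N => c%:MP : {mpoly F[N]}).
Proof.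
split=> [N|N|]; first by rewrite -alg_mpolyC rpredZ // rpred1.
  exact: comp_mpolyC.
by exists 1%N => N; rewrite mmeasureC leq_b1.
Qed.
Definition sf_const c := SymFun (sf_const_subproof c).

Fact sf_add_subproof f g : is_symfun (fun N => sf_val f N + sf_val g N).
Proof.
case: f g => [f [sf cf [d df]]] [g [sg cg [e eg]]] /=; split=> [N|N|].
- by rewrite rpredD ?sf ?sg.
- by rewrite comp_mpolyD cf cg.
exists (maxn d e) => N; apply: leq_trans (msizeD_le _ _) _.
by rewrite geq_max !leq_max df eg orbT.
Qed.
Definition sf_add f g := SymFun (sf_add_subproof f g).

Fact sf_mul_subproof f g : is_symfun (fun N => sf_val f N * sf_val g N).
Proof.
case: f g => [f [sf cf [d df]]] [g [sg cg [e eg]]] /=; split=> [N|N|].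
- by rewrite rpredM ?sf ?sg.
- by rewrite rmorphM /= cf cg.
exists (d + e)%N => N; have [->|nzf] := eqVneq (f N) 0; first by rewrite mul0r msize0.
have [->|nzg] := eqVneq (g N) 0; first by rewrite mulr0 msize0.
by rewrite msizeM // (leq_trans (leq_pred _)) // leq_add.
Qed.
Definition sf_mul f g := SymFun (sf_mul_subproof f g).

Fact sf_scale_subproof c f : is_symfun (fun N => c *: sf_val f N).
Proof.
case: f => [f [sf cf [d df]]] /=; split=> [N|N|].
- by rewrite rpredZ ?sf.
- by rewrite comp_mpolyZ cf.
by exists d => N; apply: leq_trans (msizeZ_le _ _) _.
Qed.
Definition sf_scale c f := SymFun (sf_scale_subproof c f).

Fact sf_addA : associative sf_add.
Proof. by move=> f g h; apply: symfunP => N /=; rewrite addrA. Qed.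
Fact sf_addC : commutative sf_add.
Proof. by move=> f g; apply: symfunP => N /=; rewrite addrC. Qed.
Fact sf_add0 : left_id (sf_const 0) sf_add.
Proof. by move=> f; apply: symfunP => N /=; rewrite mpolyC0 add0r. Qed.
Fact sf_addN : left_inverse (sf_const 0) (sf_scale (-1)) sf_add.
Proof.
by move=> f; apply: symfunP => N /=; rewrite mpolyC0 scaleN1r addNr.
Qed.

HB.instance Definition _ :=
  GRing.isZmodule.Build (symfun F) sf_addA sf_addC sf_add0 sf_addN.

Fact sf_mulA : associative sf_mul.
Proof. by move=> f g h; apply: symfunP => N /=; rewrite mulrA. Qed.
Fact sf_mulC : commutative sf_mul.
Proof. by move=> f g; apply: symfunP => N /=; rewrite mulrC. Qed.
Fact sf_mul1 : left_id (sf_const 1) sf_mul.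
Proof. by move=> f; apply: symfunP => N /=; rewrite mpolyC1 mul1r. Qed.
Fact sf_mulDl : left_distributive sf_mul sf_add.
Proof. by move=> f g h; apply: symfunP => N /=; rewrite mulrDl. Qed.
Fact sf_oner_neq0 : sf_const 1 != 0.
Proof.
by apply/eqP => /(congr1 (fun f => sf_val f 0)) /= /eqP; rewrite mpolyC_eq oner_eq0.
Qed.

HB.instance Definition _ := GRing.Zmodule_isComNzRing.Build (symfun F)
  sf_mulA sf_mulC sf_mul1 sf_mulDl sf_oner_neq0.

Fact sf_scaleA a b f : sf_scale a (sf_scale b f) = sf_scale (a * b) f.
Proof. by apply: symfunP => N /=; rewrite scalerA. Qed.
Fact sf_scale1 : left_id 1 sf_scale.
Proof. by move=> f; apply: symfunP => N /=; rewrite scale1r. Qed.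
Fact sf_scaleDr : right_distributive sf_scale +%R.
Proof. by move=> a f g; apply: symfunP => N /=; rewrite scalerDr. Qed.
Fact sf_scaleDl f : {morph sf_scale^~ f : a b / a + b}.
Proof. by move=> a b; apply: symfunP => N /=; rewrite scalerDl. Qed.

HB.instance Definition _ := GRing.Zmodule_isLmodule.Build F (symfun F)
  sf_scaleA sf_scale1 sf_scaleDr sf_scaleDl.

Fact sf_scaleAl (a : F) f g : a *: (f * g) = (a *: f) * g.
Proof. by apply: symfunP => N /=; rewrite scalerAl. Qed.
HB.instance Definition _ := GRing.Lmodule_isLalgebra.Build F (symfun F) sf_scaleAl.
Fact sf_scaleAr (a : F) f g : a *: (f * g) = f * (a *: g).
Proof. by apply: symfunP => N /=; rewrite scalerAr. Qed.
HB.instance Definition _ := GRing.Lalgebra_isAlgebra.Build F (symfun F) sf_scaleAr.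

Fact sf_h_coef N d (m : 'X_{1..N}) :
  (\sum_(k : 'X_{1..N < d.+1} | mdeg k == d) 'X_[k] : {mpoly F[N]})@_m
  = (mdeg m == d)%:R.
Proof.
rewrite raddf_sum /=; under eq_bigr do rewrite mcoeffX.
have [md|md] := eqVneq (mdeg m) d; last first.
  by rewrite big1 // => k /eqP kd; case: eqVneq => // km; rewrite -km kd eqxx in md.
have lm : (mdeg m < d.+1)%N by rewrite md.
rewrite (bigD1 (BMultinom lm)) /= ?md // eqxx big1 ?addr0 // => k /andP[_].
by rewrite bmeqP /= => /negbTE ->.
Qed.

Fact comp_drop_lastX N (m : 'X_{1..N.+1}) :
  'X_[m] \mPo drop_last N =
  if m ord_max == 0%N then 'X_[[multinom m (lift ord_max i) | i < N]]
  else 0 :> {mpoly F[N]}.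
Proof.
rewrite comp_mpolyX (bigD1_ord ord_max) //= tnth_mktuple unlift_none.
case: (m ord_max) => [|k] /=; last by rewrite expr0n mul0r.
rewrite expr0 mul1r mpolyXE_id; apply: eq_bigr => i _.
by rewrite tnth_mktuple liftK mnmE.
Qed.

Fact sf_h_subproof d :
  is_symfun (fun N => \sum_(m : 'X_{1..N < d.+1} | mdeg m == d) 'X_[m] : {mpoly F[N]}).
Proof.
split=> [N|N|].
- by apply/issymP => s; apply/mpolyP => m; rewrite mcoeff_sym !sf_h_coef mdeg_mperm.
- rewrite raddf_sum /=; under eq_bigr do rewrite comp_drop_lastX.
  have mdeg_drop (m : 'X_{1..N.+1}) : m ord_max = 0%N ->
      mdeg [multinom m (lift ord_max i) | i < N] = mdeg m.
    move=> m0; rewrite !mdegE (bigD1_ord ord_max) //= m0 add0n.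
    by apply: eq_bigr => i _; rewrite mnmE.
  pose ext (m : 'X_{1..N}) : 'X_{1..N.+1} :=
    [multinom if unlift ord_max i is Some j then m j else 0%N | i < N.+1].
  have ext0 m : ext m ord_max = 0%N by rewrite mnmE unlift_none.
  have extK m : [multinom ext m (lift ord_max i) | i < N] = m.
    by apply/mnmP => i; rewrite !mnmE liftK.
  have mdeg_ext m : mdeg (ext m) = mdeg m by rewrite -mdeg_drop ?extK.
  apply/mpolyP => k; rewrite sf_h_coef raddf_sum /=.
  have [kd|kd] := eqVneq (mdeg k) d; last first.
    rewrite big1 // => m /eqP md; case: eqP => [m0|]; last by rewrite mcoeff0.
    rewrite mcoeffX; case: eqVneq => // mk.
    by rewrite -mk mdeg_drop // md eqxx in kd.
  have lk : (mdeg (ext k) < d.+1)%N by rewrite mdeg_ext kd.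
  rewrite (bigD1 (BMultinom lk)) /= ?mdeg_ext ?kd // ext0 eqxx mcoeffX extK eqxx.
  rewrite big1 ?addr0 // => m /andP[_]; rewrite bmeqP /= => mk.
  case: eqP => [m0|]; last by rewrite mcoeff0.
  rewrite mcoeffX; case: eqVneq => // km; case/eqP: mk.
  apply/mnmP => i; rewrite mnmE; case: unliftP => [j ->|->] //.
  by rewrite -km mnmE.
exists d.+1 => N; apply: leq_trans (mmeasure_sum _ _ _ _) _; apply/bigmax_leqP => m /eqP md.
by rewrite msizeX md.
Qed.
Definition sf_h d : symfun F := SymFun (sf_h_subproof d).

Fact sf_pS_subproof k : is_symfun (fun N => \sum_(i < N) 'X_i ^+ k.+1 : {mpoly F[N]}).
Proof.
split=> [N|N|].
- apply/issymP => s; rewrite raddf_sum [RHS](reindex_inj (@perm_inj _ s)) /=.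
  apply: eq_bigr => i _; rewrite rmorphXn /= msymX; congr ('X_[_] ^+ _).
  by apply/mnmP => j; rewrite !mnmE -(inj_eq (@perm_inj _ s)) permKV.
- rewrite raddf_sum /= (bigD1_ord ord_max) //= rmorphXn /= comp_mpolyXU.
  rewrite -tnth_nth tnth_mktuple unlift_none expr0n add0r.
  by apply: eq_bigr => i _; rewrite rmorphXn /= comp_mpolyXU -tnth_nth tnth_mktuple liftK.
exists k.+2 => N; apply: leq_trans (mmeasure_sum _ _ _ _) _; apply/bigmax_leqP => i _.
have Xk : ('X_i : {mpoly F[N]}) ^+ k.+1 = 'X_[U_(i) *+ k.+1] by rewrite mpolyXn.
by rewrite Xk msizeX mdegMn mdeg1 mul1n.
Qed.
(** The power sum [p_(k+1)]; the index is shifted because [p_0] does not exist. *)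
Definition sf_pS k : symfun F := SymFun (sf_pS_subproof k).

(** [p_mu] for [mu] the cycle type of [s]. *)
Definition sf_p_cycle n (s : 'S_n) : symfun F := \prod_(c in porbits s) sf_pS #|c|.-1.

(** The characteristic map; with this normalization the trivial representation
    goes to [h_n]. *)
Definition frobenius_ch n d (rG : mx_representation F [set: 'S_n] d) : symfun F :=
  (n`!%:R)^-1 *: \sum_(s : 'S_n) \tr (rG s) *: sf_p_cycle s.

(** [H(x; z)] and [H(x; t z)], with [t] the polynomial variable ['X]. *)
Definition Hz : fps {poly symfun F} := Fps (fun n => (sf_h n)%:P).
Definition Htz : fps {poly symfun F} := Fps (fun n => sf_h n *: 'X^n).

End SymmetricFunctions.

Definition ideal_gen (A : comNzRingType) (gs : seq A) (f : A) : Prop :=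
  exists c : nat -> A, f = \sum_(j < size gs) c j * gs`_j.

Section IdealGen.
Variable A : comNzRingType.
Implicit Types gs hs : seq A.

Fact ideal_gen0 gs : ideal_gen gs 0.
Proof. by exists (fun=> 0); rewrite big1 // => j _; rewrite mul0r. Qed.

Fact ideal_genD gs f g : ideal_gen gs f -> ideal_gen gs g -> ideal_gen gs (f + g).
Proof.
move=> [c ->] [d ->]; exists (fun j => c j + d j).
by rewrite -big_split; apply: eq_bigr => j _; rewrite mulrDl.
Qed.

Fact ideal_genM gs a f : ideal_gen gs f -> ideal_gen gs (a * f).
Proof.
move=> [c ->]; exists (fun j => a * c j).
by rewrite mulr_sumr; apply: eq_bigr => j _; rewrite mulrA.
Qed.

Fact ideal_gen_mem gs g : g \in gs -> ideal_gen gs g.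
Proof.
move=> gs_g; have lt_g : (index g gs < size gs)%N by rewrite index_mem.
exists (fun j => (j == index g gs)%:R).
rewrite (bigD1 (Ordinal lt_g)) //= eqxx mul1r nth_index // big1 ?addr0 //.
by move=> j /negbTE; rewrite -val_eqE /= => ->; rewrite mul0r.
Qed.

Fact ideal_gen_morph (phi : {rmorphism A -> A}) gs hs :
    (forall g, g \in gs -> ideal_gen hs (phi g)) ->
  forall f, ideal_gen gs f -> ideal_gen hs (phi f).
Proof.
move=> gsP f [c ->]; rewrite raddf_sum /=.
elim/big_ind: _ => [|x y|j _]; [exact: ideal_gen0 | exact: ideal_genD |].
by rewrite rmorphM; apply/ideal_genM/gsP/mem_nth.
Qed.

End IdealGen.

Lemma ex_rowspace (F : fieldType) k (P : 'rV[F]_k -> Prop) :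
    P 0 -> (forall a u v, P u -> P v -> P (a *: u + v)) ->
  exists U : 'M[F]_k, forall u, P u <-> (u <= U)%MS.
Proof.
move=> P0 Plin.
pose good (U : 'M[F]_k) := forall u, (u <= U)%MS -> P u.
pose q r := `[< exists U, good U /\ \rank U = r >].
have q0 : exists r, q r.
  exists 0%N; apply/asboolP; exists 0; split; last exact: mxrank0.
  by move=> u; rewrite submx0 => /eqP ->.
have qk r : q r -> (r <= k)%N by move=> /asboolP[U [_ <-]]; exact: rank_leq_col.
case: (ex_maxnP q0 qk) => r /asboolP[U [gU rU]] max_r; exists U => u.
split=> [Pu|/gU//]; apply: contraT => nUu.
have /max_r : q (\rank (u + U)%MS).
  apply/asboolP; exists (u + U)%MS; split => // v /sub_addsmxP[[a b] /= ->].
  have /sub_rVP[c ->] : (a *m u <= u)%MS by exact: submxMl.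
  by apply: Plin => //; apply: gU; exact: submxMl.
have : (U < u + U)%MS by rewrite ltmxE addsmxSr addsmx_sub submx_refl andbT.
by move/rank_ltmx; rewrite rU ltnNge => /negbTE ->.
Qed.

Section Homogeneous.
Variables (F : fieldType) (N d : nat).

(** The monomials of degree [d] index the coordinates of the space [S_d] of
    homogeneous polynomials of degree [d] in [N] variables. *)
Definition hmon := {m : 'X_{1..N < d.+1} | mdeg m == d}.
Definition hdim := #|{: hmon}|.
Definition hmnm (j : 'I_hdim) : 'X_{1..N} := val (enum_val j).

Definition hpoly (u : 'rV[F]_hdim) : {mpoly F[N]} := \sum_j u 0 j *: 'X_[hmnm j].
Definition hcoord (p : {mpoly F[N]}) : 'rV[F]_hdim := \row_j p@_(hmnm j).

Fact hmnm_inj : injective hmnm.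
Proof. by move=> i j /val_inj /val_inj /enum_val_inj. Qed.

Fact mdeg_hmnm j : mdeg (hmnm j) = d.
Proof. exact/eqP/(valP (enum_val j)). Qed.

Fact hmnmP (m : 'X_{1..N}) : mdeg m = d -> exists j, hmnm j = m.
Proof.
move=> /eqP md; have lt_md : (mdeg m < d.+1)%N by rewrite (eqP md).
have md' : mdeg (BMultinom lt_md) == d by [].
by exists (enum_rank (Sub (BMultinom lt_md) md' : hmon)); rewrite /hmnm enum_rankK.
Qed.

Fact hpolyK : cancel hpoly hcoord.
Proof.
move=> u; apply/rowP => j; rewrite mxE raddf_sum /= (bigD1 j) //=.
rewrite mcoeffZ mcoeffX eqxx mulr1 big1 ?addr0 // => i ij.
by rewrite mcoeffZ mcoeffX (inj_eq hmnm_inj) (negbTE ij) mulr0.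
Qed.

Fact hcoordK p : p \is d.-homog -> hpoly (hcoord p) = p.
Proof.
move=> hp; apply/mpolyP => m; have [md|md] := eqVneq (mdeg m) d; last first.
  rewrite (dhomog_nemf_coeff hp) // raddf_sum /= big1 // => j _.
  rewrite mcoeffZ mcoeffX; case: eqVneq => [jm|]; last by rewrite mulr0.
  by rewrite -jm mdeg_hmnm eqxx in md.
by have [j <-] := hmnmP md; have /rowP/(_ j) := hpolyK (hcoord p); rewrite !mxE.
Qed.

Fact hpoly_homog u : hpoly u \is d.-homog.
Proof.
rewrite rpred_sum // => j _; rewrite rpredZ // dhomogX; apply/eqP.
exact: mdeg_hmnm.
Qed.

Fact hpolyP a u v : hpoly (a *: u + v) = a *: hpoly u + hpoly v.
Proof.
rewrite /hpoly scaler_sumr -big_split; apply: eq_bigr => j _.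
by rewrite !mxE scalerDl scalerA.
Qed.

Fact ex_hideal (gs : seq {mpoly F[N]}) :
  exists U : 'M[F]_hdim, forall u, ideal_gen gs (hpoly u) <-> (u <= U)%MS.
Proof.
apply: ex_rowspace => [|a u v Pu Pv].
  have -> : hpoly 0 = 0 by rewrite /hpoly big1 // => j _; rewrite mxE scale0r.
  exact: ideal_gen0.
by rewrite hpolyP -mul_mpolyC; apply: ideal_genD => //; apply: ideal_genM.
Qed.

(** The intersection of [S_d] with the ideal generated by [gs]. *)
Definition hideal gs : 'M[F]_hdim := projT1 (cid (ex_hideal gs)).

Lemma hidealP gs u : (u <= hideal gs)%MS <-> ideal_gen gs (hpoly u).
Proof. by rewrite /hideal; case: (cid _) => U /= ->. Qed.

End Homogeneous.

(** A finite simplicial complex with a simplicial action of a group [G] of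
    permutations of the coordinates of [R^n], and positions in [R^n] of its
    vertices. The constructions below use no further property of the
    triangulations of the simplex. *)
Record symmetric_complex (R : realType) n (G : {group 'S_n}) := SymmetricComplex {
  vtx : finType;
  pos : vtx -> 'rV[R]_n;
  face : pred {set vtx};
  vact : action G vtx;
  face_set0 : face set0;
  face_set1 : forall v, face [set v];
  face_subset : forall A B : {set vtx}, A \subset B -> face B -> face A;
  face_act : forall s (A : {set vtx}), s \in G -> face (vact^* A s)%act = face A;
  pos_act : forall s v i, s \in G -> pos (vact v s) 0 (s i) = pos v 0 i }.

(** [iota] is the inclusion of the real numbers into the complex numbers in the
    statement; the construction makes sense for any field [F]. *)
Section FaceRing.
Variables (R : realType) (F : fieldType) (iota : {rmorphism R -> F}).
Variables (n : nat) (G : {group 'S_n}) (Gamma : symmetric_complex R G).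
Local Notation N := #|vtx Gamma|.
Local Notation S := {mpoly F[N]}.

Definition xvar (v : vtx Gamma) : S := 'X_(enum_rank v).
Definition xmon (A : {set vtx Gamma}) : S := \prod_(v in A) xvar v.
Definition theta (i : 'I_n) : S := \sum_v iota (pos v 0 i) *: xvar v.

(** The face [A] lies in the face [conv {e_i : i in W}] of the simplex. *)
Definition in_simplex_face (W : {set 'I_n}) (A : {set vtx Gamma}) :=
  [forall v in A, forall i, (i \notin W) ==> (pos v 0 i == 0)].
Definition interior_face (A : {set vtx Gamma}) :=
  face A && ~~ [exists W : {set 'I_n}, (W != setT) && in_simplex_face W A].

(** [C(Gamma)] is [C[Gamma] / Theta = S / (I_Gamma + (theta_1, ..., theta_n))];
    [quot_gens] generates this ideal of [S], and [local_gens] the preimage in [S]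
    of the local face module. *)
Definition quot_gens : seq S :=
  [seq xmon A | A : {set vtx Gamma} <- enum {set vtx Gamma} & ~~ face A]
  ++ [seq theta i | i <- enum 'I_n].
Definition local_gens : seq S :=
  [seq xmon A | A : {set vtx Gamma} <- enum {set vtx Gamma} & interior_face A]
  ++ quot_gens.

(** [x_v] is sent to [x_(v s)]: as everywhere in this file the action is on the
    right, since [(s * t) i = t (s i)] for permutations. *)
Definition sact (s : 'S_n) (p : S) : S :=
  p \mPo [tuple xvar (vact Gamma (enum_val i) s) | i < N].

HB.instance Definition _ s := GRing.RMorphism.copy (sact s)
  (comp_mpoly [tuple xvar (vact Gamma (enum_val i) s) | i < N]).

Fact sactZ s a p : sact s (a *: p) = a *: sact s p.
Proof. exact: comp_mpolyZ. Qed.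

Fact sact_sum s I (r : seq I) (P : pred I) (f : I -> S) :
  sact s (\sum_(i <- r | P i) f i) = \sum_(i <- r | P i) sact s (f i).
Proof. exact: raddf_sum. Qed.

Fact sact_xvar s v : sact s (xvar v) = xvar (vact Gamma v s).
Proof. by rewrite /sact comp_mpolyXU -tnth_nth tnth_mktuple enum_rankK. Qed.

Fact sact1 p : sact 1 p = p.
Proof.
have X1 : [tuple xvar (vact Gamma (enum_val i) 1%g) | i < N] = [tuple 'X_i | i < N].
  by apply: eq_mktuple => j; rewrite act1 /xvar enum_valK.
by rewrite /sact X1 comp_mpoly_id.
Qed.

Fact sactM s t p : s \in G -> t \in G -> sact (s * t)%g p = sact t (sact s p).
Proof.
move=> Gs Gt; rewrite (mpolyE p) (sact_sum (s * t)%g) (sact_sum s) (sact_sum t).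
apply: eq_bigr => m _; rewrite (sactZ (s * t)%g) (sactZ s) (sactZ t); congr (_ *: _).
have sactX r (f : 'I_N -> S) :
    sact r (\prod_(i < N) f i ^+ m i) = \prod_(i < N) sact r (f i) ^+ m i.
  by rewrite /sact rmorph_prod; apply: eq_bigr => j _; exact: rmorphXn.
have sactV v : sact (s * t)%g (xvar v) = sact t (sact s (xvar v)).
  by rewrite (sact_xvar (s * t)%g) (sact_xvar s) (sact_xvar t) actMin.
rewrite mpolyXE_id (sactX (s * t)%g) (sactX s) (sactX t); apply: eq_bigr => j _.
have -> : 'X_j = xvar (enum_val j) by rewrite /xvar enum_valK.
by rewrite sactV.
Qed.

Fact sact_xmon s A : sact s (xmon A) = xmon ((vact Gamma)^* A s)%act.
Proof.
rewrite /sact rmorph_prod /= [RHS]big_imset; last by move=> ? ? _ _ /act_inj.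
by apply: eq_bigr => v _; exact: sact_xvar.
Qed.

Fact sact_theta s i : s \in G -> sact s (theta i) = theta (s i).
Proof.
move=> Gs; rewrite /sact raddf_sum /= [RHS](reindex_inj (act_inj (vact Gamma) s)) /=.
by apply: eq_bigr => v _; rewrite comp_mpolyZ pos_act // -sact_xvar.
Qed.

Fact in_simplex_face_act s (W : {set 'I_n}) A : s \in G ->
  in_simplex_face (s @: W) ((vact Gamma)^* A s)%act = in_simplex_face W A.
Proof.
move=> Gs; apply/forall_inP/forall_inP => WA v Av; apply/forallP => i.
  have := forallP (WA _ (imset_f (vact Gamma ^~ s) Av)) (s i).
  by rewrite mem_imset ?pos_act //; exact: perm_inj.
have /imsetP[w Aw ->] := Av; have := forallP (WA w Aw) ((s^-1)%g i).
rewrite -(pos_act _ _ Gs) permKV -(mem_imset _ _ (@perm_inj _ s)) permKV.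
exact.
Qed.

Fact interior_face_act s A : s \in G ->
  interior_face A -> interior_face ((vact Gamma)^* A s)%act.
Proof.
move=> Gs /andP[fA intA]; rewrite /interior_face face_act // fA /=.
apply: contra intA => /existsP[W /andP[WT WA]]; apply/existsP.
exists (s @^-1: W).
have sW : s @: (s @^-1: W) = W.
  by apply/setP => j; rewrite -[j](permKV s) mem_imset ?inE //; exact: perm_inj.
rewrite -(in_simplex_face_act _ _ Gs) sW WA andbT.
by apply: contra WT => /eqP WT; rewrite -sW WT; apply/eqP/setP => j;
   rewrite -[j](permKV s) mem_imset ?inE //; exact: perm_inj.
Qed.

Fact quot_gens_act s g : s \in G -> g \in quot_gens -> ideal_gen quot_gens (sact s g).
Proof.
move=> Gs; rewrite mem_cat => /orP[] /mapP[x].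
  rewrite mem_filter => /andP[nfx _] ->; rewrite sact_xmon; apply: ideal_gen_mem.
  by rewrite mem_cat map_f // mem_filter face_act // nfx mem_enum.
move=> _ ->; rewrite sact_theta //; apply: ideal_gen_mem.
by rewrite mem_cat orbC map_f // mem_enum.
Qed.

Fact local_gens_act s g :
  s \in G -> g \in local_gens -> ideal_gen local_gens (sact s g).
Proof.
move=> Gs; rewrite mem_cat => /orP[/mapP[x]|gq].
  rewrite mem_filter => /andP[ix _] ->; rewrite sact_xmon; apply: ideal_gen_mem.
  by rewrite mem_cat map_f // mem_filter interior_face_act // mem_enum.
apply: (@ideal_gen_morph _ idfun quot_gens) (quot_gens_act Gs gq) => h hq.
by apply: ideal_gen_mem; rewrite mem_cat hq orbT.
Qed.

Section Degree.
Variable d : nat.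

Definition sact_mx (s : 'S_n) : 'M[F]_(hdim N d) :=
  \matrix_(i, j) (sact s 'X_[hmnm i])@_(hmnm j).

Fact sact_homog s p : p \is d.-homog -> sact s p \is d.-homog.
Proof.
move=> hp; rewrite /sact comp_mpolyEX big_seq rpred_sum // => m mp.
rewrite rpredZ // comp_mpolyX -(dhomog_mf hp mp) /= mdegE.
elim/big_ind2: _ => [|p1 d1 p2 d2 h1 h2|i _]; first exact: dhomog1.
  exact: dhomogM.
have h : xvar (vact Gamma (enum_val i) s) \is 1.-homog by rewrite dhomogX /= mdeg1.
by rewrite tnth_mktuple; have := dhomogMn (m i) h; rewrite mul1n.
Qed.

Fact sact_mxE s u : hpoly (u *m sact_mx s) = sact s (hpoly u).
Proof.
rewrite -[RHS](@hcoordK _ _ d) ?sact_homog ?hpoly_homog //; congr hpoly.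
apply/rowP => j; rewrite !mxE /hpoly sact_sum raddf_sum /=.
by apply: eq_bigr => i _; rewrite mxE sactZ mcoeffZ.
Qed.

Fact hpoly_mx_inj (A B : 'M[F]_(hdim N d)) :
  (forall u, hpoly (u *m A) = hpoly (u *m B)) -> A = B.
Proof.
move=> AB; apply/row_matrixP => i; rewrite !rowE.
exact/(can_inj (@hpolyK F N d))/AB.
Qed.

Fact sact_repr : mx_repr G sact_mx.
Proof.
split=> [|s t Gs Gt]; apply: hpoly_mx_inj => u; first by rewrite sact_mxE sact1 mulmx1.
rewrite mulmxA; apply: etrans (sact_mxE (s * t)%g u) _; rewrite sactM //.
by apply/esym/(etrans (sact_mxE t _)); rewrite (sact_mxE s).
Qed.

Definition poly_repr := MxRepresentation sact_repr.

Fact hideal_module gs :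
    (forall s g, s \in G -> g \in gs -> ideal_gen gs (sact s g)) ->
  mxmodule poly_repr (hideal d gs).
Proof.
move=> gsP; apply/mxmoduleP => s Gs; apply/row_subP => i; rewrite row_mul.
apply/hidealP; rewrite sact_mxE; apply: ideal_gen_morph (gsP s ^~ Gs) _ _.
exact/hidealP/row_sub.
Qed.

Definition quot_module := hideal_module quot_gens_act.
Definition local_module := hideal_module local_gens_act.

(** The degree [d] components of [C(Gamma)] and of the local face module, as
    representations of [G]; the second one is the image of [local_gens] in the
    first. *)
Definition face_quot_repr : representation F G :=
  Representation (factmod_repr quot_module).
Definition local_face_repr : representation F G :=
  Representation (section_repr quot_module local_module).

End Degree.

(** The equality of classes in the representation ring is stated in each degree
    [i] as an isomorphism of representations; the coefficient of [t^i] in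
    [t^k (1 + t)^(n - 2k)] is the multiplicity of [M k]. *)
Definition local_equivariant_gal :=
  exists M : nat -> representation F G,
  forall i, (i <= n)%N ->
    mx_rsim (local_face_repr i)
      (\big[dadd_grepr/grepr0]_(k < n./2.+1)
         muln_grepr (M k) (('X^k * (1 + 'X) ^+ (n - k.*2) : {poly nat})`_i)%R).

End FaceRing.

Definition ch_gf (F : fieldType)
    (V : forall n, nat -> representation F [set: 'S_n]) : fps {poly symfun F} :=
  Fps (fun n => if n is 0 then 1 else \sum_(i < n.+1) frobenius_ch (V n i) *: 'X^i).

Section CubicalBarycentric.
Variable n : nat.

(** A pair [(A, B)] stands for the closed interval [[A, B]] of nonempty subsets
    of ['I_n]. *)
Definition interval :=
  {AB : {set 'I_n} * {set 'I_n} | (AB.1 != set0) && (AB.1 \subset AB.2)}.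

Definition interval_set (I : interval) : {set {set 'I_n}} :=
  [set D : {set 'I_n} | ((val I).1 \subset D) && (D \subset (val I).2)].

Definition interval_chain (X : {set interval}) :=
  [forall I in X, forall J in X,
     (interval_set I \subset interval_set J) || (interval_set J \subset interval_set I)].

Fact interval_act_subproof (I : interval) (s : 'S_n) :
  (s @: (val I).1 != set0) && (s @: (val I).1 \subset s @: (val I).2).
Proof.
by case: I => -[A B] /= /andP[A0 AB]; rewrite imset_eq0 A0 imsetS.
Qed.
Definition interval_act (I : interval) (s : 'S_n) : interval :=
  exist (fun AB : {set 'I_n} * {set 'I_n} => (AB.1 != set0) && (AB.1 \subset AB.2))
    (s @: (val I).1, s @: (val I).2) (interval_act_subproof I s).

Fact perm_imsetM (s t : 'S_n) (A : {set 'I_n}) : (s * t)%g @: A = t @: (s @: A).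
Proof. by rewrite -imset_comp; apply: eq_imset => i; rewrite /= permM. Qed.

Fact perm_imset1 (A : {set 'I_n}) : (1%g : 'S_n) @: A = A.
Proof. by rewrite -[RHS]imset_id; apply: eq_imset => i; rewrite perm1. Qed.

Fact interval_act1 I : interval_act I 1%g = I.
Proof. by case: I => -[A B] AB; apply: val_inj; rewrite /= !perm_imset1. Qed.

Fact interval_actM I s t : interval_act I (s * t)%g = interval_act (interval_act I s) t.
Proof. by apply: val_inj; rewrite /= !perm_imsetM. Qed.

Definition interval_action : action [set: 'S_n] interval :=
  TotalAction interval_act1 interval_actM.

Fact interval_set_act I s :
  interval_set (interval_act I s) = [set s @: D | D : {set 'I_n} in interval_set I].
Proof.
have imS (A B : {set 'I_n}) : (s @: A \subset s @: B) = (A \subset B).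
  apply/idP/idP => [AB|]; last exact: imsetS.
  apply/subsetP => i Ai; have := subsetP AB _ (imset_f s Ai).
  by rewrite mem_imset //; exact: perm_inj.
apply/setP => D; have -> : D = s @: (s^-1%g @: D) by rewrite -perm_imsetM mulVg perm_imset1.
by rewrite mem_imset ?inE /= ?imS //; apply: imset_inj; exact: perm_inj.
Qed.

Fact interval_chain0 : interval_chain set0.
Proof. by apply/forall_inP => I; rewrite inE. Qed.

Fact interval_chain1 I : interval_chain [set I].
Proof.
by apply/forall_inP => J /set1P->; apply/forall_inP => K /set1P->; rewrite subxx.
Qed.

Fact interval_chainS (X Y : {set interval}) :
  X \subset Y -> interval_chain Y -> interval_chain X.
Proof.
move=> /subsetP XY /forall_inP cY; apply/forall_inP => I /XY YI.
by apply/forall_inP => J /XY YJ; apply: (forall_inP (cY I YI)).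
Qed.

Fact interval_chain_act s (X : {set interval}) : s \in [set: 'S_n] ->
  interval_chain (interval_action^* X s)%act = interval_chain X.
Proof.
have actS t Y : interval_chain Y -> interval_chain (interval_action^* Y t)%act.
  move=> /forall_inP cY; apply/forall_inP => _ /imsetP[I YI ->].
  apply/forall_inP => _ /imsetP[J YJ ->]; rewrite !interval_set_act.
  by have /orP[IJ|IJ] := forall_inP (cY I YI) J YJ; apply/orP; [left|right]; exact: imsetS.
move=> _; apply/idP/idP => [|/actS//].
by move=> /(actS s^-1%g); rewrite actK.
Qed.

Variable R : realType.

Definition barycenter (D : {set 'I_n}) : 'rV[R]_n :=
  #|D|%:R^-1 *: \sum_(i in D) delta_mx 0 i.

(** The barycenter of the cubical face of [I], whose vertices are the barycenters
    of the [D] in [I]. *)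
Definition interval_pos (I : interval) : 'rV[R]_n :=
  #|interval_set I|%:R^-1 *: \sum_(D in interval_set I) barycenter D.

Fact interval_pos_act s I i : s \in [set: 'S_n] ->
  interval_pos (interval_action I s) 0 (s i) = interval_pos I 0 i.
Proof.
move=> _; rewrite !mxE interval_set_act card_imset; last exact/imset_inj/perm_inj.
congr (_ * _); rewrite big_imset; last by move=> ? ? _ _; apply/imset_inj/perm_inj.
rewrite !summxE; apply: eq_bigr => D _; rewrite !mxE card_imset; last exact: perm_inj.
congr (_ * _); rewrite big_imset; last by move=> ? ? _ _; apply: perm_inj.
rewrite !summxE; apply: eq_bigr => j _; rewrite !mxE !eqxx.
by rewrite (inj_eq (@perm_inj _ s)).
Qed.

Definition Kn : symmetric_complex R [set: 'S_n] :=
  SymmetricComplex interval_chain0 interval_chain1 interval_chainS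
    interval_chain_act interval_pos_act.

End CubicalBarycentric.

(* Main.v *)
Require Import Defs.
From HB Require Import structures.
From mathcomp Require Import all_boot all_order all_algebra all_fingroup.
From mathcomp Require Import all_character all_solvable all_field.
From mathcomp Require Import mpoly complex.
From mathcomp Require Import boolp reals.
From mathcomp Require Import ring zify.

Set Implicit Arguments.
Unset Strict Implicit.
Unset Printing Implicit Defensive.

Import Order.TTheory GRing.Theory Num.Theory.
Local Open Scope ring_scope.

(** All graded pieces are handled through their characters: the trace of each permutation $s$ is
    computed in every degree, and the characteristic map assembles the traces.

    Face ring modulo $\Theta$. Over the face $W$ of the simplex, the facets of [Kn] correspond to
    signed words: orderings of $W$ with signs, the first sign being negative, each letter shrinking
    the current interval at one of its ends. Lexicographic order is a shelling whose restriction
    sets are read off from descents ([words_shelling]). The $\theta_i$, $i\in W$, are independent on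
    every facet ([theta_comb_facet]), hence form a regular sequence ([mspan_full_regular]). Their
    span has an eigenbasis for $s$ with $\prod(1-\lambda t)=\prod_c(1-t^{|c|})$ over the cycles $c$
    of $s$ in $W$, so the trace series of the quotient is this product times that of the face ring
    ([qser_tw]). The latter counts the multichains of intervals fixed by $s$: with $m$ cycles there
    are $(2d+1)^m-(2d)^m$ in degree $d>0$ ([qser_nf_coef]).

    Local face module. Filter the quotient over $W$ by the size of carriers. The graded pieces are
    direct sums of the local face modules of the subsets $U$ of $W$ ([filt_split]). The crux is
    [local_cap]: an element of the interior ideal that lies in $\Theta$ is, modulo non-faces, a
    combination of products of $\theta_i$ with monomials whose carrier contains $W\setminus\{i\}$.
    Inverting the resulting sum over $s$-stable subsets lowers by 1 the factor of each cycle
    ([expl_sum], [lser_agree]).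

    Generating functions. Averages over $\mathfrak{S}_n$ of products over cycles obey the functional
    equation of the exponential ([HsD]), and $H(z)$ is the exponential of the power sums. With
    $U=H(z)/H(tz)$ and $V=1$, respectively $V=1/H(z)$, both series take the form $\sum_d
    t^d(U^{2d+1}-U^{2d})V+V$, which is summed by [geometric_identity].

    Gal phenomenon. Put $t=q^2$. The second quotient is the even part in $q$ of
    $$\frac{1-q}{H(q^2z)-qH(z)}=\frac1{1-\sum_{m>0}\beta_mh_mz^m},\qquad
    \beta_m=q+q^2+\dots+q^{2m-1}.$$ Expanding gives a sum over compositions of permutation
    characters on flags of subsets ([gser_flagsum]). Each of these is a sum of ribbon characters
    ([sum_ribbon]), and the total coefficient of a ribbon is a nonnegative combination of the
    $q^j(1+q^2)^{n-j}$ ([machine_nonneg]). The even part keeps $j=2k$, that is $t^k(1+t)^{n-2k}$.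
    Equality of characters gives an isomorphism by [mx_rsim_trace]. *)

(** * Traces on stable subspaces and on their quotients *)

Section SubspaceTrace.
Variable F : fieldType.

(** The trace of [A] on the row space of [U], meaningful when that space is [A]-stable. Traces on
    subquotients then become differences of such traces, without any quotient space. *)
Definition trU n m (A : 'M[F]_n) (U : 'M[F]_(m, n)) : F :=
  \tr (row_base U *m A *m pinvmx (row_base U)).

Lemma trU_basis n m r (A : 'M[F]_n) (U : 'M[F]_(m, n)) (X : 'M[F]_(r, n)) (Y : 'M[F]_r) :
  row_free X -> (X :=: U)%MS -> X *m A = Y *m X -> trU A U = \tr Y.
Proof.
move=> fX XU XA; set B := row_base U.
have BX : (B :=: X)%MS by apply: eqmx_trans (eq_row_base U) (eqmx_sym XU).
have /submxP[G BG] : (B <= X)%MS by rewrite BX.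
have /submxP[G' XG'] : (X <= B)%MS by rewrite BX.
have G'G : G' *m G = 1%:M.
  by apply: (row_free_inj fX); rewrite -mulmxA -BG -XG' mul1mx.
have -> : trU A U = \tr (G *m Y *m G' *m (B *m pinvmx B)).
  by rewrite /trU -/B {1}BG -(mulmxA G) XA {1}XG' !mulmxA.
by rewrite mulmxVp ?row_base_free // mulmx1 -mulmxA mxtrace_mulC -mulmxA G'G mulmx1.
Qed.

Lemma trU_eqmx n m1 m2 (A : 'M[F]_n) (U : 'M[F]_(m1, n)) (V : 'M[F]_(m2, n)) :
  (U :=: V)%MS -> (U *m A <= U)%MS -> trU A U = trU A V.
Proof.
move=> UV UA; have sB : (row_base U *m A <= row_base U)%MS.
  by rewrite (eqmxMr _ (eq_row_base U)) eq_row_base.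
rewrite [RHS](@trU_basis _ _ _ _ _ (row_base U) (row_base U *m A *m pinvmx (row_base U))) //.
- exact: row_base_free.
- exact: eqmx_trans (eq_row_base U) UV.
by rewrite mulmxKpV.
Qed.

Lemma trU1 n (A : 'M[F]_n) : trU A (1%:M : 'M_n) = \tr A.
Proof.
by apply: (@trU_basis _ _ _ _ _ 1%:M); rewrite ?row_free_unit ?unitmx1 ?mul1mx ?mulmx1.
Qed.

(* The rows of [X] are a basis of [V] modulo [E], and [Y] is the matrix of [A]
   in it. *)
Lemma trU_rel n m1 m2 r (A : 'M[F]_n) (V : 'M[F]_(m1, n)) (E : 'M[F]_(m2, n))
    (X : 'M[F]_(r, n)) (Y : 'M[F]_r) :
    (E *m A <= E)%MS -> (E <= V)%MS -> (X <= V)%MS -> (V <= E + X)%MS ->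
    (forall u : 'rV_r, (u *m X <= E)%MS -> u = 0) ->
    (X *m A - Y *m X <= E)%MS ->
  trU A V - trU A E = \tr Y.
Proof.
move=> EA EV XV VEX Xfree XAY; pose B := row_base E.
have BE : (B :=: E)%MS := eq_row_base E.
pose YE := B *m A *m pinvmx B.
have BA : B *m A = YE *m B by rewrite mulmxKpV // (eqmxMr _ BE) BE.
have /submxP[Z ZB] : (X *m A - Y *m X <= B)%MS by rewrite BE.
suff -> : trU A V = \tr (block_mx YE 0 Z Y) by rewrite mxtrace_block addrC addKr.
apply: (@trU_basis _ _ _ _ _ (col_mx B X)).
- apply/row_freeP/row_freeP; rewrite -kermx_eq0; apply/eqP/row_matrixP => i.
  set u := row i _; have : u *m col_mx B X = 0.
    by rewrite -row_mul mulmx_ker row0.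
  rewrite -[u]hsubmxK mul_row_col row0 => /eqP; rewrite addr_eq0 => /eqP uB.
  have u2 : rsubmx u = 0.
    by apply: Xfree; rewrite -[_ *m X]opprK -uB -BE -mulNmx submxMl.
  have u1 : lsubmx u = 0.
    apply: (row_free_inj (row_base_free E)); rewrite -/B uB u2 !mul0mx oppr0 //.
  by rewrite u1 u2 row_mx0.
- apply/eqmxP; rewrite -addsmxE addsmx_sub BE EV XV /=.
  by apply: submx_trans VEX _; rewrite -addsmxE addsmxS // BE.
rewrite mul_col_mx mul_block_col mul0mx addr0 BA; congr col_mx.
by rewrite -ZB subrK.
Qed.

Lemma diffmx_rel n m1 m2 (P : 'M[F]_(m1, n)) (P' : 'M[F]_(m2, n)) (X := row_base (P :\: P')%MS) :
  (P' <= P)%MS ->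
  [/\ (X <= P)%MS, (P <= P' + X)%MS & forall u : 'rV_(\rank (P :\: P')%MS), (u *m X <= P')%MS -> u = 0].
Proof.
move=> sP; have XD : (X :=: P :\: P')%MS := eq_row_base _.
split; first by rewrite XD diffmxSl.
  rewrite addsmxC -(addsmx_diff_cap_eq P P') addsmxS ?XD //.
  by rewrite capmxC; apply/capmxSl.
move=> u uX; apply: (row_free_inj (row_base_free (P :\: P')%MS)).
rewrite mul0mx; apply/eqP; rewrite -submx0.
apply: submx_trans (_ : ((P :\: P') :&: P' <= 0)%MS); last by rewrite capmx_diff.
by rewrite sub_capmx uX -XD submxMl.
Qed.

(** [f] induces an isomorphism from [P / P'] onto [Q / Q'] under which [B] corresponds to [lam]
    times [A]. The scalar accommodates multiplication by a linear form that is an eigenvector of the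
    group element. *)
Lemma trU_iso n k m1 m2 m3 m4 (A : 'M[F]_n) (B : 'M[F]_k) (P : 'M[F]_(m1, n))
    (P' : 'M[F]_(m2, n)) (Q : 'M[F]_(m3, k)) (Q' : 'M[F]_(m4, k)) (f : 'M[F]_(n, k)) lam :
    (P' <= P)%MS -> (P' *m A <= P')%MS -> (P *m A <= P)%MS ->
    (Q' <= Q)%MS -> (Q' *m B <= Q')%MS ->
    (P *m f <= Q)%MS -> (P' *m f <= Q')%MS -> (Q <= Q' + P *m f)%MS ->
    (forall u : 'rV_n, (u <= P)%MS -> (u *m f <= Q')%MS -> (u <= P')%MS) ->
    (P *m (f *m B - lam *: (A *m f)) <= Q')%MS ->
  trU B Q - trU B Q' = lam * (trU A P - trU A P').
Proof.
move=> sP P'A PA sQ Q'B Pf P'f Qf finj fAB.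
have [XP PX Xfree] := diffmx_rel sP; set X := row_base _ in XP PX Xfree.
have /sub_addsmxP[[a Y] /= XA] : (X *m A <= P' + X)%MS.
  exact: submx_trans (submx_trans (submxMr A XP) PA) PX.
rewrite (@trU_rel _ _ _ _ A P P' X Y) //; last first.
  by rewrite XA addrK submxMl.
rewrite -mxtraceZ; apply: (@trU_rel _ _ _ _ _ _ _ (X *m f)) => //.
- exact: submx_trans (submxMr f XP) Pf.
- apply: submx_trans Qf _; rewrite addsmx_sub addsmxSl /=.
  apply: submx_trans (submxMr f PX) _; rewrite addsmxMr addsmxS //.
- move=> u; rewrite mulmxA => uXf; apply: Xfree; apply: finj => //.
  exact: submx_trans (submxMl _ _) XP.
have -> : X *m f *m B - lam *: Y *m (X *m f)
    = X *m (f *m B - lam *: (A *m f)) + lam *: (a *m P' *m f).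
  rewrite mulmxBr mulmxA -[in RHS]scalemxAr !mulmxA XA mulmxDl scalerDr -!scalemxAl.
  by rewrite opprD -!addrA; congr (_ + _); rewrite addrCA addNr addr0 !mulmxA.
rewrite addmx_sub ?scalemx_sub //; last by rewrite -mulmxA mulmx_sub.
exact: submx_trans (submxMr _ XP) fAB.
Qed.

Lemma trU_eq0 n m1 m2 (A : 'M[F]_n) (P : 'M[F]_(m1, n)) (P' : 'M[F]_(m2, n)) :
  (P == P')%MS -> (P *m A <= P)%MS -> trU A P - trU A P' = 0.
Proof. by move=> /eqmxP PP' PA; rewrite (trU_eqmx PP' PA) subrr. Qed.

(* Permuted summands contribute nothing: in a basis adapted to the decomposition
   the diagonal block of [X i] vanishes unless [tau i = i]. *)
Lemma trU_permuted (I : finType) (tau : I -> I) n m1 m2 (A : 'M[F]_n)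
    (V : 'M[F]_(m1, n)) (E : 'M[F]_(m2, n)) (X : I -> 'M[F]_n) :
    (E *m A <= E)%MS -> (E <= V)%MS -> (forall i, E <= X i)%MS -> (forall i, X i <= V)%MS ->
    (V <= E + \sum_i X i)%MS ->
    (forall i, X i *m A <= X (tau i))%MS ->
    (forall x : I -> 'rV_n, (forall i, x i <= X i)%MS -> ((\sum_i x i)%R <= E)%MS ->
       forall i, (x i <= E)%MS) ->
  trU A V - trU A E = \sum_(i | tau i == i) (trU A (X i) - trU A E).
Proof.
move=> EA EV EX XV VX XA Xdir.
pose e (i : 'I_#|I|) : I := enum_val i.
pose Z i := row_base (X (e i) :\: E)%MS.
have Zrel i := diffmx_rel (EX (e i)).
have ZA i : (Z i *m A <= E + Z (enum_rank (tau (e i))))%MS.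
  have [ZX _ _] := Zrel i; have [_ XZ _] := Zrel (enum_rank (tau (e i))).
  apply: submx_trans (submx_trans (submxMr A ZX) (XA _)) _.
  by move: XZ; rewrite {1}/e enum_rankK.
pose g i := enum_rank (tau (e i)).
have ZAg i j : {a : 'M[F]_(_, _) * 'M[F]_(_, _) |
    j == g i -> Z i *m A = a.1 *m E + a.2 *m Z j}.
  apply: cid; case: eqP => [->|_]; last by exists (0, 0).
  by have /sub_addsmxP[a ZAa] := ZA i; exists a.
pose a i j := sval (ZAg i j).
pose Y i j := if j == g i then (a i j).2 else 0.
have YZ i : (Z i *m A - \sum_j Y i j *m Z j <= E)%MS.
  rewrite (bigD1 (g i)) //= big1 ?addr0 => [|j /negbTE nj]; last first.
    by rewrite /Y nj mul0mx.
  by rewrite /Y eqxx (svalP (ZAg i (g i)) (eqxx _)) addrK submxMl.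
have Ydiag i : tau (e i) != e i -> Y i i = 0.
  move=> ti; rewrite /Y /g; case: eqP => // ii.
  by rewrite {2}ii /e enum_rankK eqxx in ti.
have Yfix i : tau (e i) = e i -> trU A (X (e i)) - trU A E = \tr (Y i i).
  move=> ti; have [ZX XZ Zf] := Zrel i.
  apply: (@trU_rel _ _ _ _ _ _ _ (Z i)) => //.
  have := YZ i; rewrite (bigD1 i) //= big1 ?addr0 // => j /negbTE ji.
  by rewrite /Y /g ti /e enum_valK ji mul0mx.
rewrite (@trU_rel _ _ _ _ A V E (\mxcol_i Z i) (\mxblock_(i, j) Y i j)) //.
- rewrite mxtrace_mxblock [RHS]big_mkcond (reindex e) /=; last exact/onW_bij/enum_val_bij.
  apply: eq_bigr => i _; case: eqP => [/Yfix-> //|/eqP/Ydiag ->].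
  by rewrite mxtrace0.
- apply/row_subP => k; rewrite row_mxcol; apply: submx_trans (row_sub _ _) _.
  by have [ZX _ _] := Zrel (tagnat.sig1 k); apply: submx_trans ZX (XV _).
- apply: submx_trans VX _; rewrite addsmx_sub addsmxSl /=; apply/sumsmx_subP => i _.
  have -> : X i = X (e (enum_rank i)) by rewrite /e enum_rankK.
  have [_ XZ _] := Zrel (enum_rank i); apply: submx_trans XZ _; apply: addsmxS => //.
  rewrite -/(Z (enum_rank i)).
  rewrite -[Z (enum_rank i)](mxcolK (fun i => Z i)).
  by apply/row_subP => k; rewrite row_rowsub row_sub.
- move=> u; rewrite -[u]submxrowK mul_mxrow_mxcol => uE.
  have ux i : (submxrow u i *m Z i <= E)%MS.
    have h := @Xdir (fun k => submxrow u (enum_rank k) *m Z (enum_rank k)) _ _ (e i).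
    rewrite /= {-1}/e enum_valK in h; apply: h.
      move=> k; have [ZX _ _] := Zrel (enum_rank k).
      apply: submx_trans (submxMl _ _) _.
      by apply: submx_trans ZX _; rewrite /e enum_rankK.
    by rewrite (reindex e) /=; [under eq_bigr do rewrite /e enum_valK | exact/onW_bij/enum_val_bij].
  rewrite -mxrow0; apply: eq_mxrow => i; have [_ _] := Zrel i; apply; exact: ux.
rewrite mul_mxblock_mxrow mxcol_mul -mxcolB; apply/row_subP => k; rewrite row_mxcol.
exact: submx_trans (row_sub _ _) (YZ _).
Qed.

End SubspaceTrace.

(** * Characters determine representations in characteristic zero *)

Section TraceDeterminesRepresentation.
Variable F : fieldType.

Lemma mxtrace_lin_mulmx m n (A : 'M[F]_m) (B : 'M[F]_n) (f : {linear 'M[F]_(m, n) -> 'M[F]_(m, n)}) :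
  f =1 (fun X => A *m X *m B) -> \tr (lin_mx f) = \tr A * \tr B.
Proof.
move=> fE; rewrite /mxtrace (reindex _ (curry_mxvec_bij m n)) /=.
rewrite (eq_bigr (fun ij : 'I_m * 'I_n => A ij.1 ij.1 * B ij.2 ij.2)) => [|[i j] _].
  by rewrite -(pair_bigA _ (fun i j => A i i * B j j)) /= mulr_suml; apply: eq_bigr => i _; rewrite mulr_sumr.
have -> : lin_mx f (mxvec_index i j) (mxvec_index i j) = (f (delta_mx i j)) i j.
  by rewrite -[RHS]mxvecE -(mul_vec_lin f) mxvec_delta -rowE !mxE.
rewrite fE mxE (bigD1 j) //= big1 ?addr0 => [|k kj].
  rewrite mxE (bigD1 i) //= big1 ?addr0 => [|k ki]; first by rewrite mxE !eqxx mulr1.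
  by rewrite mxE (negbTE ki) mulr0.
rewrite mxE big1 ?mul0r // => l _.
by rewrite mxE (negbTE kj) andbF mulr0.
Qed.

Lemma mxtrace_idem n (M : 'M[F]_n) : M *m M = M -> \tr M = (\rank M)%:R.
Proof.
move=> MM; have := mulmx_base M; have := row_base_free M; have := col_base_full M.
move: (col_base M) (row_base M) => C R fC fR CR.
have RC : R *m C = 1%:M.
  apply: (row_free_inj fR); rewrite mul1mx.
  have : C *m (R *m C *m R) = C *m R by rewrite -(mulmxA R) CR mulmxA CR MM.
  by move/(congr1 (mulmx (pinvmx C))); rewrite !(mulmxA (pinvmx C)) mulVpmx // !mul1mx.
by rewrite -{1}CR mxtrace_mulC RC mxtrace1.
Qed.

Variables (gT : finGroupType) (G : {group gT}).
Hypothesis F0 : [pchar F] =i pred0.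
Local Notation reprG := (mx_representation F G).

Let natF0 k : (k%:R == 0 :> F) = (k == 0)%N.
Proof. by move/pcharf0P: F0. Qed.

Definition hom_avg m n (rU : reprG m) (rV : reprG n) (X : 'M[F]_(m, n)) :=
  (#|G|%:R)^-1 *: \sum_(g in G) rU g^-1%g *m X *m rV g.

Lemma hom_avgJ m n (rU : reprG m) (rV : reprG n) X g : g \in G ->
  rU g *m hom_avg rU rV X = hom_avg rU rV X *m rV g.
Proof.
move=> Gg; rewrite /hom_avg -scalemxAl -scalemxAr; congr (_ *: _).
rewrite mulmx_sumr mulmx_suml (reindex_inj (mulIg g)) /=; apply: eq_big => h.
  by rewrite groupMr.
move=> Ghg; have Gh : h \in G by rewrite -(groupMr _ Gg).
by rewrite invMg !repr_mxM ?groupV // !mulmxA -repr_mxM ?groupV // mulgV repr_mx1 mul1mx.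
Qed.

Lemma hom_avg_id m n (rU : reprG m) (rV : reprG n) X :
  (forall g, g \in G -> rU g *m X = X *m rV g) -> hom_avg rU rV X = X.
Proof.
move=> XJ; rewrite /hom_avg (eq_bigr (fun=> X)) => [|g Gg].
  by rewrite sumr_const -scaler_nat scalerA mulVf ?scale1r // natF0 -lt0n cardG_gt0.
by rewrite -mulmxA -XJ // mulmxA -repr_mxM ?groupV // mulVg repr_mx1 mul1mx.
Qed.

(** Averaging over [G] is a projection of the space of matrices onto the intertwiners. Its trace is
    the sum of products of characters divided by the order of [G]; it is also the rank of the
    projection, which in characteristic zero vanishes only if the projection does. *)
Lemma hom_trace m n (rU : reprG m) (rV : reprG n) :
  (exists2 X : 'M[F]_(m, n), X != 0 & forall g, g \in G -> rU g *m X = X *m rV g) <->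
  \sum_(g in G) \tr (rU g^-1%g) * \tr (rV g) != 0.
Proof.
pose lg g : {linear 'M[F]_(m, n) -> 'M[F]_(m, n)} := mulmxr (rV g) \o mulmx (rU g^-1%g).
pose M := (#|G|%:R)^-1 *: \sum_(g in G) lin_mx (lg g).
have MX X : mxvec X *m M = mxvec (hom_avg rU rV X).
  have -> : mxvec (hom_avg rU rV X) = (#|G|%:R)^-1 *: \sum_(g in G) mxvec (rU g^-1%g *m X *m rV g).
    by rewrite /hom_avg linearZ raddf_sum.
  rewrite /M -scalemxAr mulmx_sumr; congr (_ *: _).
  by apply: eq_bigr => g _; rewrite mul_vec_lin.
have MM : M *m M = M.
  apply/row_matrixP => i; rewrite !rowE mulmxA -[delta_mx 0 i]vec_mxK MX MX.
  by rewrite hom_avg_id // => g Gg; rewrite hom_avgJ.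
have trM : \tr M = (#|G|%:R)^-1 * \sum_(g in G) \tr (rU g^-1%g) * \tr (rV g).
  rewrite mxtraceZ raddf_sum; congr (_ * _); apply: eq_bigr => g _.
  exact: mxtrace_lin_mulmx.
have G0 : (#|G|%:R)^-1 != 0 :> F by rewrite invr_eq0 natF0 -lt0n cardG_gt0.
have -> : (\sum_(g in G) \tr (rU g^-1%g) * \tr (rV g) != 0) = (M != 0).
  by rewrite -mxrank_eq0 -natF0 -(mxtrace_idem MM) trM mulf_eq0 (negbTE G0).
split=> [[X X0 XJ]|M0].
  apply: contraNneq X0 => M0; have := MX X; rewrite M0 mulmx0 hom_avg_id //.
  by move/esym/eqP; rewrite mxvec_eq0.
have [k] : exists k, row k M != 0.
  apply/existsP; apply: contraT; rewrite negb_exists => /forallP Mi.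
  by case/eqP: M0; apply/row_matrixP => i; rewrite row0; apply/eqP/negPn.
rewrite rowE -[delta_mx 0 k]vec_mxK MX mxvec_eq0 => X0.
by exists (hom_avg rU rV (vec_mx (delta_mx 0 k))) => // g; apply: hom_avgJ.
Qed.

(** Induction on the degree. A simple submodule of the first module embeds into the second one,
    because [hom_trace] sees only characters; Maschke complements on both sides again have equal
    characters. *)
Theorem mx_rsim_trace n1 n2 (rG1 : reprG n1) (rG2 : reprG n2) :
  (forall g, g \in G -> \tr (rG1 g) = \tr (rG2 g)) -> mx_rsim rG1 rG2.
Proof.
have [k] := ubnP n1; elim: k => // k IHk in n1 n2 rG1 rG2 *; rewrite ltnS => n1k trE.
have n12 : n1 = n2.
  have /eqP := trE _ (group1 G); rewrite !repr_mx1 !mxtrace1 -subr_eq0.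
  case/orP: (leq_total n1 n2) => n12.
    rewrite -opprB oppr_eq0 -natrB // natF0 subn_eq0 => n21.
    by apply/eqP; rewrite eqn_leq n12.
  by rewrite -natrB // natF0 subn_eq0 => n21; apply/eqP; rewrite eqn_leq n12 n21.
subst n2; rename n1 into n.
have [n0|n_gt0] := posnP n.
  by subst n; exists 1%:M => // [|g _]; rewrite ?row_free_unit ?unitmx1 ?[LHS]flatmx0 ?[RHS]flatmx0.
have n0 : (1%:M : 'M[F]_n) != 0 by rewrite -mxrank_eq0 mxrank1 -lt0n.
apply: contrapT => nsim; apply: (negP (_ : ~~ false)) => //.
apply: (mxsimple_exists (mxmodule1 rG1) n0) => -[U simU _]; exfalso; apply: nsim.
have modU := mxsimple_module simU; set rU := submod_repr modU.
(* The inclusion of [U] into [rG1] makes the character sum nonzero; the same sum for [rG2] then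
   yields a nonzero map. *)
have [f f0 fJ] : exists2 f : 'M[F]_(\rank U, n), f != 0 &
    forall g, g \in G -> rU g *m f = f *m rG2 g.
  apply/hom_trace; have -> : \sum_(g in G) \tr (rU g^-1%g) * \tr (rG2 g)
      = \sum_(g in G) \tr (rU g^-1%g) * \tr (rG1 g) by apply: eq_bigr => g Gg; rewrite trE.
  apply/hom_trace; exists (val_submod 1%:M) => [|g Gg].
    by rewrite -mxrank_eq0 val_submod1 mxrank_eq0; have [_ U0 _] := simU.
  by rewrite -(val_submodJ modU) // mul1mx [RHS]val_submodE.
have /submod_mx_irr : mxsimple rG1 U by [].
move/(_ modU); rewrite -/rU => irrU.
have ff : row_free f.
  rewrite -kermx_eq0; apply: contraT => K0; case/negP: f0.
  have modK : mxmodule rU (kermx f).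
    apply/mxmoduleP => g Gg; apply/sub_kermxP.
    by rewrite -mulmxA fJ // mulmxA mulmx_ker mul0mx.
  have [_ _ irr] := irrU.
  have : (1%:M <= kermx f)%MS by apply: irr; rewrite // submx1.
  by move/sub_kermxP; rewrite mul1mx => ->.
pose W := <<f>>%MS.
have fW : (f :=: W)%MS by apply: eqmx_sym (genmxE f).
have modW : mxmodule rG2 W.
  rewrite (eqmx_module _ (genmxE f)); apply/mxmoduleP => g Gg.
  by rewrite -fJ // submxMl.
have simUW : mx_rsim (submod_repr modW) rU.
  apply: mx_rsim_sym; exists (in_submod W f) => [||g Gg].
  - by rewrite -fW (eqP ff).
  - rewrite /row_free; have := eqP ff; rewrite -{1}[f](@in_submodK _ _ W) ?fW // val_submodE.
    rewrite mxrankMfree => [-> //|]; by rewrite /row_free val_submod1.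
  - by rewrite -in_submodJ ?fW // -fJ // [in LHS]in_submodE [in RHS]in_submodE mulmxA.
have FG : pgroup [pchar F]^' G.
  by rewrite /pgroup /pnat cardG_gt0; apply/allP => p _; rewrite inE /= F0.
have [U' modU' defU dxU] := mx_Maschke_pchar rG1 FG modU (submx1 U).
have [W' modW' defW dxW] := mx_Maschke_pchar rG2 FG modW (submx1 W).
have U'lt : (\rank U' < n)%N.
  have := mxrank_disjoint_sum (mxdirect_addsP dxU); rewrite defU mxrank1 => nE.
  rewrite [X in (_ < X)%N]nE -[X in (X < _)%N]add0n ltn_add2r lt0n mxrank_eq0.
  by have [_ U0 _] := simU.
have simUW' : mx_rsim (submod_repr modU') (submod_repr modW').
  apply: IHk => [|g Gg]; first exact: leq_trans U'lt _.
  have := mxtrace_dadd_mod modU modU' (mxmodule1 rG1) defU dxU Gg.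
  rewrite (mxtrace_rsim (rsim_submod1 _ (eqmx_refl _))) // trE //.
  rewrite -(mxtrace_rsim (rsim_submod1 (mxmodule1 rG2) (eqmx_refl _))) //.
  rewrite -(mxtrace_dadd_mod modW modW' (mxmodule1 rG2) defW dxW Gg).
  by rewrite -(mxtrace_rsim simUW) // => /addrI.
pose D := dadd_grepr (Representation rU) (Representation (submod_repr modW')).
have s1 : mx_rsim rG1 D.
  apply: mx_rsim_trans (mx_rsim_sym (rsim_submod1 (mxmodule1 rG1) (eqmx_refl _))) _.
  by apply: mx_rsim_dadd defU dxU _ _ => //; apply: mx_rsim_refl.
have s2 : mx_rsim rG2 D.
  apply: mx_rsim_trans (mx_rsim_sym (rsim_submod1 (mxmodule1 rG2) (eqmx_refl _))) _.
  by apply: mx_rsim_dadd defW dxW _ _ => //; apply: mx_rsim_refl.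
exact: mx_rsim_trans s1 (mx_rsim_sym s2).
Qed.

End TraceDeterminesRepresentation.

(** * Ideals as predicates, and regular sequences on quotients of ideals *)

Section RegularSequences.
Variable S : comNzRingType.
Implicit Types (P M : S -> Prop) (p q c x : S).

Definition is_ideal M :=
  [/\ M 0, forall p q, M p -> M q -> M (p + q) & forall a p, M p -> M (a * p)].

Lemma ideal0 M : is_ideal M -> M 0. Proof. by case. Qed.
Lemma idealD M : is_ideal M -> forall p q, M p -> M q -> M (p + q). Proof. by case. Qed.
Lemma idealM M : is_ideal M -> forall a p, M p -> M (a * p). Proof. by case. Qed.
Lemma idealB M : is_ideal M -> forall p q, M p -> M q -> M (p - q).
Proof. by move=> [_ MD MM] p q Mp Mq; apply: MD => //; rewrite -mulN1r; apply: MM. Qed.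
Lemma idealDr M : is_ideal M -> forall p q, M q -> M (p + q) -> M p.
Proof. by move=> IM p q Mq /(idealB IM)/(_ Mq); rewrite addrK. Qed.
Lemma idealBr M : is_ideal M -> forall p q, M q -> M (p - q) -> M p.
Proof. by move=> IM p q Mq /(idealD IM)/(_ Mq); rewrite subrK. Qed.

Definition ideal_zero p := p = 0.
Definition ideal_full (p : S) := True.
Lemma is_ideal_zero : is_ideal ideal_zero.
Proof. by split=> [|p q -> ->|a p ->]; rewrite /ideal_zero ?addr0 ?mulr0. Qed.
Lemma is_ideal_full : is_ideal ideal_full. Proof. by []. Qed.

(* [gsum P e M s] is [P + \sum_(i <- s) e i * M i]. *)
Fixpoint gsum (I : Type) P (e : I -> S) (M : I -> S -> Prop) (s : seq I) : S -> Prop :=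
  if s is i :: s' then fun p => exists2 c, M i c & gsum P e M s' (p - e i * c) else P.

Section Gsum.
Variables (I : Type) (e : I -> S).
Implicit Type s : seq I.

Lemma gsum_ideal P (M : I -> S -> Prop) s :
  is_ideal P -> (forall i, is_ideal (M i)) -> is_ideal (gsum P e M s).
Proof.
move=> IP IM; elim: s => //= i s IHs; split.
- by exists 0; rewrite ?mulr0 ?subr0; [exact: ideal0 | exact: ideal0].
- move=> p q [c Mc pc] [d Md qd]; exists (c + d); first exact: idealD.
  by rewrite mulrDr opprD addrACA; apply: idealD.
move=> a p [c Mc pc]; exists (a * c); first exact: idealM.
by rewrite mulrCA -mulrBr; apply: idealM.
Qed.

Lemma gsum_base P (M : I -> S -> Prop) s p :
  (forall i, M i 0) -> P p -> gsum P e M s p.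
Proof.
by move=> M0; elim: s p => //= i s IHs p Pp; exists 0; rewrite ?mulr0 ?subr0 //; apply: IHs.
Qed.

Lemma gsum_mono P P' (M M' : I -> S -> Prop) s :
  (forall p, P p -> P' p) -> (forall i p, M i p -> M' i p) ->
  forall p, gsum P e M s p -> gsum P' e M' s p.
Proof.
move=> PP MM; elim: s => //= i s IHs p [c Mc pc].
by exists c; [apply: MM | apply: IHs].
Qed.

Lemma gsum_split P P' (M : I -> S -> Prop) s p :
  P' 0 -> gsum P e M s p -> exists2 q, P q & gsum P' e M s (p - q).
Proof.
move=> P'0; elim: s p => [|i s IHs] p /=; first by exists p; rewrite ?subrr.
by move=> [c Mc /IHs[q Pq pq]]; exists q => //; exists c => //; rewrite addrAC.
Qed.

Lemma gsum_sub P (M : I -> S -> Prop) Q (s : seq I) :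
  is_ideal Q -> (forall p, P p -> Q p) -> (forall i c, M i c -> Q (e i * c)) ->
  forall p, gsum P e M s p -> Q p.
Proof.
move=> IQ PQ MQ; elim: s => //= i s IHs p [c Mc /IHs pc].
by apply: (idealBr IQ) pc; apply: MQ.
Qed.

End Gsum.

Lemma gsum_sub_in (I : eqType) (e : I -> S) P (M : I -> S -> Prop) Q (s : seq I) :
  is_ideal Q -> (forall p, P p -> Q p) -> (forall i c, i \in s -> M i c -> Q (e i * c)) ->
  forall p, gsum P e M s p -> Q p.
Proof.
move=> IQ PQ; elim: s => //= i s IHs MQ p [c Mc pc].
have {}pc : Q (p - e i * c).
  by apply: IHs pc => j d js; apply: MQ; rewrite inE js orbT.
by apply: (idealBr IQ) pc; apply: MQ => //; rewrite inE eqxx.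
Qed.

Lemma gsum_mem (I : eqType) (e : I -> S) P (M : I -> S -> Prop) (s : seq I) i c :
  P 0 -> (forall i, is_ideal (M i)) -> i \in s -> M i c -> gsum P e M s (e i * c).
Proof.
move=> P0 IM; elim: s => //= j s IHs; rewrite inE => /predU1P[<- Mc|js Mc].
  by exists c => //; rewrite subrr; apply: gsum_base => // k; apply: ideal0.
by exists 0; rewrite ?mulr0 ?subr0; [exact: ideal0 | exact: IHs].
Qed.

(* The module [M / P] has the regular sequence [e i], for [i] in [s] from right
   to left. *)
Fixpoint regular (I : Type) P M (e : I -> S) (s : seq I) : Prop :=
  if s is i :: s' then
    regular P M e s' /\ forall c, M c -> gsum P e (fun=> M) s' (e i * c) -> gsum P e (fun=> M) s' c
  else True.

(** Regularity on [M / Q] keeps the inclusion of [Q / P] into [M / P] injective after reduction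
    modulo the sequence. In a relation the coefficient in [M] is moved into [Q] by regularity, the
    error being absorbed by the remaining members of the sequence. *)
Lemma regular_cap (I : Type) P Q M (e : I -> S) (s : seq I) :
    is_ideal P -> is_ideal Q -> is_ideal M ->
    (forall p, P p -> Q p) -> (forall p, Q p -> M p) -> regular Q M e s ->
  forall x, Q x -> gsum P e (fun=> M) s x -> gsum P e (fun=> Q) s x.
Proof.
move=> IP IQ IM PQ QM; elim: s => //= i s IHs [/IHs{}IHs reg] x Qx [c Mc xc].
have [| q Qq cq] := gsum_split (ideal0 IP) (reg c Mc _).
  have IG : is_ideal (gsum Q e (fun=> M) s) by apply: gsum_ideal.
  have := idealB IG (@gsum_base _ e Q (fun=> M) s x (fun=> ideal0 IM) Qx) (gsum_mono PQ (fun i p h => h) xc).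
  by rewrite opprB addrC subrK.
exists q => //; apply: IHs; first by apply: idealB => //; apply: idealM.
have IG : is_ideal (gsum P e (fun=> M) s) by apply: gsum_ideal.
have := idealD IG xc (idealM IG (e i) cq).
by rewrite mulrBr addrA subrK.
Qed.

(** Regularity passes to extensions. A relation is solved modulo [Q] by regularity of [M / Q]; by
    [regular_cap] what is left is a relation inside [Q], to which regularity of [Q / P] applies. *)
Lemma regular_ext (I : Type) P Q M (e : I -> S) (s : seq I) :
    is_ideal P -> is_ideal Q -> is_ideal M ->
    (forall p, P p -> Q p) -> (forall p, Q p -> M p) ->
  regular P Q e s -> regular Q M e s -> regular P M e s.
Proof.
move=> IP IQ IM PQ QM; elim: s => //= i s IHs [rPQ PQreg] [rQM QMreg].
split=> [|c Mc ic]; first exact: IHs.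
have IG : is_ideal (gsum P e (fun=> M) s) by apply: gsum_ideal.
have [q Qq cq] := gsum_split (ideal0 IP) (QMreg c Mc (gsum_mono PQ (fun i p h => h) ic)).
have : gsum P e (fun=> M) s (e i * q).
  by have := idealB IG ic (idealM IG (e i) cq); rewrite mulrBr opprB addrC subrK.
move/(regular_cap IP IQ IM PQ QM rQM (idealM IQ _ Qq))/(PQreg q Qq).
move/(@gsum_mono _ e P P (fun=> Q) (fun=> M) s (fun p h => h) (fun i p => QM p)).
by move/(idealD IG cq); rewrite subrK.
Qed.

End RegularSequences.

(** * Independent linear forms are regular in a polynomial ring *)

Section LinearForms.
Variables (F : fieldType) (N : nat).
Local Notation S := {mpoly F[N]}.

Definition lform (v : 'rV[F]_N) : S := \sum_i v 0 i *: 'X_i.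

Lemma lformD u v : lform (u + v) = lform u + lform v.
Proof. by rewrite /lform -big_split; apply: eq_bigr => i _; rewrite mxE scalerDl. Qed.

Lemma lformZ a v : lform (a *: v) = a *: lform v.
Proof. by rewrite /lform scaler_sumr; apply: eq_bigr => i _; rewrite mxE scalerA. Qed.

Lemma lform0 : lform 0 = 0.
Proof. by rewrite -(scale0r (0 : 'rV_N)) lformZ scale0r. Qed.

Lemma lform_sum (I : Type) (r : seq I) (P : pred I) (v : I -> 'rV[F]_N) :
  lform (\sum_(i <- r | P i) v i) = \sum_(i <- r | P i) lform (v i).
Proof. by apply: (big_morph lform lformD lform0). Qed.

Lemma lform_delta i : lform (delta_mx 0 i) = 'X_i.
Proof.
rewrite /lform (bigD1 i) //= mxE !eqxx scale1r big1 ?addr0 // => j ji.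
by rewrite mxE (negbTE ji) andbF scale0r.
Qed.

Lemma lform_inj : injective lform.
Proof.
move=> u v uv; apply/rowP => i.
have lE w : (lform w)@_U_(i) = w 0 i.
  rewrite raddf_sum /= (bigD1 i) //= mcoeffZ mcoeffX eqxx mulr1 big1 ?addr0 // => j ji.
  rewrite mcoeffZ mcoeffX; case: eqVneq => [/mnmP/(_ j)|_]; last by rewrite mulr0.
    by rewrite !mnm1E eqxx eq_sym (negbTE ji).
by rewrite -!lE uv.
Qed.

Lemma lform_homog v : lform v \is 1.-homog.
Proof. by rewrite rpred_sum // => i _; rewrite rpredZ // dhomogX /= mdeg1. Qed.

(* The substitution along the projection with kernel the span of [ls] has as
   kernel the ideal generated by [ls], which is therefore prime. *)
Lemma lform_regular l (ls : seq 'rV[F]_N) p : free (l :: ls) ->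
  gsum (@ideal_zero S) lform (fun=> @ideal_full S) ls (lform l * p) ->
  gsum (@ideal_zero S) lform (fun=> @ideal_full S) ls p.
Proof.
rewrite free_cons => /andP[l_ls _].
set J := gsum _ _ _ _; have IJ : is_ideal J.
  by apply: gsum_ideal => [|i]; [exact: is_ideal_zero | exact: is_ideal_full].
pose E (v : 'rV[F]_N) := v - projv <<ls>>%VS v.
pose rho (q : S) : S := q \mPo [tuple lform (E (delta_mx 0 i)) | i < N].
have rhoD : {morph rho : a b / a + b} by move=> a b; apply: raddfD.
have rhoM : {morph rho : a b / a * b} by move=> a b; apply: rmorphM.
have rhoZ a q : rho (a *: q) = a *: rho q by apply: comp_mpolyZ.
have rhoX i : rho 'X_i = lform (E (delta_mx 0 i)).
  by rewrite /rho comp_mpolyXU -tnth_nth tnth_mktuple.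
have ED : {morph E : u v / u + v}.
  by move=> u v; rewrite /E linearD opprD addrACA.
have EZ a u : E (a *: u) = a *: E u by rewrite /E linearZ scalerBr.
have E0 : E 0 = 0 by rewrite /E linear0 subrr.
have rho_l v : rho (lform v) = lform (E v).
  rewrite {2}[v]row_sum_delta (big_morph E ED E0) lform_sum.
  rewrite [in LHS]/lform (big_morph rho rhoD (raddf0 _)).
  by apply: eq_bigr => i _; rewrite rhoZ rhoX EZ lformZ.
have J_ker q : J q -> rho q = 0.
  apply: (gsum_sub_in (Q := fun q => rho q = 0)) => [|a ->|v c vls _].
  - split=> [|a b ra rb|a b rb]; first exact: raddf0.
      by rewrite rhoD ra rb addr0.
    by rewrite rhoM rb mulr0.
  - exact: raddf0.
  by rewrite rhoM rho_l /E projv_id ?subrr ?lform0 ?mul0r // memv_span.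
have J_span v : v \in <<ls>>%VS -> J (lform v).
  move=> vls; rewrite (@coord_span _ _ _ (in_tuple ls) v vls) lform_sum.
  elim/big_ind: _ => [||i _]; [exact: ideal0 | exact: idealD |].
  rewrite lformZ -mul_mpolyC; apply: (idealM IJ); rewrite -[lform _]mulr1.
  by apply: gsum_mem => //; apply: mem_nth.
have J_rho q : J (q - rho q).
  pose A q := J (q - rho q).
  have A0 : A 0 by rewrite /A /rho raddf0 subrr; apply: ideal0.
  have AD a b : A a -> A b -> A (a + b).
    by rewrite /A rhoD opprD addrACA; apply: idealD.
  have AM a b : A a -> A b -> A (a * b).
    move=> Aa Ab; rewrite /A rhoM.
    have -> : a * b - rho a * rho b = b * (a - rho a) + rho a * (b - rho b) by ring.
    by apply: idealD => //; apply: idealM.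
  have A1 : A 1 by rewrite /A /rho rmorph1 subrr; apply: ideal0.
  have AX i : A 'X_i.
    rewrite /A rhoX -lform_delta -scaleN1r -lformZ -lformD scaleN1r /E subKr.
    exact/J_span/memv_proj.
  rewrite -/(A q) (mpolyE q); elim/big_ind: _ => // m _.
  have -> : q@_m *: 'X_[m] = (q@_m)%:MP * \prod_(i < N) 'X_i ^+ m i.
    by rewrite mul_mpolyC mpolyXE_id.
  apply: (AM); first by rewrite /A /rho comp_mpolyC subrr; apply: ideal0.
  apply: (big_ind A A1 AM) => i _; elim: (m i) => // k IHk.
  by rewrite exprS; apply: (AM).
move=> /J_ker; rewrite rhoM rho_l => /eqP; rewrite mulf_eq0 => /orP[/eqP El|/eqP rp].
  have : E l = 0 by apply: lform_inj; rewrite El lform0.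
  move/eqP; rewrite subr_eq0 => /eqP lE; case/negP: l_ls; rewrite lE; exact: memv_proj.
by have := J_rho p; rewrite rp subr0.
Qed.

End LinearForms.

(** * Subspaces of polynomials described by supports of monomials *)

Section MonomialSpans.
Variables (F : fieldType) (T : finType).
Local Notation N := #|T|.
Local Notation S := {mpoly F[N]}.
Implicit Types (m : 'X_{1..N}) (p q : S) (X Y Z : pred {set T}) (G H : {set T}).

Definition supp m : {set T} := [set v | m (enum_rank v) != 0%N].

Lemma supp_add m1 m2 : supp (m1 + m2)%MM = supp m1 :|: supp m2.
Proof. by apply/setP => v; rewrite !inE mnmDE addn_eq0 negb_and. Qed.

Lemma supp0 : supp 0%MM = set0.
Proof. by apply/setP => v; rewrite !inE mnm0E. Qed.

Lemma supp1 i : supp U_(i)%MM = [set enum_val i].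
Proof.
apply/setP => v; rewrite !inE mnm1E eqb0 negbK.
by apply/eqP/eqP => ->; rewrite ?enum_rankK ?enum_valK.
Qed.

Definition mspan X p := all (fun m => X (supp m)) (msupp p).

Lemma mspanP X p : reflect (forall m, p@_m != 0 -> X (supp m)) (mspan X p).
Proof.
by apply: (iffP allP) => h m; [rewrite -mcoeff_msupp; apply: h | rewrite mcoeff_msupp; apply: h].
Qed.

Lemma mspan_mul X Y Z p q : (forall G H, X G -> Y H -> Z (G :|: H)) ->
  mspan X p -> mspan Y q -> mspan Z (p * q).
Proof.
move=> XYZ /allP pX /allP qY; apply/allP => m /msuppM_le /allpairsP[[m1 m2] /= [/pX h1 /qY h2 ->]].
by rewrite supp_add; apply: XYZ.
Qed.

Lemma mspan_sub X Y p : (forall G, X G -> Y G) -> mspan X p -> mspan Y p.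
Proof. by move=> XY /mspanP pX; apply/mspanP => m /pX/XY. Qed.

Lemma mspan_and X Y p : mspan X p -> mspan Y p -> mspan (predI X Y) p.
Proof. by move=> /mspanP pX /mspanP pY; apply/mspanP => m nz; rewrite /= pX ?pY. Qed.

Lemma mspanT p : mspan xpredT p.
Proof. exact/mspanP. Qed.

Lemma mspan0 X : mspan X 0.
Proof. by apply/mspanP => m; rewrite mcoeff0 eqxx. Qed.

Lemma mspanD X p q : mspan X p -> mspan X q -> mspan X (p + q).
Proof.
move=> /mspanP pX /mspanP qX; apply/mspanP => m; rewrite mcoeffD.
by have [->|nz _] := eqVneq p@_m 0; [rewrite add0r; apply: qX | apply: pX].
Qed.

Lemma mspanZ X a p : mspan X p -> mspan X (a *: p).
Proof.
by move=> /mspanP pX; apply/mspanP => m; rewrite mcoeffZ mulf_eq0 negb_or => /andP[_ /pX].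
Qed.

Lemma mspanB X p q : mspan X p -> mspan X q -> mspan X (p - q).
Proof. by move=> pX qX; rewrite -scaleN1r mspanD ?mspanZ. Qed.

Lemma mspan_sum X (I : Type) (r : seq I) (P : pred I) (f : I -> S) :
  (forall i, P i -> mspan X (f i)) -> mspan X (\sum_(i <- r | P i) f i).
Proof. by apply: (big_ind (fun p => mspan X p)) => [|p q]; [apply: mspan0 | apply: mspanD]. Qed.

Lemma mspanX X m : mspan X 'X_[m] = X (supp m).
Proof.
apply/mspanP/idP => [h|Xm k]; last by rewrite mcoeffX; case: (m =P k) => [<- //|_]; rewrite eqxx.
by apply: h; rewrite mcoeffX eqxx oner_eq0.
Qed.

Definition upclosed X := forall G H, G \subset H -> X G -> X H.

Lemma mspan_ideal X : upclosed X -> is_ideal (fun p : S => mspan X p).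
Proof.
move=> uX; split=> [|p q|a p pX]; [exact: mspan0 | exact: mspanD |].
by apply: mspan_mul (mspanT a) pX => G H _; apply: uX; apply: subsetUr.
Qed.

Definition mproj X p : S := \sum_(m <- msupp p | X (supp m)) p@_m *: 'X_[m].

Lemma mcoeff_proj X p m : (mproj X p)@_m = if X (supp m) then p@_m else 0.
Proof.
rewrite raddf_sum /=; have [mp|/memN_msupp_eq0 p0] := boolP (m \in msupp p); last first.
  rewrite p0 if_same big1_seq // => k /andP[_ kp]; rewrite mcoeffZ mcoeffX.
  by case: eqP => [km|]; rewrite ?mulr0 // km p0 mul0r.
rewrite big_mkcond (bigD1_seq m) ?msupp_uniq //= big1 ?addr0 => [|k /negbTE km].
  by case: (X _); rewrite // mcoeffZ mcoeffX eqxx mulr1.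
by case: (X _); rewrite // mcoeffZ mcoeffX km mulr0.
Qed.

Lemma mspan_proj X p : mspan X (mproj X p).
Proof. by apply/mspanP => m; rewrite mcoeff_proj; case: (X _) => //; rewrite eqxx. Qed.

Lemma mspan_proj_stable X Y p : mspan Y p -> mspan Y (mproj X p).
Proof.
by move=> /mspanP pY; apply/mspanP => m; rewrite mcoeff_proj; case: (X _); rewrite ?eqxx //; apply: pY.
Qed.

Lemma mspan_projC X p : mspan (predC X) (p - mproj X p).
Proof.
apply/mspanP => m; rewrite mcoeffB mcoeff_proj /=.
by case: (X _); rewrite ?subrr ?eqxx.
Qed.

Lemma mproj_id X p : mspan X p -> mproj X p = p.
Proof.
move=> /mspanP pX; apply/mpolyP => m; rewrite mcoeff_proj; case: ifPn => // nX.
by apply/esym/eqP; apply: contraNT nX; apply: pX.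
Qed.

Lemma mproj_eq0 X p : mspan (predC X) p -> mproj X p = 0.
Proof.
move=> /mspanP pX; apply/mpolyP => m; rewrite mcoeff_proj mcoeff0; case: ifP => // XM.
by apply/eqP; apply: contraTT XM => /pX.
Qed.

(* Every monomial [m] is in [X] or in [Y]. *)
Lemma mspan_split X Y Z p : (forall G, Z G -> X G || Y G) -> mspan Z p ->
  exists2 q, mspan X q & mspan Y (p - q).
Proof.
move=> ZXY pZ; exists (mproj X p); first exact: mspan_proj.
apply: mspan_sub (mspan_and (mspan_projC X p) (mspanB pZ (mspan_proj_stable X pZ))) => G /=.
by case/andP => /negbTE nX /ZXY; rewrite nX.
Qed.

(* Setting to zero the variables outside [A]. *)
Section Restriction.
Variable A : {set T}.
Local Notation res := (mproj (fun G => G \subset A)).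

Let resE p : res p = p \mPo [tuple if enum_val i \in A then 'X_i else 0 | i < N].
Proof.
rewrite (mpolyE p) raddf_sum /=; apply/mpolyP => m.
rewrite -mpolyE mcoeff_proj raddf_sum /=.
have XE k : 'X_[k] \mPo [tuple if enum_val i \in A then 'X_i else 0 | i < N] =
    if supp k \subset A then 'X_[k] else 0 :> S.
  rewrite comp_mpolyX; case: ifPn => [/subsetP kA|].
    rewrite [RHS]mpolyXE_id; apply: eq_bigr => i _; rewrite tnth_mktuple.
    case: ifPn => // iA; have : enum_val i \notin supp k by apply: contra iA => /kA.
    by rewrite inE negbK enum_valK => /eqP ->; rewrite !expr0.
  case/subsetPn => v vk vA; rewrite (bigD1 (enum_rank v)) //= tnth_mktuple enum_rankK.
  by rewrite (negbTE vA) expr0n; move: vk; rewrite inE => /negbTE ->; rewrite mul0r.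
under eq_bigr => k _ do rewrite comp_mpolyZ mcoeffZ XE.
have [mp|/memN_msupp_eq0 p0] := boolP (m \in msupp p); last first.
  rewrite p0 if_same big1_seq // => k /andP[_ kp]; case: ifP => _; rewrite ?mcoeff0 ?mulr0 //.
  by rewrite mcoeffX; case: eqP => [km|]; rewrite ?mulr0 // km p0 mul0r.
rewrite (bigD1_seq m) ?msupp_uniq //= big1 ?addr0 => [|k /negbTE km].
  by case: ifP => _; rewrite ?mcoeff0 ?mulr0 // mcoeffX eqxx mulr1.
by case: ifP => _; rewrite ?mcoeff0 ?mulr0 // mcoeffX km mulr0.
Qed.

Lemma resM p q : res (p * q) = res p * res q.
Proof. by rewrite !resE rmorphM. Qed.

Lemma resD p q : res (p + q) = res p + res q.
Proof. by rewrite !resE raddfD. Qed.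

Lemma resB p q : res (p - q) = res p - res q.
Proof. by rewrite !resE raddfB. Qed.

Lemma res0 : res 0 = 0 :> S.
Proof. by rewrite resE raddf0. Qed.

Lemma res_res p : res (res p) = res p.
Proof. exact/mproj_id/mspan_proj. Qed.

Definition resv (v : 'rV[F]_N) : 'rV[F]_N :=
  \row_i (if enum_val i \in A then v 0 i else 0).

Lemma res_lform v : res (lform v) = lform (resv v).
Proof.
rewrite resE /lform raddf_sum; apply: eq_bigr => i _ /=; rewrite comp_mpolyZ.
rewrite comp_mpolyXU -tnth_nth tnth_mktuple mxE; case: ifP => //.
by rewrite scaler0 scale0r.
Qed.

End Restriction.

(** * Regular sequences from a shelling *)

Section Shelling.
Implicit Types (A R : {set T}) (fs : seq {set T}).

Definition offacets fs : pred {set T} := fun G => ~~ has (fun A => G \subset A) fs.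

Lemma offacets_up fs : upclosed (offacets fs).
Proof.
move=> G H GH; apply: contra => /hasP[A Afs HA]; apply/hasP; exists A => //.
exact: subset_trans HA.
Qed.

Definition setmnm R : 'X_{1..N} := [multinom nat_of_bool (enum_val i \in R) | i < N].

Lemma supp_setmnm R : supp (setmnm R) = R.
Proof. by apply/setP => v; rewrite inE mnmE enum_rankK; case: (v \in R). Qed.

Lemma setmnm_dvd R p : mspan (fun G => R \subset G) p -> exists q, p = 'X_[setmnm R] * q.
Proof.
move=> pR; exists (\sum_(m <- msupp p) p@_m *: 'X_[m - setmnm R]).
rewrite {1}(mpolyE p) mulr_sumr; apply: eq_big_seq => m mp; rewrite -scalerAr -mpolyXD addmC submK //.
apply/mnm_lepP => i; rewrite mnmE; case: (boolP (_ \in R)) => // iR.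
have := allP pR _ mp; move/subsetP/(_ _ iR).
by rewrite inE enum_valK lt0n.
Qed.

(** Adding the facet [A] with restriction set [R] changes the ideal by a piece isomorphic to $x_R$
    times the polynomial ring in the variables of [A]: modulo the smaller ideal, an element is
    determined by its restriction to [A], and this restriction is divisible by $x_R$. Linear forms
    act there through their restrictions, so independence on [A] is enough. *)
Lemma regular_piece A R fs (vs : seq 'rV[F]_N) :
    R \subset A -> (forall G, G \subset A -> offacets fs G = (R \subset G)) ->
    free (map (resv A) vs) ->
  regular (mspan (offacets (A :: fs))) (mspan (offacets fs)) (@lform F N) vs.
Proof.
move=> RA AR; set P := mspan _; set M := mspan _.
have IP : is_ideal P by apply/mspan_ideal/offacets_up.
have IM : is_ideal M by apply/mspan_ideal/offacets_up.
pose res := mproj (fun G => G \subset A).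
have resP p : P p -> res p = 0.
  move=> pP; apply: mproj_eq0; apply: mspan_sub pP => G /=.
  by rewrite /offacets /= negb_or => /andP[].
have MP p : M p -> res p = 0 -> P p.
  move=> /mspanP pM rp; apply/mspanP => m pm; rewrite /offacets /= negb_or [X in _ && X]pM // andbT.
  apply: contraNN pm => mA; apply/eqP; have /mpolyP/(_ m) := rp.
  by rewrite mcoeff_proj mA mcoeff0.
have resM' p : M p -> mspan (fun G => R \subset G) (res p).
  move=> pM; apply: mspan_sub (mspan_and (mspan_proj _ p) (mspan_proj_stable (fun G => G \subset A) pM)) => G.
  by case/andP => GA; rewrite AR.
pose xR : S := 'X_[setmnm R].
have xR0 : xR != 0 by rewrite -msize_poly_eq0 msizeX.
have MXR p : M (xR * res p).
  have : mspan (predI (fun G => R \subset G) (fun G => G \subset A)) (xR * res p).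
    apply: (@mspan_mul (fun G => G == R) (fun G => G \subset A)) => [G H /eqP -> HA||].
    - by rewrite /= subsetUl subUset RA.
    - by rewrite mspanX supp_setmnm.
    - exact: mspan_proj.
  by apply: mspan_sub => G /andP[RG GA]; rewrite AR.
have res_xR p : res (xR * p) = xR * res p.
  by rewrite /res resM (@mproj_id _ xR) // mspanX supp_setmnm.
elim: vs => //= v vs IHvs; rewrite free_cons => /andP[v_vs fvs].
split=> [|c Mc vc]; first exact: IHvs.
pose e v := lform (resv A v).
have res_e u : res (e u) = e u by rewrite /e -res_lform; apply: res_res.
have resum s p : gsum P (@lform F N) (fun=> M) s p ->
    exists2 q, res p = xR * q & gsum (@ideal_zero S) e (fun=> @ideal_full S) s q.
  elim: s p => /= [p /resP->|u s IHs p [d Md /IHs[q rq gq]]]; first by exists 0; rewrite ?mulr0.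
  have [d' dE] := setmnm_dvd (resM' d Md).
  exists (q + e u * d'); last by exists d' => //; rewrite addrK.
  have -> : res p = res (p - lform u * d) + res (lform u * d) by rewrite -resD subrK.
  by rewrite rq /res resM res_lform -/res dE mulrDr mulrCA.
have [q rq gq] := resum _ _ vc.
have [c' cE] := setmnm_dvd (resM' c Mc).
have {gq} : gsum (@ideal_zero S) e (fun=> @ideal_full S) vs c'.
  have gsum_resv s p : gsum (@ideal_zero S) e (fun=> @ideal_full S) s p <->
      gsum (@ideal_zero S) (@lform F N) (fun=> @ideal_full S) (map (resv A) s) p.
    by elim: s p => //= u s IHs p; split=> -[d _ /IHs]; exists d.
  apply: (iffRL (gsum_resv vs c')); apply: (@lform_regular _ _ (resv A v)); first by rewrite free_cons v_vs.
  apply: (iffLR (gsum_resv vs _)); suff <- : q = e v * c' by [].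
  by apply: (mulfI xR0); rewrite -rq /res resM res_lform -/res cE mulrCA.
have M_res p : M p -> P (p - res p).
  move=> Mp; apply: MP; last by rewrite /res resB res_res subrr.
  by apply: mspanB => //; apply: mspan_proj_stable.
(* The way back from the polynomial ring on [A]: a linear form and its restriction act alike on
   multiples of $x_R$ in the variables of [A], since the difference involves a variable outside [A]
   and lies in [P]. *)
have lift s p : gsum (@ideal_zero S) e (fun=> @ideal_full S) s p ->
    gsum P (@lform F N) (fun=> M) s (xR * res p).
  elim: s p => /= [p ->|u s IHs p [d _ /IHs]]; first by rewrite /res res0 mulr0; exact: mspan0.
  set G := gsum _ _ _ _ => Gp; exists (xR * res d); first exact: MXR.
  have IG : is_ideal G by apply: gsum_ideal.
  have : P ((lform u - e u) * (xR * res d)).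
    apply: MP; first by apply: (idealM IM); apply: MXR.
    by rewrite /res resM resB -/res res_e /res res_lform subrr mul0r.
  move/(@gsum_base _ _ (@lform F N) P (fun=> M) s _ (fun=> ideal0 IM)) => Pd.
  have := idealB IG Gp Pd; rewrite /res resB resM -/res res_e.
  by rewrite mulrBr mulrBl opprB [xR * (e u * _)]mulrCA addrA subrK.
move/lift => Gc; have IG : is_ideal (gsum P (@lform F N) (fun=> M) vs) by apply: gsum_ideal.
apply: (idealBr IG) Gc _; rewrite -res_xR -cE.
rewrite /res res_res; apply: gsum_base; [by move=> _; exact: mspan0 | exact: M_res].
Qed.

(* [ws] lists the facets in reverse shelling order. *)
Lemma regular_shelling (I : eqType) (ws : seq I) (A : I -> {set T}) (vs : seq 'rV[F]_N) :
    (forall w ws', suffix (w :: ws') ws -> exists R : {set T},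
       R \subset A w /\ forall G, G \subset A w -> offacets (map A ws') G = (R \subset G)) ->
    (forall w, w \in ws -> free (map (resv (A w)) vs)) ->
  regular (mspan (offacets (map A ws))) (@ideal_full S) (@lform F N) vs.
Proof.
elim: ws => [|w ws IHws] shell fr.
  elim: vs {shell fr} => //= v vs IHvs; split=> // c _ _.
  apply: gsum_base => //; exact/mspanP.
have [R [RA AR]] := shell w ws (suffix_refl _).
(* The head of the list is the facet added last. [regular_piece] covers the step between the two
   ideals, the induction hypothesis the rest. *)
apply: (@regular_ext _ _ _ (mspan (offacets (map A ws)))).
- exact/mspan_ideal/offacets_up.
- exact/mspan_ideal/offacets_up.
- exact: is_ideal_full.
- by move=> p; apply: mspan_sub => G; rewrite /offacets /= negb_or => /andP[].
- by [].
- by apply: regular_piece RA AR _; apply: fr; rewrite inE eqxx.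
apply: IHws => [w' ws' sf|w' w'ws]; last by apply: fr; rewrite inE w'ws orbT.
by apply: shell; apply: suffix_trans sf (suffix_cons _ _).
Qed.

End Shelling.
End MonomialSpans.

(** * Signed words, their descents and their lexicographic order *)

Section SignedWords.
Variable n : nat.

(* A letter [(false, i)] adds [i] to the lower end of an interval, [(true, i)]
   removes it from the upper end; the key puts the former before the latter. The
   value [n], between the two groups, closes the words: the last letter counts as
   a descent when it is positive. *)
Definition letter : Type := bool * 'I_n.
Implicit Types (x y z : letter) (u v w p q : seq letter) (W : {set 'I_n}).

Definition lkey x : nat := x.1 * n.+1 + x.2.

Lemma lkey_inj : injective lkey.
Proof.
move=> [[] i] [[] j]; rewrite /lkey /= ?mul1n ?mul0n ?add0n => /eqP.
- by rewrite eqn_add2l => /eqP/val_inj ->.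
- by rewrite eqn_leq => /andP[]; have := ltn_ord j; lia.
- by rewrite eqn_leq => /andP[]; have := ltn_ord i; lia.
by move/eqP/val_inj ->.
Qed.

Lemma lkey_neg x : (lkey x < n)%N = ~~ x.1.
Proof. by case: x => [[] i]; rewrite /lkey /= ?mul1n ?mul0n; have := ltn_ord i; lia. Qed.

Lemma lkey_neq x : lkey x != n.
Proof. by case: x => [[] i]; rewrite /lkey /= ?mul1n ?mul0n; have := ltn_ord i; lia. Qed.

Definition wdesc w k := (nth n (map lkey w) k.+1 < nth n (map lkey w) k)%N.

Lemma wdesc_size w k : wdesc w k -> (k < size w)%N.
Proof.
rewrite /wdesc; case: (ltnP k (size w)) => // wk.
by rewrite !nth_default ?size_map ?ltnn // (leq_trans wk).
Qed.

(** Keys are smaller than $2n+2$, so with keys as digits in this base the comparison of words of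
    equal length is lexicographic. A natural number serves both as sorting key and as induction
    measure. *)
Fixpoint wrank w : nat := if w is x :: w' then lkey x * n.*2.+2 ^ size w' + wrank w' else 0.

Lemma wrank_ub w : (wrank w < n.*2.+2 ^ size w)%N.
Proof.
elim: w => //= x w IHw; rewrite expnS.
have : (lkey x < n.*2.+2)%N.
  by case: x => [[] i]; rewrite /lkey /= ?mul1n ?mul0n; have := ltn_ord i; lia.
move: (_ ^ _)%N IHw => B wB xk.
apply: (@leq_trans ((lkey x).+1 * B)); last by rewrite leq_mul2r xk orbT.
by rewrite mulSn; lia.
Qed.

Lemma wrank_head x y u v : size u = size v -> (lkey x < lkey y)%N ->
  (wrank (x :: u) < wrank (y :: v))%N.
Proof.
move=> suv xy /=; rewrite -suv; have := wrank_ub u; move: (_ ^ _)%N => B uB.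
apply: (@leq_trans ((lkey x).+1 * B)); first by rewrite mulSn; lia.
by apply: (leq_trans _ (leq_addr _ _)); rewrite leq_mul2r xy orbT.
Qed.

Lemma wrank_cat p u v : size u = size v -> (wrank u < wrank v)%N ->
  (wrank (p ++ u) < wrank (p ++ v))%N.
Proof. by move=> suv uv; elim: p => //= x p IHp; rewrite !size_cat suv ltn_add2l. Qed.

(** Up to the first descent a word increases, so its first letter has the least key of that block. A
    word without descents increases up to the closing value [n], and all its letters are
    negative. *)
Lemma wdesc_min x u :
  (exists2 l, wdesc (x :: u) l & forall y, y \in take l.+1 (x :: u) -> (lkey x <= lkey y)%N)
  \/ forall y, y \in x :: u -> (lkey x <= lkey y)%N && ~~ y.1.
Proof.
elim: u x => [|x' u IHu] x.
  have [xn|nx] := ltnP (lkey x) n.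
    by right => y; rewrite inE => /eqP ->; rewrite leqnn -lkey_neg.
  left; exists 0; first by rewrite /wdesc /= ltn_neqAle nx eq_sym lkey_neq.
  by move=> y; rewrite inE => /eqP ->.
have [x'x|xx'] := ltnP (lkey x') (lkey x).
  by left; exists 0 => // y; rewrite inE => /eqP ->.
have [[l dl minl]|all] := IHu x'; [left|right].
  exists l.+1 => // y; rewrite [take _ _]/= inE => /predU1P[-> //|/minl].
  exact: leq_trans.
move=> y; rewrite inE => /predU1P[->|/all/andP[xy ->]]; last by rewrite (leq_trans xx').
by rewrite leqnn -lkey_neg (leq_ltn_trans xx') // lkey_neg; have /andP[] := all x' (mem_head _ _).
Qed.

(* Lexicographic minimality: the blocks cut out by the descents of [u] are
   increasing, and the last one consists of negative letters. *)
Lemma wrank_min u v :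
    uniq (map snd u) -> perm_eq (map snd u) (map snd v) ->
    (forall k, wdesc u k -> take k.+1 v =i take k.+1 u) -> u != v ->
  (wrank u < wrank v)%N.
Proof.
elim: u v => [|x u IHu] [|y v] //= uu; first by move/perm_size.
  by move/perm_size.
move=> puv cond; have suv : size u = size v by have [] := perm_size puv; rewrite !size_map.
have [xy neq|xy _] := eqVneq x y; last first.
  apply: wrank_head => //; rewrite ltn_neqAle (inj_eq lkey_inj) xy /=.
  have [[l dl minl]|all] := wdesc_min x u.
    by apply: minl; rewrite -cond // mem_head.
  have : y.2 \in map snd (x :: u) by rewrite (perm_mem puv) mem_head.
  case/mapP => z /all/andP[xz nz] yz; apply: leq_trans xz _.
  by rewrite /lkey yz (negbTE nz) leq_addl.
subst y; case/andP: uu => xu uu.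
rewrite suv ltn_add2l; apply: IHu => //.
- by rewrite /= perm_cons in puv.
- move=> k dk z; have /(_ z) := cond k.+1 dk.
  rewrite !inE.
  have [zx|//] := eqVneq z x.
  have xv : x.2 \notin map snd v.
    by rewrite -(perm_mem (_ : perm_eq (map snd u) _)) //; rewrite /= perm_cons in puv.
  have nu s : x.2 \notin map snd s -> (z \in take k.+1 s) = false.
    by move=> xs; apply: contraNF xs => /mem_take zs; rewrite -zx map_f.
  by rewrite !nu.
by apply: contra neq => /eqP ->.
Qed.

Definition neg_head w := if w is x :: _ then ~~ x.1 else true.
Definition word W w := perm_eq (map snd w) (enum W) && neg_head w.

Lemma word_uniq W w : word W w -> uniq (map snd w).
Proof. by case/andP => /perm_uniq -> _; apply: enum_uniq. Qed.

Lemma word_size W w : word W w -> size w = #|W|.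
Proof. by case/andP => /perm_size; rewrite size_map cardE. Qed.

Lemma word_mem W w : word W w -> forall x, x \in w -> x.2 \in W.
Proof. by case/andP => /perm_mem pw _ x /(map_f snd); rewrite pw mem_enum. Qed.

(** An interior descent is undone by exchanging its two letters, a descent at the end by making the
    last letter negative. Only the prefix of length [k.+1] changes as a set. The head stays negative
    because the letter that may replace it has a smaller key. *)
Lemma word_desc W w k : word W w -> wdesc w k ->
  exists2 w', word W w' & [/\ (wrank w' < wrank w)%N,
    forall l, (l < size w)%N -> l != k -> take l.+1 w' =i take l.+1 w
    & all (fun x => ~~ x.1) w -> all (fun x => ~~ x.1) w'].
Proof.
move=> ww dk; have kw := wdesc_size dk.
have defw := cat_take_drop k w; set p := take k w in defw.
have sp : size p = k by rewrite size_takel // ltnW.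
case Eu: (drop k w) defw => [|a u] defw.
  by have := size_drop k w; rewrite Eu /= => /esym/eqP; rewrite subn_eq0 leqNgt kw.
have nthw j : nth n (map lkey w) (k + j) = nth n (map lkey (a :: u)) j.
  by rewrite -defw map_cat nth_cat size_map sp ltnNge leq_addr addKn.
have := nthw 0%N; have := nthw 1%N; rewrite addn0 addn1 => nth1 nth0.
move: dk; rewrite /wdesc nth1 nth0.
case: u Eu defw {nth1 nth0 nthw} => [|b u] Eu defw /= dk.
  pose a' : letter := (false, a.2).
  have a1 : a.1 by apply: contraLR dk; rewrite -lkey_neg -leqNgt => /ltnW.
  exists (p ++ [:: a']).
    case/andP: ww; rewrite /word -defw !map_cat => -> /=; case: (p) => //=.
  split.
  - rewrite -defw; apply: wrank_cat => //; apply: wrank_head => //.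
    by rewrite /lkey a1 mul1n -[X in (X < _)%N]add0n ltn_add2r.
  - move=> l; rewrite -defw size_cat addn1 ltnS sp => lk nlk.
    have {lk nlk} lk : (l < k)%N by rewrite ltn_neqAle nlk.
    by move=> z; rewrite !takel_cat // sp.
  by rewrite -defw !all_cat /= a1 andbF.
exists (p ++ b :: a :: u).
  case/andP: ww => pw hw; rewrite /word -defw /= in pw hw *; apply/andP; split.
    apply: perm_trans _ pw; rewrite !map_cat perm_cat2l.
    by have /permPl := perm_catCA [:: b.2] [:: a.2] (map snd u).
  case: (p) hw => //=; rewrite -!lkey_neg; exact: ltn_trans.
split.
- by rewrite -defw; apply: wrank_cat => //; apply: wrank_head.
- move=> l _ nlk z; rewrite -defw; have [lk|kl|/eqP] := ltngtP l k; last by rewrite (negbTE nlk).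
    by rewrite !takel_cat // sp.
  rewrite !take_cat sp ltnNge (leqW (ltnW kl)) /= subSn ?(ltnW kl) //.
  have : (0 < l - k)%N by rewrite subn_gt0.
  case: (l - k)%N => // j _; rewrite !mem_cat [take _ (b :: _)]/= [take _ (a :: _)]/= !inE.
  by congr (_ || _); rewrite orbCA.
by rewrite -defw !all_cat /= => /and4P[-> -> -> ->].
Qed.

End SignedWords.

(** * Facets of the subdivision over a face of the simplex, and their shelling *)

Section CubicalFacets.
Variable n : nat.
Implicit Types (I J K : Defs.interval n) (G : {set Defs.interval n}) (W : {set 'I_n}) (w p q : seq (letter n)).

Definition ilo I := (val I).1.
Definition ihi I := (val I).2.

Lemma ilo_neq0 I : ilo I != set0. Proof. by have /andP[] := valP I. Qed.
Lemma ilo_hi I : ilo I \subset ihi I. Proof. by have /andP[] := valP I. Qed.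

Lemma interval_inj I J : ilo I = ilo J -> ihi I = ihi J -> I = J.
Proof.
by move=> lo hi; apply: val_inj; rewrite [val I]surjective_pairing [val J]surjective_pairing; congr pair.
Qed.

Lemma mem_interval_set I D : (D \in interval_set I) = (ilo I \subset D) && (D \subset ihi I).
Proof. by rewrite inE. Qed.

Lemma interval_subE I J :
  (interval_set I \subset interval_set J) = (ilo J \subset ilo I) && (ihi I \subset ihi J).
Proof.
apply/subsetP/andP => [IJ|[lo hi] D].
  have := IJ (ilo I); have := IJ (ihi I).
  rewrite !mem_interval_set !subxx ilo_hi andbT => /(_ isT)/andP[_ ->] /(_ isT)/andP[-> _].
  by [].
by rewrite !mem_interval_set => /andP[/(subset_trans lo)-> /subset_trans->].
Qed.

Definition faceW W G := interval_chain G && [forall I in G, ihi I \subset W].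

Lemma faceW_sub W G (H : {set Defs.interval n}) : G \subset H -> faceW W H -> faceW W G.
Proof.
move=> /[dup] GH /subsetP GH' /andP[/(interval_chainS GH) cG /forall_inP HW].
by rewrite /faceW cG; apply/forall_inP => I /GH'/HW.
Qed.

Definition negs p := [set i | (false, i) \in p].
Definition poss p := [set i | (true, i) \in p].
(** The interval reached from [(set0, W)] by reading [p]. Its lower end must be nonempty from the
    first letter on, hence the negative head required of words. *)
Definition wint W p := (negs p, W :\: poss p).

Lemma wint_eq W p q : wint W p = wint W q ->
  (forall x, x \in p -> x.2 \in W) -> (forall x, x \in q -> x.2 \in W) -> p =i q.
Proof.
move=> [/setP Np /setP Pp] pW qW [[] i]; last by have := Np i; rewrite !inE.
have := Pp i; rewrite !inE; have [iW|iW] := boolP (i \in W).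
  by rewrite !andbT => /negb_inj.
move=> _; transitivity false; first by apply: contraNF iW => /pW.
by apply/esym; apply: contraNF iW => /qW.
Qed.

Lemma wint_mem W p q : p =i q -> wint W p = wint W q.
Proof. by move=> pq; congr pair; apply/setP => i; rewrite !inE pq. Qed.

Definition wface W w : {set Defs.interval n} :=
  [set I | has (fun k => val I == wint W (take k.+1 w)) (iota 0 (size w))].
(** The vertices at the descents: the restriction set of the facet in the lexicographic shelling. *)
Definition wres W w : {set Defs.interval n} :=
  [set I | has (fun k => wdesc w k && (val I == wint W (take k.+1 w))) (iota 0 (size w))].

Lemma wfaceP W w I :
  reflect (exists2 k, (k < size w)%N & val I = wint W (take k.+1 w)) (I \in wface W w).
Proof.
rewrite inE; apply: (iffP hasP) => [[k]|[k kw /eqP Ik]].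
  by rewrite mem_iota => /andP[_ kw] /eqP; exists k.
by exists k; rewrite // mem_iota.
Qed.

Lemma wresP W w I :
  reflect (exists2 k, wdesc w k & val I = wint W (take k.+1 w)) (I \in wres W w).
Proof.
rewrite inE; apply: (iffP hasP) => [[k]|[k dk Ik]].
  by move=> _ /andP[dk /eqP Ik]; exists k.
by exists k; rewrite ?mem_iota ?(wdesc_size dk) // dk Ik /=.
Qed.

Section Word.
Variables (W : {set 'I_n}) (w : seq (letter n)).
Hypothesis ww : word W w.

Lemma word_take k x : x \in take k w -> x.2 \in W.
Proof. by move=> /mem_take; apply: word_mem. Qed.

Lemma wint_interval k : (k < size w)%N -> exists I : Defs.interval n, val I = wint W (take k.+1 w).
Proof.
move=> kw; have P : ((wint W (take k.+1 w)).1 != set0) && ((wint W (take k.+1 w)).1 \subset (wint W (take k.+1 w)).2).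
  apply/andP; split.
    case: (w) ww kw => // -[b i] w' /andP[_ /= /negbTE ->] _; apply/set0Pn; exists i.
    by rewrite inE mem_head.
  apply/subsetP => i; rewrite !inE => ni; apply/andP; split; last exact: (word_take ni).
  apply/negP => pi; have := word_uniq ww.
  rewrite -(cat_take_drop k.+1 w) map_cat cat_uniq => /and3P[ut _ _].
  move: (take _ _) ni pi ut => s; elim: s => //= x s IHs; rewrite !inE.
  case/predU1P => [<-|ns] /predU1P[xi|ps] //=.
  - by case/andP => /negP[]; exact: (map_f snd ps).
  - by case/andP => /negP[]; rewrite -xi; exact: (map_f snd ns).
  - by case/andP => _; apply: IHs.
by exists (Sub (wint W (take k.+1 w)) P : Defs.interval n); rewrite SubK.
Qed.

Lemma wint_index w' k l : word W w' -> (k < size w)%N -> (l < size w')%N ->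
  wint W (take k.+1 w) = wint W (take l.+1 w') -> k = l /\ take k.+1 w =i take l.+1 w'.
Proof.
move=> ww' kw lw' /wint_eq eqkl.
have {}eqkl : take k.+1 w =i take l.+1 w'.
  by apply: eqkl => x; [apply: word_take | move=> /mem_take; apply: word_mem].
split=> //; apply: succn_inj.
rewrite -(size_takel kw) -(size_takel lw'); apply: perm_size.
by apply: uniq_perm => //; apply: take_uniq; [move: ww | move: ww'] => /word_uniq/map_uniq.
Qed.

Lemma wface_faceW : faceW W (wface W w).
Proof.
apply/andP; split; last first.
  by apply/forall_inP => I /wfaceP[k _]; rewrite /ihi => -> /=; apply: subsetDl.
have sub I J k l : (k <= l)%N -> val I = wint W (take k.+1 w) -> val J = wint W (take l.+1 w) ->
    interval_set J \subset interval_set I.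
  move=> kl Ik Jl; rewrite interval_subE /ilo /ihi Ik Jl /=.
  have tt x : x \in take k.+1 w -> x \in take l.+1 w.
    by rewrite -(take_takel w (_ : k.+1 <= l.+1)%N) // => /mem_take.
  apply/andP; split; first by apply/subsetP => i; rewrite !inE => /tt.
  by apply/setDS/subsetP => i; rewrite !inE => /tt.
apply/forall_inP => I /wfaceP[k _ Ik]; apply/forall_inP => J /wfaceP[l _ Jl].
by case/orP: (leq_total k l) => kl; [rewrite orbC (sub I J k l) | rewrite (sub J I l k)].
Qed.

Lemma wres_sub : wres W w \subset wface W w.
Proof. by apply/subsetP => I /wresP[k /wdesc_size kw Ik]; apply/wfaceP; exists k. Qed.

(** A facet containing all vertices at the descents of [w] comes from a word with the same prefix
    sets there, and among these words [w] has the least rank by [wrank_min]. *)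
Lemma wface_shell G w' : word W w' -> w' != w -> (wrank w' <= wrank w)%N ->
  wres W w \subset G -> G \subset wface W w' -> False.
Proof.
move=> ww' neq rk /subsetP RG /subsetP GF.
suff : (wrank w < wrank w')%N by rewrite ltnNge rk.
apply: wrank_min; first exact: word_uniq ww.
- by case/andP: ww => p1 _; case/andP: ww' => p2 _; apply: perm_trans p1 _; rewrite perm_sym.
- move=> k dk; have kw := wdesc_size dk; have [I Ik] := wint_interval kw.
  have /GF/wfaceP[l lw'] : I \in G by apply/RG/wresP; exists k.
  by rewrite Ik => /(wint_index ww' kw lw')[<-] kk z; rewrite kk.
by rewrite eq_sym.
Qed.

(** If a vertex at a descent is absent from [G], undoing that descent gives a smaller word whose
    facet has all the other vertices of the facet of [w]. *)
Lemma wface_shell_ex G : G \subset wface W w -> ~~ (wres W w \subset G) ->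
  exists w', [/\ word W w', (wrank w' < wrank w)%N & G \subset wface W w'].
Proof.
move=> /subsetP GF /subsetPn[I /wresP[k dk Ik] IG].
have [w' ww' [rk cond _]] := word_desc ww dk; exists w'; split=> //.
apply/subsetP => J JG; have /wfaceP[l lw Jl] := GF J JG.
apply/wfaceP; exists l; first by rewrite (word_size ww') -(word_size ww).
rewrite Jl; apply: wint_mem => z; rewrite cond //; apply: contraNneq IG => lk.
by have -> : I = J by apply: val_inj; rewrite Ik Jl lk.
Qed.

End Word.

Section ExtendChain.
Variables (W : {set 'I_n}) (G : {set Defs.interval n}).
Hypothesis fG : faceW W G.

Let isfree I (i : 'I_n) := (i \notin ilo I) && (i \in ihi I).
Let depth i := #|[set I in G | isfree I i]|.
Let sgn i := [exists I in G, i \notin ihi I].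
Let key i := ((depth i).*2 + sgn i)%N.
Let above I := #|[set J in G | (interval_set I \proper interval_set J)]|.

Let chainG I J : I \in G -> J \in G ->
  (interval_set I \subset interval_set J) || (interval_set J \subset interval_set I).
Proof. by case/andP: fG => /forall_inP cG _ IG; apply: (forall_inP (cG I IG)). Qed.

Let free_up I J i : interval_set I \subset interval_set J -> isfree I i -> isfree J i.
Proof.
rewrite interval_subE => /andP[/subsetP lo /subsetP hi] /andP[il ih].
by rewrite /isfree hi // andbT; apply: contra il => /lo.
Qed.

(** In a chain, [i] is free exactly in the [depth i] largest intervals, so it is already decided at
    [I] when its depth is at most the number of intervals strictly above [I]. The odd bound absorbs
    the sign bit of [key]. *)
Let depth_le I i : I \in G -> (~~ isfree I i) = (key i <= (above I).*2.+1)%N.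
Proof.
move=> IG; have [fi|nfi] := boolP (isfree I i).
  apply/esym; apply: contraTF isT => kle.
  have : (above I < depth i)%N.
    apply: proper_card; apply/properP; split.
      apply/subsetP => J; rewrite !inE => /andP[-> /proper_sub IJ].
      exact: free_up fi.
    by exists I; rewrite !inE IG // properxx.
  by move: kle; rewrite /key; case: (sgn i); lia.
have : (depth i <= above I)%N.
  apply/subset_leq_card/subsetP => J; rewrite !inE => /andP[JG fJ].
  rewrite JG properE; have nJI : ~~ (interval_set J \subset interval_set I).
    by apply: contra nfi => /free_up; apply.
  by rewrite nJI andbT; have := chainG IG JG; rewrite (negbTE nJI) orbF.
by rewrite /key; case: (sgn i); lia.
Qed.

Let sgn_nfree I i : I \in G -> ~~ isfree I i -> sgn i = (i \notin ilo I).
Proof.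
move=> IG; rewrite negb_and negbK; have [il _|il /= ih] := boolP (i \in ilo I).
  apply: contraTF isT => /existsP[J /andP[JG]]; case/negP.
  have := chainG IG JG; rewrite !interval_subE => /orP[] /andP[/subsetP lo /subsetP hi].
    exact/hi/(subsetP (ilo_hi I)).
  exact/(subsetP (ilo_hi J))/lo.
by apply/existsP; exists I; rewrite IG.
Qed.

Lemma filter_sorted_take (T : eqType) (f : T -> nat) c (s : seq T) :
  sorted (fun x y => f x <= f y)%N s ->
  [seq x <- s | (f x <= c)%N] = take (count (fun x => f x <= c)%N s) s.
Proof.
elim: s => //= x s IHs sx; have := path_sorted sx => /IHs IH.
have [xc|cx] := leqP (f x) c; first by rewrite add1n /= IH.
have : all (fun y => c < f y)%N s.
  have tr : transitive (fun x y => f x <= f y)%N by move=> a b d; apply: leq_trans.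
  apply: sub_all (order_path_min tr sx) => y; exact: leq_trans.
move=> al; have c0 : count (fun x => f x <= c)%N s = 0%N.
  apply/eqP; rewrite -leqn0 leqNgt -has_count; apply/hasPn => /= y ys.
  by rewrite -ltnNge; have /allP/(_ y ys) := al.
by rewrite IH c0 addn0 take0.
Qed.

(** The word lists [W] in the order in which elements cease to be free as the intervals of the chain
    shrink, with a positive sign for those that leave an upper end. Ties are broken in favour of
    negative letters; since the largest interval has a nonempty lower end, the head is then
    negative. *)
Lemma faceW_ext : exists2 w, word W w & G \subset wface W w.
Proof.
pose r (i j : 'I_n) := (key i <= key j)%N.
have rtot : total r by move=> i j; apply: leq_total.
pose s := sort r (enum W); pose w : seq (letter n) := [seq (sgn i, i) | i <- s].
have sW : s =i W by move=> i; rewrite mem_sort mem_enum.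
have ss : sorted r s by apply: sort_sorted.
have snd_w : map snd w = s by rewrite -map_comp map_id.
have GW I : I \in G -> ihi I \subset W by case/andP: fG => _ /forall_inP; apply.
exists w.
  rewrite /word snd_w perm_sort perm_refl /=.
  rewrite /w; case Es: s ss sW => [//|i0 s'] /= ss sW.
  have [I0 I0G|G0] := pickP (mem G); last first.
    by apply/existsP => -[I /andP[IG _]]; have := G0 I; rewrite inE IG.
  pose I := [arg max_(I > I0 in G) #|interval_set I|].
  have [IG maxI] : I \in G /\ forall J, J \in G -> (#|interval_set J| <= #|interval_set I|)%N.
    by rewrite /I; case: arg_maxnP.
  have aI : above I = 0%N.
    apply/eqP; rewrite cards_eq0; apply/eqP/setP => J; rewrite !inE.
    apply/negP => /andP[JG /proper_card]; by rewrite ltnNge maxI.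
  have /set0Pn[i iI] := ilo_neq0 I.
  have iW : i \in W by apply: (subsetP (GW I IG)); apply: (subsetP (ilo_hi I)).
  have ki : (key i <= 1)%N by have := depth_le i IG; rewrite aI /isfree iI /= => <-.
  have si : sgn i = false.
    by rewrite (@sgn_nfree I) ?iI // /isfree iI.
  have {}ki : key i = 0%N by move: ki; rewrite /key si; case: (depth i).
  have : (key i0 <= key i)%N.
    have tr : transitive r by move=> a b d; apply: leq_trans.
    have := order_path_min tr ss => /allP amin; have : i \in i0 :: s' by rewrite sW.
    by rewrite inE => /predU1P[->|/amin //]; apply: leqnn.
  by rewrite ki leqn0 /key; case: (sgn i0) => //; rewrite addn1.
apply/subsetP => I IG.
pose c := (above I).*2.+1; pose k := count (fun i => key i <= c)%N s.
have tk : take k s = [seq i <- s | ~~ isfree I i].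
  by rewrite -(filter_sorted_take c ss); apply: eq_filter => i; rewrite -depth_le.
have /set0Pn[i iI] := ilo_neq0 I.
have iW j : j \in ilo I -> j \in W by move=> jI; apply: (subsetP (GW I IG)); apply: (subsetP (ilo_hi I)).
have k0 : (0 < k)%N.
  rewrite -has_count; apply/hasP; exists i; first by rewrite sW iW.
  by rewrite -depth_le // /isfree iI.
apply/wfaceP; exists k.-1.
  by rewrite prednK // size_map count_size.
rewrite prednK // [LHS]surjective_pairing -/(ilo I) -/(ihi I); congr pair.
  apply/setP => j; rewrite !inE -map_take tk.
  apply/idP/mapP => [jI|[l]].
    exists j; first by rewrite mem_filter /isfree jI sW iW.
    by rewrite (@sgn_nfree I) ?jI // /isfree jI.
  rewrite mem_filter => /andP[nf _] [+ ->]; rewrite (@sgn_nfree I) // => /esym/negbT.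
  by rewrite negbK.
apply/setP => j; rewrite !inE -map_take tk.
have [jW|jW] := boolP (j \in W); last first.
  by rewrite andbF; apply: contraNF jW; apply: (subsetP (GW I IG)).
rewrite andbT; apply/idP/idP => [jI|].
  apply/mapP => -[l]; rewrite mem_filter => /andP[nf _] [+ jl]; subst l.
  rewrite (@sgn_nfree I) // => /esym jl; move: nf.
  by rewrite /isfree jl jI.
apply: contraR => jI; have nf : ~~ isfree I j by rewrite /isfree (negbTE jI) andbF.
apply/mapP; exists j; first by rewrite mem_filter nf sW.
rewrite (@sgn_nfree I) //; congr pair; apply/esym.
by apply: contra jI; apply: (subsetP (ilo_hi I)).
Qed.

End ExtendChain.

(* The facets of the part of [Kn] over [W], in reverse shelling order. *)
Definition words W : seq (seq (letter n)) :=
  sort (fun u v => wrank v <= wrank u)%N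
    (filter (word W) [seq val t | t <- enum {: #|W|.-tuple (letter n)}]).

Lemma mem_words W w : (w \in words W) = word W w.
Proof.
rewrite mem_sort mem_filter; case: (boolP (word W w)) => //= ww.
have sw : size w == #|W| by rewrite (word_size ww).
by apply/mapP; exists (Tuple sw); rewrite ?mem_enum.
Qed.

Lemma words_uniq W : uniq (words W).
Proof. by rewrite sort_uniq filter_uniq // map_inj_uniq ?enum_uniq //; apply: val_inj. Qed.

Lemma offacets_words W G : offacets (map (wface W) (words W)) G = ~~ faceW W G.
Proof.
congr (~~ _); apply/hasP/idP => [[A /mapP[w]]|/faceW_ext[w ww Gw]].
  by move=> _ -> GA; apply: faceW_sub GA _; apply: wface_faceW.
by exists (wface W w) => //; rewrite map_f // mem_words.
Qed.

Lemma words_shelling W w ws : suffix (w :: ws) (words W) -> exists R : {set Defs.interval n},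
  R \subset wface W w /\
  forall G, G \subset wface W w -> offacets (map (wface W) ws) G = (R \subset G).
Proof.
case/suffixP => us defws; exists (wres W w); split; first exact: wres_sub.
have ww : word W w by rewrite -mem_words defws mem_cat mem_head orbT.
have us_ws : uniq (w :: ws) by have := words_uniq W; rewrite defws cat_uniq => /and3P[].
have tr : transitive (fun u v : seq (letter n) => wrank v <= wrank u)%N.
  by move=> a b d ba ad; apply: leq_trans ad ba.
have sorted_words : sorted (fun u v => wrank v <= wrank u)%N (us ++ w :: ws).
  by rewrite -defws; apply: sort_sorted => a b; apply: leq_total.
move: sorted_words; rewrite (sorted_pairwise tr) pairwise_cat => /and3P[/allrelP us_rk _].
rewrite /= => /andP[/allP rk_ws _].
have mem_ws w' : word W w' -> (wrank w' < wrank w)%N -> w' \in ws.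
  move=> ww' rk; have : w' \in us ++ w :: ws by rewrite -defws mem_words.
  rewrite mem_cat inE => /or3P[w'us|/eqP w'w|//]; last by rewrite w'w ltnn in rk.
  by have := us_rk w' w w'us (mem_head _ _); rewrite leqNgt rk.
move=> G GA; apply/idP/idP => [|RG].
  apply: contraR => nRG; have [w' [ww' rk Gw']] := wface_shell_ex ww GA nRG.
  by apply/hasP; exists (wface W w') => //; apply/map_f/mem_ws.
apply/hasPn => A /mapP[w' w'ws ->]; apply/negP => Gw'.
have ww' : word W w' by rewrite -mem_words defws mem_cat inE w'ws !orbT.
apply: (wface_shell ww ww' _ (rk_ws _ w'ws) RG Gw').
by apply: contraTneq us_ws => w'w; rewrite /= -w'w w'ws.
Qed.

End CubicalFacets.

(** * Coordinates of the vertices, and independence of the parameters on facets *)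

Section Positions.
Variables (R : realType) (n : nat).
Implicit Types (I : Defs.interval n) (i j : 'I_n).
Local Notation ipos := (@interval_pos n R).

Lemma interval_posE I i :
  ipos I 0 i = #|interval_set I|%:R^-1 * \sum_(D in interval_set I) (i \in D)%:R / #|D|%:R.
Proof.
rewrite !mxE summxE; congr (_ * _); apply: eq_bigr => D _.
rewrite !mxE summxE mulrC; congr (_ * _).
have [iD|iD] := boolP (i \in D).
  rewrite (bigD1 i) //= mxE !eqxx big1 ?addr0 // => j /andP[_ ji].
  by rewrite mxE eq_sym (negbTE ji) andbF.
rewrite big1 // => j jD; rewrite mxE; case: eqP => // ij; case: eqP => //= ij'.
by rewrite ij' jD in iD.
Qed.

Lemma interval_set_gt0 I : 0 < #|interval_set I|%:R^-1 :> R.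
Proof.
rewrite invr_gt0 ltr0n card_gt0; apply/set0Pn; exists (ilo I).
by rewrite mem_interval_set subxx ilo_hi.
Qed.

Lemma interval_pos_out I i : i \notin ihi I -> ipos I 0 i = 0.
Proof.
move=> iI; rewrite interval_posE big1 ?mulr0 // => D; rewrite mem_interval_set => /andP[_ /subsetP DI].
by case: (boolP (i \in D)) => [/DI|]; rewrite ?(negbTE iI) // mul0r.
Qed.

Lemma interval_pos_gt0 I i : i \in ihi I -> 0 < ipos I 0 i.
Proof.
move=> iI; rewrite interval_posE mulr_gt0 ?interval_set_gt0 //.
rewrite (bigD1 (ihi I)) /=; last by rewrite mem_interval_set subxx ilo_hi.
rewrite ltr_pwDl //; last by apply: sumr_ge0 => D _; rewrite divr_ge0 ?ler0n.
rewrite iI div1r invr_gt0 ltr0n card_gt0; apply/set0Pn; by exists i.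
Qed.

Lemma interval_pos_eq0 I i : (ipos I 0 i == 0) = (i \notin ihi I).
Proof.
have [iI|iI] := boolP (i \in ihi I); first by rewrite gt_eqF ?interval_pos_gt0.
by rewrite interval_pos_out ?eqxx.
Qed.

(** The transposition of [i] and [j] fixes the interval, hence also its barycenter. *)
Lemma interval_pos_sym I i j : (i \in ilo I) = (j \in ilo I) -> (i \in ihi I) = (j \in ihi I) ->
  ipos I 0 i = ipos I 0 j.
Proof.
move=> lo hi; rewrite -(@interval_pos_act n R (tperm i j) I i) ?inE // tpermL.
have fixS (A : {set 'I_n}) : (i \in A) = (j \in A) -> tperm i j @: A = A.
  move=> ij; apply/setP => k; rewrite -{1}[k](tpermK i j) mem_imset; last exact: perm_inj.
  by case: tpermP => [->|->|//]; rewrite ij.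
congr (ipos _ 0 j); apply: interval_inj; exact: fixS.
Qed.

(** Every set of the interval contains [i], while its lower end omits [j]. *)
Lemma interval_pos_lt I i j : i \in ilo I -> j \notin ilo I -> ipos I 0 j < ipos I 0 i.
Proof.
move=> iI jI; rewrite !interval_posE ltr_pM2l ?interval_set_gt0 //.
rewrite -subr_gt0 -sumrB (bigD1 (ilo I)) /=; last by rewrite mem_interval_set subxx ilo_hi.
rewrite ltr_pwDl //; last first.
  apply: sumr_ge0 => D /andP[]; rewrite mem_interval_set => /andP[/subsetP/(_ i iI) iD _] _.
  by rewrite iD -mulrBl divr_ge0 ?ler0n // subr_ge0 ler_nat leq_b1.
rewrite iI (negbTE jI) mul0r subr0 div1r invr_gt0 ltr0n card_gt0; apply/set0Pn; by exists i.
Qed.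

Variables (F : fieldType) (iota : {rmorphism R -> F}).
Local Notation T := (vtx (Kn n R)).

Definition theta_coord i : 'rV[F]_#|T| := \row_k iota (ipos (enum_val k) 0 i).

Lemma thetaE i : theta iota (Kn n R) i = lform (theta_coord i).
Proof.
rewrite /theta /lform (reindex (enum_val : 'I_#|T| -> T)) /=; last exact/onW_bij/enum_val_bij.
by apply: eq_bigr => k _; rewrite [in RHS]mxE /xvar enum_valK.
Qed.

Definition theta_comb (y : 'rV[F]_n) : 'rV[F]_#|T| := \sum_i y 0 i *: theta_coord i.

Lemma theta_comb_linear : linear theta_comb.
Proof.
move=> a u v; rewrite /theta_comb scaler_sumr -big_split; apply: eq_bigr => i _.
by rewrite !mxE scalerDl scalerA.
Qed.

Implicit Types (W : {set 'I_n}) (w p q : seq (letter n)).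

(** At the vertex of the prefix [p], a coordinate in [W] has one of three values: [ab.1] for the
    negative letters read, [ab.2] for the letters not yet read, and 0 for the positive letters read.
    The conditions on [ab] say that these values are distinct. *)
Lemma theta_comb_prefix W p q (y : 'I_n -> F) (I : T) :
    word W (p ++ q) -> val I = wint W p -> (forall i, i \notin W -> y i = 0) ->
  exists2 ab : F * F, [/\ ab.1 != 0, q != [::] -> ab.2 != 0 & q != [::] -> ab.1 != ab.2] &
    \sum_i y i * iota (ipos I 0 i) =
    ab.1 * \sum_(z <- p | ~~ z.1) y z.2 + ab.2 * \sum_(z <- q) y z.2.
Proof.
move=> ww Ip yW; have /set0Pn[i0 i0I] := ilo_neq0 I.
have uw := word_uniq ww; have memW := word_mem ww.
have disj z z' : z \in p -> z' \in q -> z.2 != z'.2.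
  move=> zp zq; move: uw; rewrite map_cat cat_uniq => /and3P[_ /hasPn h _].
  by apply: contraTneq (map_f snd zp) => ->; apply: h; rewrite map_f.
have inp b b' i : (b, i) \in p -> (b', i) \in p -> b = b'.
  move: uw; rewrite map_cat cat_uniq => /and3P[+ _ _]; elim: (p) => //= x s IHs /andP[xs us].
  rewrite !inE => /predU1P[bx|bs] /predU1P[b'x|b's].
  - by have [] : (b, i) = (b', i) by rewrite bx b'x.
  - by case/negP: xs; rewrite -bx; exact: (map_f snd b's).
  - by case/negP: xs; rewrite -b'x; exact: (map_f snd bs).
  - exact: IHs.
have q_mid z : z \in q -> (z.2 \notin ilo I) && (z.2 \in ihi I).
  move=> zq; rewrite /ilo /ihi Ip !inE memW ?mem_cat ?zq ?orbT // andbT.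
  by apply/andP; split; apply/negP => /disj/(_ zq) /=; rewrite eqxx.
pose j0 := if q is z :: _ then z.2 else i0.
exists (iota (ipos I 0 i0), iota (ipos I 0 j0)) => /=.
  have i0hi := subsetP (ilo_hi I) _ i0I.
  split; first by rewrite fmorph_eq0 interval_pos_eq0 i0hi.
    rewrite /j0; case: (q) q_mid => // z s /(_ _ (mem_head _ _))/andP[_ zI] _.
    by rewrite fmorph_eq0 interval_pos_eq0 zI.
  rewrite /j0; case: (q) q_mid => // z s /(_ _ (mem_head _ _))/andP[zI _] _.
  by rewrite (inj_eq (fmorph_inj iota)) gt_eqF // interval_pos_lt.
transitivity (\sum_(z <- p ++ q) y z.2 * iota (ipos I 0 z.2)).
  rewrite -(big_map snd xpredT (fun i => y i * iota (ipos I 0 i))).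
  have /andP[pw _] := ww; rewrite (perm_big _ pw) big_enum [RHS]big_mkcond /=.
  by apply: eq_bigr => i _; case: ifPn => // /yW ->; rewrite mul0r.
rewrite big_cat /= !mulr_sumr; congr (_ + _).
  rewrite big_seq [RHS]big_mkcond [RHS]big_seq; apply: eq_bigr => -[b i] zp.
  case: b zp => zp /=.
    rewrite interval_pos_out ?rmorph0 ?mulr0 // /ihi Ip !inE zp //.
  rewrite mulrC (@interval_pos_sym I i i0) //.
    by rewrite i0I /ilo Ip inE zp.
  by rewrite !(subsetP (ilo_hi I)) // /ilo Ip inE zp.
rewrite !big_seq; apply: eq_bigr => z zq; rewrite mulrC; congr (iota _ * _).
have jq : exists2 z, z \in q & j0 = z.2.
  by rewrite /j0; case: (q) zq => // a s _; exists a; rewrite ?mem_head.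
case: jq => z' /q_mid/andP[l' h'] ->; have /andP[l h] := q_mid z zq.
by apply: interval_pos_sym; rewrite ?(negbTE l) ?(negbTE l') ?h ?h'.
Qed.

(** Letters are eliminated from the end of the word. Comparing the equations at the prefixes before
    and after a letter [x], when later coordinates of [y] are already zero, kills the coordinate of
    [x]: this uses that [b] is nonzero if [x] is positive, and that [a] and [b] differ if it is
    negative. The head, being negative, is killed by the equation at the first vertex. *)
Lemma theta_comb_facet W w (y : 'rV[F]_n) : word W w -> (forall i, i \notin W -> y 0 i = 0) ->
  resv (wface W w) (theta_comb y) = 0 -> y = 0.
Proof.
move=> ww yW y0.
have yI p q : p ++ q = w -> p != [::] -> exists2 I : T, val I = wint W p &
    \sum_i y 0 i * iota (ipos I 0 i) = 0.
  move=> pq p0; have sp : (size p).-1.+1 = size p by rewrite prednK // lt0n size_eq0.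
  have kw : ((size p).-1 < size w)%N by rewrite -pq size_cat sp leq_addr.
  have tp : take (size p).-1.+1 w = p by rewrite sp -pq take_size_cat.
  have [I Ip] := wint_interval ww kw; exists I; first by rewrite Ip tp.
  have /rowP/(_ (enum_rank I)) := y0; rewrite mxE [RHS]mxE enum_rankK.
  have -> : I \in wface W w by apply/wfaceP; exists (size p).-1.
  move=> y0I; transitivity (theta_comb y 0 (enum_rank I)); last exact: y0I.
  rewrite /theta_comb summxE; apply: eq_bigr => i _.
  by rewrite [in RHS]mxE [in RHS]mxE enum_rankK.
have step p q : p ++ q = w -> p != [::] ->
    (forall z, z \in q -> y 0 z.2 = 0) /\ \sum_(z <- p | ~~ z.1) y 0 z.2 = 0.
  elim: q p => [|x q IHq] p pq p0.
    split=> //; have [I Ip yI0] := yI _ _ pq p0.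
    have [[a b] /= [a0 _ _]] := theta_comb_prefix (etrans (congr1 (word W) pq) ww) Ip yW.
    by rewrite yI0 big_nil mulr0 addr0 => /esym/eqP; rewrite mulf_eq0 (negbTE a0) => /eqP.
  have [||yq s0] := IHq (rcons p x); first by rewrite cat_rcons.
    by rewrite -size_eq0 size_rcons.
  have [I Ip yI0] := yI _ _ pq p0.
  have [[a b] /= [a0 /(_ isT) b0 /(_ isT) ab]] := theta_comb_prefix (etrans (congr1 (word W) pq) ww) Ip yW.
  rewrite yI0 big_cons [X in b * (_ + X)]big_seq [X in b * (_ + X)]big1 ?addr0; last exact: yq.
  move: s0; rewrite -cats1 big_cat big_cons big_nil /=.
  case: (x.1) => /=.
    rewrite addr0 => s0; rewrite s0 mulr0 add0r => /esym/eqP; rewrite mulf_eq0 (negbTE b0) => /eqP xq.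
    by split=> // z; rewrite inE => /predU1P[-> //|]; apply: yq.
  rewrite addr0 => /eqP; rewrite addr_eq0 => /eqP sE; rewrite sE mulrN addrC -mulrBl.
  move/esym/eqP; rewrite mulf_eq0 subr_eq0 eq_sym (negbTE ab) => /= /eqP xq.
  by rewrite xq oppr0; split=> // z; rewrite inE => /predU1P[-> //|]; apply: yq.
apply/rowP => i; rewrite mxE; have [iW|/yW //] := boolP (i \in W).
have iw : i \in map snd w by have /andP[/perm_mem-> _] := ww; rewrite mem_enum.
case: w ww y0 yI step iw => // x q ww _ _ step.
have [yq s0] := step [:: x] q erefl isT.
rewrite inE => /predU1P[->|/mapP[z zq ->]]; last exact: yq.
by move: s0; rewrite big_cons big_nil; case/andP: ww => _ /= ->; rewrite addr0.
Qed.

Lemma theta_comb_free W w (ys : seq 'rV[F]_n) : word W w ->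
  (forall y, y \in ys -> forall i, i \notin W -> y 0 i = 0) -> free ys ->
  free (map (resv (wface W w)) (map theta_comb ys)).
Proof.
move=> ww ysW; rewrite -map_comp; set f := _ \o _.
have flin : linear f.
  move=> a u v; rewrite /f /= theta_comb_linear; apply/rowP => k; rewrite !mxE.
  by case: ifP; rewrite ?mulr0 ?addr0.
pose fL : {linear 'rV[F]_n -> 'rV[F]_#|T|} := HB.pack f (GRing.isLinear.Build _ _ _ _ f flin).
pose phi := linfun fL.
have phiE y : phi y = f y by rewrite lfunE.
rewrite -(eq_map phiE) => fr.
have kerW : (<<ys>> :&: lker phi <= 0)%VS.
  apply/subvP => y /memv_capP[yys]; rewrite memv_ker phiE memv0 => /eqP fy.
  apply/eqP; apply: (theta_comb_facet ww) fy; move=> i iW.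
  rewrite (@coord_span _ _ _ (in_tuple ys) y yys) summxE big1 // => k _.
  by rewrite mxE ysW ?mulr0 // mem_nth.
rewrite /free -limg_span size_map limg_dim_eq //.
by apply/eqP; rewrite -subv0.
Qed.

End Positions.

(** * Carriers, interior ideals and their intersection with the parameter ideal *)

Section InteriorIdeals.
Variables (R : realType) (n : nat) (F : fieldType) (iota : {rmorphism R -> F}).
Local Notation T := (vtx (Kn n R)).
Local Notation S := {mpoly F[#|T|]}.
Implicit Types (W U V : {set 'I_n}) (G H : {set T}) (i j k : 'I_n) (p q c x : S) (s : seq 'I_n).

Definition carr G : {set 'I_n} := \bigcup_(I in G) ihi I.

Lemma carr_sub G H : G \subset H -> carr G \subset carr H.
Proof.
move=> /subsetP GH; apply/bigcupsP => I IG; apply: bigcup_sup; exact: GH.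
Qed.

Lemma carrU G H : carr (G :|: H) = carr G :|: carr H.
Proof. exact: bigcup_setU. Qed.

Lemma faceW_carr W G : faceW W G = interval_chain G && (carr G \subset W).
Proof. by congr (_ && _); apply/forall_inP/bigcupsP. Qed.

(* [nf W] describes the monomials that vanish in the face ring of the part of
   [Kn] over [W], and [jp U W] those whose carrier contains [U] or that vanish. *)
Definition nf W : pred {set T} := fun G => ~~ faceW W G.
Definition jp U W : pred {set T} := fun G => nf W G || (U \subset carr G).
Local Notation iw W := (fun p : S => mspan (nf W) p).
Local Notation J U W := (fun p : S => mspan (jp U W) p).

Lemma nf_up W : upclosed (nf W).
Proof. by move=> G H GH; apply/contra/faceW_sub. Qed.

Lemma jp_up U W : upclosed (jp U W).
Proof.
move=> G H GH /orP[nG|UG]; first by rewrite /jp (nf_up GH nG).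
by rewrite /jp (subset_trans UG (carr_sub GH)) orbT.
Qed.

Lemma iw_ideal W : is_ideal (iw W). Proof. exact/mspan_ideal/nf_up. Qed.
Lemma J_ideal U W : is_ideal (J U W). Proof. exact/mspan_ideal/jp_up. Qed.
Hint Resolve iw_ideal J_ideal : core.

Lemma nf_mono W V G : V \subset W -> nf W G -> nf V G.
Proof.
move=> VW; apply: contra; rewrite !faceW_carr => /andP[-> GV]; exact: subset_trans VW.
Qed.

Lemma jp_mono U V W G : U \subset V -> jp V W G -> jp U W G.
Proof. by move=> UV /orP[nG|VG]; rewrite /jp ?nG // (subset_trans UV VG) orbT. Qed.

Lemma jp_monoW U V W G : V \subset W -> jp U W G -> jp U V G.
Proof. by move=> VW /orP[/(nf_mono VW) nG|UG]; rewrite /jp ?nG // UG orbT. Qed.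

Lemma nf_jp U W G : nf W G -> jp U W G. Proof. by rewrite /jp => ->. Qed.

Lemma jp_nf U W V G : ~~ (U \subset V) -> V \subset W -> jp U W G -> nf V G.
Proof.
move=> UV VW /orP[/(nf_mono VW) //|UG]; rewrite /nf faceW_carr negb_and.
by apply/orP; right; apply: contra UV; apply: subset_trans.
Qed.

Local Notation th := (theta iota (Kn n R)).

Lemma theta_carr i : mspan (fun G => i \in carr G) (th i).
Proof.
apply: mspan_sum => I _; have [iI|iI] := boolP (i \in ihi I); last first.
  by rewrite /= interval_pos_out // rmorph0 scale0r mspan0.
by rewrite mspanZ // mspanX supp1 enum_rankK /carr big_set1.
Qed.

Lemma theta_J U W i c : mspan (jp (U :\ i) W) c -> mspan (jp U W) (th i * c).
Proof.
apply: mspan_mul (theta_carr i) => G H iG /orP[nH|UH].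
  by apply: nf_jp; apply: nf_up nH; apply: subsetUr.
rewrite /jp carrU; apply/orP; right; apply/subsetP => k kU; rewrite inE.
have [->|ki] := eqVneq k i; first by rewrite iG.
by rewrite (subsetP UH) ?orbT // !inE ki.
Qed.

Lemma theta_iw W i c : i \notin W -> mspan (nf W) (th i * c).
Proof.
move=> iW; apply: mspan_mul (theta_carr i) (mspanT c) => G H iG _.
rewrite /nf faceW_carr negb_and carrU; apply/orP; right; apply: contra iW.
by move/subsetP; apply; rewrite inE iG.
Qed.

(** The Cohen-Macaulay property in explicit form. It is stated for arbitrary independent
    combinations, because it is applied both to the $\theta_i$ and to eigenvectors of a
    permutation. *)
Lemma mspan_full_regular W (ys : seq 'rV[F]_n) :
  (forall y, y \in ys -> forall i, i \notin W -> y 0 i = 0) -> free ys ->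
  regular (iw W) (@ideal_full S) (@lform F _) (map (theta_comb iota) ys).
Proof.
move=> ysW fys.
have := @regular_shelling F T _ (words W) (wface W) (map (theta_comb iota) ys).
have -> : offacets (map (wface W) (words W)) = nf W by apply: funext => G; apply: offacets_words.
apply; first exact: words_shelling.
by move=> w; rewrite mem_words => ww; apply: theta_comb_free.
Qed.

Lemma theta_comb_delta i : lform (theta_comb iota (delta_mx 0 i)) = th i.
Proof.
rewrite thetaE /theta_comb (bigD1 i) //= big1 ?addr0 => [|j ji]; first by rewrite mxE !eqxx scale1r.
by rewrite mxE (negbTE ji) andbF scale0r.
Qed.

Lemma free_delta s : uniq s -> free [seq delta_mx 0 i : 'rV[F]_n | i <- s].
Proof.
move=> us; pose f i : 'rV[F]_n := delta_mx 0 i.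
apply/(@freeP _ _ _ (map_tuple f (in_tuple s))) => k kE a; pose t := tnth (in_tuple s).
have fE (b : 'I_(size s)) : (map_tuple f (in_tuple s))`_b = delta_mx 0 (t b).
  by rewrite (nth_map (t b)) //; congr (delta_mx 0 _); rewrite -(tnth_nth _ (in_tuple s)).
have /rowP/(_ (t a)) := kE; rewrite mxE summxE (bigD1 a) //= big1 ?addr0.
  by rewrite mxE [X in _ * X]( congr1 (fun v : 'rV[F]_n => v 0 (t a)) (fE a)) mxE !eqxx mulr1.
move=> b ba; rewrite mxE [X in _ * X]( congr1 (fun v : 'rV[F]_n => v 0 (t a)) (fE b)) mxE eqxx /=.
case: eqP => [e|_]; last by rewrite mulr0.
by case/eqP: ba; apply: (tuple_uniqP (in_tuple s) us); rewrite -/t e.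
Qed.

Lemma gsum_in_W W s x :
  gsum (iw W) th (fun=> @ideal_full S) s x <->
  gsum (iw W) th (fun=> @ideal_full S) [seq j <- s | j \in W] x.
Proof.
split; apply: gsum_sub_in => [|p|j c js _].
- by apply: gsum_ideal => [|j]; [exact: iw_ideal | exact: is_ideal_full].
- by move=> pI; apply: gsum_base.
- have [jW|jW] := boolP (j \in W); last by apply: gsum_base; rewrite ?theta_iw.
  by apply: gsum_mem => //; [apply: mspan0 | rewrite mem_filter jW].
- by apply: gsum_ideal => [|j]; [exact: iw_ideal | exact: is_ideal_full].
- by move=> pI; apply: gsum_base.
- by apply: gsum_mem => //; [apply: mspan0 | rewrite mem_filter in js; case/andP: js].
Qed.

Lemma theta_regular W s i c : i \in W -> uniq (i :: s) ->
  gsum (iw W) th (fun=> @ideal_full S) s (th i * c) -> gsum (iw W) th (fun=> @ideal_full S) s c.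
Proof.
move=> iW /andP[is_ us] /gsum_in_W h; apply/gsum_in_W; move: h.
set t := filter _ _.
have ut : uniq (i :: t) by rewrite /= mem_filter negb_and is_ orbT filter_uniq.
have h : regular (iw W) (@ideal_full S) (@lform F _) (map (theta_comb iota) [seq delta_mx 0 j | j <- i :: t]).
  apply: mspan_full_regular (free_delta ut) => y /mapP[j jt ->] k kW; rewrite mxE.
  rewrite eqxx /=; case: eqP => // kj; case/negP: kW; rewrite kj.
  by move: jt; rewrite inE => /predU1P[-> //|]; rewrite mem_filter => /andP[].
have gE r p : gsum (iw W) (@lform F _) (fun=> @ideal_full S)
     (map (theta_comb iota) [seq delta_mx 0 j | j <- r]) p <-> gsum (iw W) th (fun=> @ideal_full S) r p.
  by elim: r p => //= j r IHr p; split=> -[d _ /IHr]; exists d => //;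
    rewrite ?theta_comb_delta // -theta_comb_delta.
have [_ /(_ c I)] := h; rewrite theta_comb_delta => hc /(iffRL (gE _ _))/hc.
by move/(iffLR (gE _ _)).
Qed.

Local Notation NJ W U s := (gsum (iw W) th (fun j => J (U :\ j) W) s).

(** Regularity for the whole system of interior ideals: cancelling [th i] removes [i] from the
    carrier conditions on all coefficients. For empty [U] this is [theta_regular]. *)
Definition Jregular U := forall W s i c, i \in W -> uniq (i :: s) ->
  mspan (jp (U :\ i) W) c -> NJ W U s (th i * c) ->
  gsum (iw W) th (fun j => J (U :\ i :\ j) W) s c.

(** One element [k] is added to the carrier condition; repeating this from the empty set up to [W]
    yields [local_cap]. *)
Definition Jcap U := forall W s k x, k \notin U -> uniq s ->
  NJ W U s x -> mspan (jp (k |: U) W) x -> NJ W (k |: U) s x.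

Lemma NJ_ideal W U s : is_ideal (NJ W U s).
Proof. by apply: gsum_ideal. Qed.

Lemma NJ_lift W V (U : 'I_n -> {set 'I_n}) s c : V \subset W ->
  gsum (iw V) th (fun j => J (U j) V) s c ->
  exists2 c', gsum (iw W) th (fun j => J (U j) W) s c' & mspan (nf V) (c - c').
Proof.
move=> VW; elim: s c => [|j s IHs] c /=; first by exists 0; rewrite ?mspan0 ?subr0.
case=> d dJ /IHs[c' c'J cc'].
have [||d1 d1J d2] := @mspan_split _ _ (jp (U j) W) (nf V) (jp (U j) V) d => //.
  by move=> G /orP[-> |UG]; rewrite ?orbT // /jp UG orbT.
exists (th j * d1 + c'); first by exists d1; rewrite // addrAC subrr add0r.
have -> : c - (th j * d1 + c') = (c - th j * d - c') + th j * (d - d1).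
  by rewrite mulrBr opprD; ring.
by apply: mspanD => //; apply: (idealM (iw_ideal V)).
Qed.

(** In [x = th i * c + y] the aim is to choose [c] with [k] in its carriers. Over [W :\ k] the
    element [x] vanishes, so regularity there expresses [c] through the remaining parameters. A lift
    [c'] of that expression is subtracted from [c]: what remains vanishes over [W :\ k], so its
    monomials outside the non-face ideal have [k] in their carrier. *)
Lemma Jcap_of_regular U : Jregular U -> Jcap U.
Proof.
move=> regU W s k x kU; elim: s x => [|i s IHs] x; first by [].
case/andP=> is_ us [c cJ yN] xJ; have IHus := IHs _ us.
have IN : is_ideal (NJ W (k |: U) s) := NJ_ideal _ _ _.
have [ik|ik] := eqVneq i k.
  subst i; have kUk : (k |: U) :\ k = U by apply/setP => j; rewrite !inE; case: eqP => // ->; rewrite (negbTE kU).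
  have UkU : U :\ k = U by apply/setP => j; rewrite !inE; case: eqP => // ->; rewrite (negbTE kU).
  rewrite UkU in cJ; exists c; first by rewrite kUk.
  by apply: IHus => //; apply: mspanB => //; apply: theta_J; rewrite kUk.
have [iW|iW] := boolP (i \in W); last first.
  exists 0; first exact: mspan0.
  rewrite mulr0 subr0; apply: IHus => //; apply: (idealBr (NJ_ideal _ _ _)) yN.
  by apply: gsum_base; [move=> j; exact: mspan0 | exact: theta_iw].
have VW : W :\ k \subset W := subsetDl _ _.
have xV : mspan (nf (W :\ k)) x.
  apply: mspan_sub xJ => G; apply: jp_nf => //; apply/subsetPn; exists k; by rewrite !inE eqxx.
have icV : NJ (W :\ k) U s (th i * c).
  have yV : NJ (W :\ k) U s (x - th i * c).
    apply: gsum_mono yN => [p|j p]; apply: mspan_sub => G; [exact: nf_mono | exact: jp_monoW].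
  have xN : NJ (W :\ k) U s x by apply: gsum_base => // j; exact: mspan0.
  by have := idealB (NJ_ideal _ _ _) xN yV; rewrite opprB addrC subrK.
have cV : mspan (jp (U :\ i) (W :\ k)) c by apply: mspan_sub cJ => G; apply: jp_monoW.
have /(NJ_lift VW)[c' c'N cc'] : gsum (iw (W :\ k)) th (fun j => J (U :\ i :\ j) (W :\ k)) s c.
  by apply: regU icV; rewrite //= ?is_ // !inE ik.
have c'J : mspan (jp (U :\ i) W) c'.
  apply: (gsum_sub (Q := J (U :\ i) W)) c'N => // [p|j d]; last exact: theta_J.
  by apply: mspan_sub => G; apply: nf_jp.
have ccJ : mspan (jp ((k |: U) :\ i) W) (c - c').
  apply: mspan_sub (mspan_and cc' (mspanB cJ c'J)) => G /andP[nG].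
  rewrite /jp; case: (boolP (nf W G)) => //= fG UG; move: nG fG.
  rewrite /nf !faceW_carr negbK negb_and => /orP[/negbTE -> //|GWk] /andP[_ GW].
  have kG : k \in carr G.
    apply: contraNT GWk => kG; apply/subsetP => j jG; rewrite !inE (subsetP GW) // andbT.
    by apply: contraNneq kG => <-.
  apply/subsetP => j; rewrite !inE => /andP[ji /predU1P[-> //|jU]].
  by apply: (subsetP UG); rewrite !inE ji.
(* The correction [th i * c'] is itself a combination of the later parameters with admissible
   coefficients, so it can be moved into [y]. *)
exists (c - c') => //; apply: IHus; last by apply: mspanB => //; apply: theta_J.
have -> : x - th i * (c - c') = (x - th i * c) + th i * c' by rewrite mulrBr opprB addrA addrAC.
have IU : is_ideal (NJ W U s) := NJ_ideal W U s.
apply: (idealD IU yN).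
apply: (gsum_sub_in (Q := fun p => NJ W U s (th i * p)) _ _ _ c'N).
- split=> [|p q pN qN|a p pN].
  + by rewrite mulr0; exact: (ideal0 IU).
  + by rewrite mulrDr; exact: (idealD IU pN qN).
  + by rewrite mulrCA; exact: (idealM IU a pN).
- move=> p pI; apply: gsum_base; first by move=> j; exact: mspan0.
  exact: (idealM (iw_ideal W)).
move=> j d js dJ; rewrite mulrCA; apply: gsum_mem => //; first exact: mspan0.
apply: theta_J; apply: mspan_sub dJ => G; apply: jp_mono.
by apply/subsetP => l; rewrite !inE => /and3P[-> -> ->].
Qed.

(** Induction on the size of [U]. For $U=V\cup\{k\}$, regularity for [V] gives the conclusion except
    for the presence of [k] in the carriers, which [Jcap] for [V :\ i] restores. *)
Lemma Jregular_all U : Jregular U.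
Proof.
have [m] := ubnP #|U|; elim: m U => // m IHm U; rewrite ltnS => Um.
have [->|/set0Pn[k kU]] := eqVneq U set0.
  move=> W s i c iW us _ h.
  have full j (p : S) : ideal_full p -> mspan (jp (set0 :\ i :\ j) W) p.
    by move=> _; apply/mspanP => mm _; rewrite /jp !set0D sub0set orbT.
  apply: (gsum_mono (P := iw W) (M := fun=> @ideal_full S)).
  - by move=> p.
  - by move=> j p; apply: full.
  - by apply: theta_regular iW us _; apply: gsum_mono h.
pose V := U :\ k; have UV : k |: V = U := setD1K kU.
have Vm : (#|V| < m)%N by move: Um; rewrite (cardsD1 k) kU.
have kV : k \notin V by rewrite !inE eqxx.
have regV := IHm V Vm.
rewrite -UV => W s i c iW us cJ h.
have hV : NJ W V s (th i * c).
  apply: gsum_mono h => // j p; apply: mspan_sub => G; apply: jp_mono.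
  by apply/subsetP => l; rewrite !inE => /and3P[-> -> ->]; rewrite orbT.
have cV : mspan (jp (V :\ i) W) c.
  apply: mspan_sub cJ => G; apply: jp_mono.
  by apply/subsetP => l; rewrite !inE => /and3P[-> -> ->]; rewrite orbT.
have cN := regV _ _ _ _ iW us cV hV.
have [ik|ik] := eqVneq i k.
  subst i; apply: gsum_mono cN => // j p; apply: mspan_sub => G; apply: jp_mono.
  apply/subsetP => l; rewrite !inE => /and3P[-> lk /orP[/eqP lk'|/andP[-> ->]]]; last by [].
  by rewrite lk' eqxx in lk.
have capV : Jcap (V :\ i).
  apply: Jcap_of_regular; apply: IHm; apply: leq_ltn_trans Vm.
  exact: subset_leq_card (subsetDl _ _).
have kVi : k |: V :\ i = (k |: V) :\ i.
  apply/setP => l; rewrite !inE; have [->|//] := eqVneq l k.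
  by rewrite /= eq_sym ik.
have := capV W s k c; rewrite kVi; apply=> //.
  by rewrite !inE eqxx andbF.
by case/andP: us.
Qed.

(* The part of [Theta] inside the interior ideal is generated by the obvious
   elements. *)
Lemma local_cap W s x : uniq s -> mspan (jp W W) x ->
  gsum (iw W) th (fun=> @ideal_full S) s x -> NJ W W s x.
Proof.
move=> us; suff IH U : mspan (jp U W) x -> gsum (iw W) th (fun=> @ideal_full S) s x -> NJ W U s x.
  exact: IH.
have [m] := ubnP #|U|; elim: m U => // m IHm U; rewrite ltnS => Um.
have [->|/set0Pn[k kU]] := eqVneq U set0.
  move=> _; apply: gsum_mono => // j p _.
  by apply/mspanP => mm _; rewrite /jp set0D sub0set orbT.
move=> xU xT; pose V := U :\ k; have UV : k |: V = U := setD1K kU.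
have kV : k \notin V by rewrite !inE eqxx.
rewrite -UV; apply: (Jcap_of_regular (@Jregular_all V)) => //; last by rewrite UV.
apply: IHm => //; first by move: Um; rewrite (cardsD1 k) kU.
by apply: mspan_sub xU => G; apply: jp_mono; apply: subsetDl.
Qed.

End InteriorIdeals.

(** * Traces on the homogeneous components of ideals *)

Section GradedTraces.
Variables (R : realType) (F : fieldType) (n : nat) (G : {group 'S_n}) (Gamma : symmetric_complex R G).
Local Notation N := #|vtx Gamma|.
Local Notation S := {mpoly F[N]}.
Implicit Types (P Q M : S -> Prop) (p q c : S) (d : nat) (s : 'S_n).

Lemma hpoly_inj d : injective (@hpoly F N d).
Proof. exact: can_inj (@hpolyK F N d). Qed.

Lemma hpoly0 d : hpoly (0 : 'rV[F]_(hdim N d)) = 0.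
Proof. by rewrite /hpoly big1 // => j _; rewrite mxE scale0r. Qed.

Lemma hpolyZ d a (u : 'rV[F]_(hdim N d)) : hpoly (a *: u) = a *: hpoly u.
Proof. by rewrite -[a *: u]addr0 hpolyP hpoly0 addr0. Qed.

Lemma hpolyD d (u v : 'rV[F]_(hdim N d)) : hpoly (u + v) = hpoly u + hpoly v.
Proof. by rewrite -[u]scale1r hpolyP !scale1r. Qed.

Lemma hpolyN d (u : 'rV[F]_(hdim N d)) : hpoly (- u) = - hpoly u.
Proof. by rewrite -scaleN1r hpolyZ scaleN1r. Qed.

Lemma hpoly_sum d (I : finType) (f : I -> 'rV[F]_(hdim N d)) :
  hpoly (\sum_i f i) = \sum_i hpoly (f i).
Proof. exact: (big_morph (@hpoly F N d) (@hpolyD d) (@hpoly0 d)). Qed.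

Lemma ideal_scale P a p : is_ideal P -> P p -> P (a *: p).
Proof. by move=> IP Pp; rewrite -mul_mpolyC; apply: idealM. Qed.

(* The homogeneous component of degree [d] of an ideal. *)
Lemma ex_hmx d P : exists U : 'M[F]_(hdim N d),
  is_ideal P -> forall u, (u <= U)%MS <-> P (hpoly u).
Proof.
have [IP|nIP] := pselect (is_ideal P); last by exists 0.
have [|a u v Pu Pv|U UP] := @ex_rowspace F (hdim N d) (fun u => P (hpoly u)).
- by rewrite hpoly0; apply: ideal0.
- by rewrite hpolyP; apply: idealD => //; apply: ideal_scale.
by exists U => _ u; split=> /UP.
Qed.

Definition hmx d P : 'M[F]_(hdim N d) := projT1 (cid (ex_hmx d P)).

Lemma hmxP d P u : is_ideal P -> (u <= hmx d P)%MS <-> P (hpoly u).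
Proof. by rewrite /hmx; case: (cid _) => U /= UP IP; apply: UP. Qed.

Lemma hmx_sub m d P (A : 'M[F]_(m, hdim N d)) : is_ideal P ->
  (forall i, P (hpoly (row i A))) -> (A <= hmx d P)%MS.
Proof. by move=> IP AP; apply/row_subP => i; apply/hmxP. Qed.

Lemma hmx_row d P i : is_ideal P -> P (hpoly (row i (hmx d P))).
Proof. by move=> IP; apply/hmxP => //; apply: row_sub. Qed.

Lemma hmx_mono d P Q : is_ideal P -> is_ideal Q -> (forall p, P p -> Q p) ->
  (hmx d P <= hmx d Q)%MS.
Proof. by move=> IP IQ PQ; apply: hmx_sub => // i; apply: PQ; apply: hmx_row. Qed.

Lemma hmx_full d P : is_ideal P -> (forall p, P p) -> (hmx d P :=: 1%:M)%MS.
Proof.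
by move=> IP Pf; apply/eqmxP; rewrite submx1 /=; apply: hmx_sub => // i; apply: Pf.
Qed.

Definition stable s P := forall p, P p -> P (sact s p).
Local Notation A s d := (sact_mx F Gamma d s).

Lemma hmx_stable s d P : is_ideal P -> stable s P -> (hmx d P *m A s d <= hmx d P)%MS.
Proof.
move=> IP sP; apply: hmx_sub => // i; rewrite row_mul sact_mxE; by apply: sP; apply: hmx_row.
Qed.

Definition TR s d P : F := trU (A s d) (hmx d P).

Lemma TR_full s d : TR s d (@ideal_full S) = \tr (A s d).
Proof.
rewrite -trU1; apply: trU_eqmx; last by apply: hmx_stable.
by apply: hmx_full.
Qed.

Definition graded P := forall p d, P p -> P (pihomog mdeg d p).

Lemma mcoeff_pihomog d p m : (pihomog mdeg d p)@_m = if mdeg m == d then p@_m else 0.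
Proof.
rewrite pihomogE raddf_sum /=; have [mp|/memN_msupp_eq0 p0] := boolP (m \in msupp p); last first.
  rewrite p0 if_same big1_seq // => k /andP[_ kp]; rewrite mcoeffZ mcoeffX.
  by case: eqP => [km|]; rewrite ?mulr0 // km p0 mul0r.
rewrite big_mkcond (bigD1_seq m) ?msupp_uniq //= big1 ?addr0 => [|k /negbTE km].
  by case: eqP => // _; rewrite mcoeffZ mcoeffX eqxx mulr1.
by case: eqP => // _; rewrite mcoeffZ mcoeffX km mulr0.
Qed.

Lemma pihomogD_ d p q : pihomog mdeg d (p + q) = pihomog mdeg d p + pihomog mdeg d q.
Proof. exact: pihomogD. Qed.

Lemma pihomog_mul1 e c d : e \is 1.-homog -> pihomog mdeg d.+1 (e * c) = e * pihomog mdeg d c.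
Proof.
move=> he; rewrite {1}(pihomog_partitionE (leqnn (mmeasure mdeg c))) mulr_sumr.
rewrite raddf_sum /=; set k := mmeasure _ _.
have hh j : e * pihomog mdeg j c \is j.+1.-homog by rewrite -add1n dhomogM // pihomogP.
have [dk|kd] := ltnP d k.
  rewrite (bigD1 (Ordinal dk)) //= pihomog_dE // big1 ?addr0 // => j jd.
  by rewrite (pihomog_ne0 _ (hh j)) // eqSS.
rewrite big1 => [|j _]; last by rewrite (pihomog_ne0 _ (hh j)) // eqSS neq_ltn (leq_trans _ kd).
rewrite (_ : pihomog mdeg d c = 0) ?mulr0 //; apply/mpolyP => m; rewrite mcoeff_pihomog mcoeff0.
case: eqP => // md; apply: memN_msupp_eq0; apply: contraTN kd => /(mmeasure_mnm_lt mdeg) mk.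
by rewrite -ltnNge -md.
Qed.

Lemma pihomog_mul0 e c : e \is 1.-homog -> pihomog mdeg 0 (e * c) = 0.
Proof.
move=> he; rewrite (pihomog_partitionE (leqnn (mmeasure mdeg c))) mulr_sumr raddf_sum big1 // => j _.
by apply: (@pihomog_ne0 _ _ _ j.+1) => //; rewrite -add1n dhomogM // pihomogP.
Qed.

Lemma mspan_graded X : graded (fun p : S => mspan X p).
Proof.
move=> p d /mspanP pX; apply/mspanP => m; rewrite mcoeff_pihomog.
by case: ifP => [_ /pX //|]; rewrite eqxx.
Qed.

Lemma gsum_graded (I : Type) P (e : I -> S) (M : I -> S -> Prop) (r : seq I) :
    is_ideal P -> (forall i, is_ideal (M i)) ->
    graded P -> (forall i, e i \is 1.-homog) -> (forall i, graded (M i)) ->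
  graded (gsum P e M r).
Proof.
move=> IP IM gP he gM; elim: r => //= i r IHr p d [c Mc /IHr pc].
case: d => [|d].
  exists 0; first exact: ideal0; rewrite mulr0 subr0.
  by have := pc 0%N; rewrite pihomogB pihomog_mul0 ?subr0.
exists (pihomog mdeg d c); first exact: gM.
by rewrite -pihomog_mul1 // -pihomogB.
Qed.

Definition mul_mx d e : 'M[F]_(hdim N d, hdim N d.+1) :=
  \matrix_i hcoord d.+1 (e * 'X_[hmnm i]).

Lemma mul_mxE d e u : e \is 1.-homog -> hpoly (u *m mul_mx d e) = e * hpoly u.
Proof.
move=> he; rewrite {2}/hpoly mulr_sumr mulmx_sum_row hpoly_sum.
apply: eq_bigr => i _; rewrite rowK hpolyZ hcoordK ?scalerAr //.
by rewrite -add1n dhomogM // dhomogX; apply/eqP/mdeg_hmnm.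
Qed.

(** By regularity, multiplication by the linear form is an isomorphism from [S / P] onto [Q / P] of
    degree one, and it commutes with [s] up to [lam]. In degree 0 the ideals [P] and [Q] agree. *)
Lemma TR_mul s P (v : 'rV[F]_N) lam :
    is_ideal P -> graded P -> stable s P ->
    sact s (lform v) = lam *: lform v ->
    (forall c, P (lform v * c) -> P c) ->
  let Q := gsum P (@lform F N) (fun=> @ideal_full S) [:: v] in
  (forall d, TR s d.+1 Q - TR s d.+1 P = lam * (TR s d (@ideal_full S) - TR s d P)) /\
  TR s 0 Q - TR s 0 P = 0.
Proof.
set e := lform v => IP gP sP se reg Q; have he : e \is 1.-homog := lform_homog v.
have IQ : is_ideal Q by apply: gsum_ideal.
have PQ p : P p -> Q p by move=> Pp; exists 0 => //=; rewrite mulr0 subr0.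
have sm (p q : S) : sact (Gamma := Gamma) s (p * q) = sact s p * sact s q.
  by rewrite /sact rmorphM.
have sB (p q : S) : sact (Gamma := Gamma) s (p - q) = sact s p - sact s q.
  by rewrite /sact raddfB.
have sQ : stable s Q.
  move=> p [c _ /= pc]; exists (lam *: sact s c) => //=.
  have := sP _ pc; rewrite sB sm se.
  by rewrite -scalerAl -scalerAr.
split=> [d|]; last first.
  apply: trU_eq0; last exact: hmx_stable.
  apply/andP; split; last exact: hmx_mono.
  apply: hmx_sub => // i; have := hmx_row i IQ; set p := hpoly _ => -[c _ /= pc].
  have := gP _ 0%N pc; rewrite pihomogB pihomog_mul0 // subr0 pihomog_dE //.
  exact: hpoly_homog.
apply: (@trU_iso _ _ _ _ _ _ _ _ _ _ _ _ _ (mul_mx d e)).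
- exact: hmx_mono.
- exact: hmx_stable.
- exact: hmx_stable.
- exact: hmx_mono.
- exact: hmx_stable.
- apply: hmx_sub => // i; rewrite row_mul mul_mxE //; set u := hpoly _.
  by exists u => //=; rewrite subrr; apply: ideal0.
- by apply: hmx_sub => // i; rewrite row_mul mul_mxE //; apply: idealM => //; apply: hmx_row.
- apply/row_subP => i; set u := row i _.
  have [c _ /= pc] : Q (hpoly u) by apply: hmx_row.
  have hu : hpoly u \is d.+1.-homog by apply: hpoly_homog.
  have := gP _ d.+1 pc; rewrite pihomogB pihomog_mul1 // pihomog_dE // => Puc.
  set w := hcoord d (pihomog mdeg d c).
  have hw : hpoly w = pihomog mdeg d c by rewrite hcoordK // pihomogP.
  have -> : u = (u - w *m mul_mx d e) + w *m mul_mx d e by rewrite subrK.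
  apply: addmx_sub_adds; last by apply: submxMr; apply/hmxP.
  by apply/hmxP => //; rewrite hpolyD hpolyN mul_mxE // hw.
- by move=> u _ /hmxP => /(_ IP); rewrite mul_mxE // => /reg Pu; apply/hmxP.
apply: hmx_sub => // i; rewrite row_mul mulmxBr -scalemxAr !mulmxA hpolyD hpolyN hpolyZ.
rewrite sact_mxE mul_mxE // sm se mul_mxE // sact_mxE -scalerAl subrr; exact: ideal0.
Qed.

(* The family [b] of polynomials of degree [d] is a basis modulo [P], permuted
   by [s]. *)
Lemma TR_subquotient s d P P' Q Q' :
    is_ideal P -> is_ideal P' -> is_ideal Q -> is_ideal Q' ->
    stable s P -> stable s P' -> stable s Q' ->
    (forall p, P' p -> P p) -> (forall p, Q' p -> Q p) ->
    (forall p, P p -> Q p) -> (forall p, P' p -> Q' p) ->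
    (forall q, q \is d.-homog -> Q q -> exists p, [/\ p \is d.-homog, P p & Q' (q - p)]) ->
    (forall p, P p -> Q' p -> P' p) ->
  TR s d Q - TR s d Q' = TR s d P - TR s d P'.
Proof.
move=> IP IP' IQ IQ' sP sP' sQ' P'P Q'Q PQ P'Q' surj inj.
rewrite -[RHS]mul1r.
apply: (@trU_iso _ _ _ _ _ _ _ _ _ _ _ _ _ 1%:M); rewrite ?mulmx1.
- exact: hmx_mono.
- exact: hmx_stable.
- exact: hmx_stable.
- exact: hmx_mono.
- exact: hmx_stable.
- exact: hmx_mono.
- exact: hmx_mono.
- apply/row_subP => i; set u := row i _.
  have [|p [hp Pp Q'p]] := surj (hpoly u) (hpoly_homog u); first by apply: hmx_row.
  have -> : u = (u - hcoord d p) + hcoord d p by rewrite subrK.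
  apply: addmx_sub_adds; apply/hmxP; rewrite ?hcoordK //.
  by rewrite hpolyD hpolyN hcoordK.
- by move=> u; rewrite mulmx1 => /(hmxP _ IP) Pu /(hmxP _ IQ') Q'u; apply/(hmxP _ IP')/inj.
by rewrite scale1r mul1mx subrr mulmx0 sub0mx.
Qed.

Lemma TR_permuted (I : finType) (tau : I -> I) s d P Q (X : I -> S -> Prop) :
    is_ideal P -> is_ideal Q -> (forall i, is_ideal (X i)) ->
    stable s P -> (forall p, P p -> Q p) ->
    (forall i p, P p -> X i p) -> (forall i p, X i p -> Q p) ->
    (forall q, q \is d.-homog -> Q q ->
       exists2 x : I -> S, forall i, X i (x i) /\ x i \is d.-homog & P (q - \sum_i x i)) ->
    (forall i p, X i p -> X (tau i) (sact s p)) ->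
    (forall x : I -> S, (forall i, X i (x i)) -> P (\sum_i x i) -> forall i, P (x i)) ->
  TR s d Q - TR s d P = \sum_(i | tau i == i) (TR s d (X i) - TR s d P).
Proof.
move=> IP IQ IX sP PQ PX XQ gen XA dir.
apply: (trU_permuted (tau := tau)).
- exact: hmx_stable.
- exact: hmx_mono.
- by move=> i; apply: hmx_mono => //; apply: PX.
- by move=> i; apply: hmx_mono => //; apply: XQ.
- apply/row_subP => i; set u := row i _.
  have [|x xX Px] := gen (hpoly u) (hpoly_homog u); first by apply: hmx_row.
  have -> : u = (u - \sum_i hcoord d (x i)) + \sum_i hcoord d (x i) by rewrite subrK.
  apply: addmx_sub_adds.
    apply/hmxP => //; rewrite hpolyD hpolyN hpoly_sum.
    by rewrite (eq_bigr x) // => j _; rewrite hcoordK //; have [] := xX j.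
  apply: summx_sub => j _; apply: submx_trans (sumsmx_sup j _ (submx_refl _)) => //.
  by have [Xj hj] := xX j; apply/hmxP; rewrite ?hcoordK.
- by move=> i; apply: hmx_sub => // j; rewrite row_mul sact_mxE; apply: XA; apply: hmx_row.
move=> x xX xP i; apply/(hmxP _ IP); apply: (dir (fun i => hpoly (x i))).
  by move=> j; apply/hmxP.
by rewrite -hpoly_sum; apply/hmxP.
Qed.

End GradedTraces.

(** * Polynomials as power series *)

Section FpsPoly.
Variable A : comNzRingType.

Definition pser (p : {poly A}) : fps A := Fps (fun i => p`_i).

Lemma pser_is_zmod : zmod_morphism pser.
Proof. by move=> p q; apply: fpsP => i /=; rewrite coefB. Qed.
Lemma pser_is_monoid : monoid_morphism pser.
Proof.
split; first by apply: fpsP => -[|i] /=; rewrite coef1.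
by move=> p q; apply: fpsP => i /=; rewrite coefM.
Qed.
HB.instance Definition _ := GRing.isZmodMorphism.Build {poly A} (fps A) pser pser_is_zmod.
HB.instance Definition _ := GRing.isMonoidMorphism.Build {poly A} (fps A) pser pser_is_monoid.

Lemma pser_inj : injective pser.
Proof. by move=> p q pq; apply/polyP => i; have := congr1 (fun f => fps_coef f i) pq. Qed.

Lemma fps_coefD (f g : fps A) i : fps_coef (f + g) i = fps_coef f i + fps_coef g i.
Proof. by []. Qed.
Lemma fps_coefN (f : fps A) i : fps_coef (- f) i = - fps_coef f i.
Proof. by []. Qed.
Lemma fps_coefB (f g : fps A) i : fps_coef (f - g) i = fps_coef f i - fps_coef g i.
Proof. by []. Qed.
Lemma fps_coef0 i : fps_coef (0 : fps A) i = 0.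
Proof. by case: i. Qed.
Lemma fps_coef1 i : fps_coef (1 : fps A) i = (i == 0%N)%:R.
Proof. by case: i. Qed.
Lemma fps_coefM (f g : fps A) i :
  fps_coef (f * g) i = \sum_(j < i.+1) fps_coef f j * fps_coef g (i - j)%N.
Proof. by []. Qed.

Lemma fps_coef_sum (I : Type) (r : seq I) (P : pred I) (f : I -> fps A) i :
  fps_coef (\sum_(j <- r | P j) f j) i = \sum_(j <- r | P j) fps_coef (f j) i.
Proof.
exact: (big_morph (fun f => fps_coef f i) (fun f g => fps_coefD f g i) (fps_coef0 i)).
Qed.

Lemma fps_coefXM (f : fps A) i :
  fps_coef (pser 'X * f) i = if i is j.+1 then fps_coef f j else 0.
Proof.
rewrite fps_coefM; case: i => [|i]; first by rewrite big_ord_recl big_ord0 /= coefX mul0r addr0.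
rewrite !big_ord_recl big1 ?addr0 => [|j _]; last by rewrite /= coefX mul0r.
by rewrite /= !coefX mul0r add0r mul1r subSS subn0.
Qed.

Lemma fps_coefCM a (f : fps A) i : fps_coef (pser a%:P * f) i = a * fps_coef f i.
Proof.
rewrite fps_coefM big_ord_recl /= coefC subn0 big1 ?addr0 // => j _.
by rewrite /= coefC mul0r.
Qed.

Lemma fps_coefXnM k (f : fps A) i :
  fps_coef (pser 'X ^+ k * f) i = if (k <= i)%N then fps_coef f (i - k)%N else 0.
Proof.
elim: k i => [|k IHk] i; first by rewrite expr0 mul1r subn0.
by rewrite exprS -mulrA fps_coefXM; case: i => // i; rewrite IHk subSS.
Qed.

End FpsPoly.

(** * The action on the face ring, and trace series of quotients *)

Section KnActions.
Variables (R : realType) (n : nat) (F : fieldType) (iota : {rmorphism R -> F}).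
Local Notation T := (vtx (Kn n R)).
Local Notation S := {mpoly F[#|T|]}.
Implicit Types (W U V : {set 'I_n}) (G H : {set T}) (i j k : 'I_n) (p q c x : S) (s : 'S_n) (m : 'X_{1..#|T|}).
Local Notation act s v := (vact (Kn n R) v s).
Local Notation th := (theta iota (Kn n R)).
Local Notation sa := (sact (Gamma := Kn n R)).

Definition smnm s m : 'X_{1..#|T|} := [multinom m (enum_rank (act s^-1%g (enum_val a))) | a < #|T|].

Lemma act_inK s (v : T) : act s (act s^-1%g v) = v.
Proof. exact: actKV. Qed.

Lemma act_inVK s (v : T) : act s^-1%g (act s v) = v.
Proof. exact: actK. Qed.

Lemma sact_mpolyX s m : sa s ('X_[m] : S) = 'X_[smnm s m].
Proof.
rewrite /sact comp_mpolyX [RHS]mpolyXE_id.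
rewrite [RHS](reindex (fun a : 'I_#|T| => enum_rank (act s (enum_val a : T)))); last first.
  exists (fun a : 'I_#|T| => enum_rank (act s^-1%g (enum_val a : T))) => a _; rewrite enum_rankK.
    by rewrite act_inVK enum_valK.
  by rewrite act_inK enum_valK.
by apply: eq_bigr => i _; rewrite tnth_mktuple mnmE enum_rankK act_inVK enum_valK.
Qed.

Lemma supp_smnm s m : supp (smnm s m) = [set act s v | v in supp m].
Proof.
apply/setP => v; rewrite inE mnmE enum_rankK; apply/idP/imsetP => [mv|[u um ->]].
  by exists (act s^-1%g v); rewrite ?inE ?act_inK.
by rewrite act_inVK; rewrite inE in um.
Qed.

Lemma sactD s p q : sa s (p + q) = sa s p + sa s q.
Proof. by rewrite /sact raddfD. Qed.
Lemma sactB s p q : sa s (p - q) = sa s p - sa s q.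
Proof. by rewrite /sact raddfB. Qed.
Lemma sactMr s p q : sa s (p * q) = sa s p * sa s q.
Proof. by rewrite /sact rmorphM. Qed.

Lemma mspan_sact s (X Y : pred {set T}) p :
  (forall G, X G -> Y [set act s v | v in G]) -> mspan X p -> mspan Y (sa s p).
Proof.
move=> XY /allP pX; rewrite [p]mpolyE sact_sum big_seq; apply: mspan_sum => m mp.
by rewrite sactZ mspanZ // sact_mpolyX mspanX supp_smnm XY // pX.
Qed.

Lemma carr_act s G : carr [set act s v | v in G] = s @: carr G.
Proof.
apply/setP => i; apply/bigcupP/imsetP => [[_ /imsetP[I IG ->]]|[j /bigcupP[I IG jI] ->]].
  by move=> /imsetP[j jI ->]; exists j => //; apply/bigcupP; exists I.
by exists (act s I); [apply: imset_f | apply: imset_f].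
Qed.

Lemma faceW_act s W G : faceW W G -> faceW (s @: W) [set act s v | v in G].
Proof.
rewrite !faceW_carr => /andP[cG GW]; apply/andP; split.
  by rewrite -(@interval_chain_act n s) ?inE in cG.
by rewrite carr_act imsetS.
Qed.

Lemma imset_permV s W : s^-1%g @: (s @: W) = W.
Proof. by rewrite -perm_imsetM mulgV perm_imset1. Qed.

Lemma imset_permVK s W : s @: (s^-1%g @: W) = W.
Proof. by rewrite -perm_imsetM mulVg perm_imset1. Qed.

Lemma faceW_actE s W G : faceW (s @: W) [set act s v | v in G] = faceW W G.
Proof.
apply/idP/idP; last exact: faceW_act.
move/(faceW_act s^-1%g); rewrite imset_permV -imset_comp.
suff -> : [set ((fun v : T => act s^-1%g v) \o (fun v : T => act s v)) x | x in G] = G by [].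
by rewrite -[RHS]imset_id; apply: eq_imset => v; exact: act_inVK.
Qed.

Lemma nf_act s W p : mspan (nf W) p -> mspan (nf (s @: W)) (sa s p).
Proof. by apply: mspan_sact => G; rewrite /nf faceW_actE. Qed.

Lemma jp_act s U W p : mspan (jp U W) p -> mspan (jp (s @: U) (s @: W)) (sa s p).
Proof.
apply: mspan_sact => G; rewrite /jp /nf faceW_actE carr_act => /orP[-> //|/(imsetS s) ->].
by rewrite orbT.
Qed.

Lemma sact_th s i : sa s (th i) = th (s i).
Proof. by apply: sact_theta; rewrite inE. Qed.

(* The vector [y] of coefficients of an eigenvector of [s] in the span of the
   [th i]. *)
Definition eigencomb s (y : 'rV[F]_n) lam :=
  sa s (lform (theta_comb iota y)) = lam *: lform (theta_comb iota y).

Lemma theta_combE y : lform (theta_comb iota y) = \sum_i y 0 i *: th i.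
Proof.
by rewrite /theta_comb lform_sum; apply: eq_bigr => i _; rewrite lformZ thetaE.
Qed.

Local Notation TRs s d P := (TR (Gamma := Kn n R) s d P).
Definition qser s (P : S -> Prop) : fps F := Fps (fun d => TRs s d (@ideal_full S) - TRs s d P).

(** By [TR_mul], dividing out a regular eigenvector of eigenvalue $\lambda$ multiplies the trace
    series by $1-\lambda t$. *)
Lemma qser_eigen s W (yl : seq ('rV[F]_n * F)) :
    s @: W = W -> free (map fst yl) ->
    (forall y, y \in map fst yl -> forall i, i \notin W -> y 0 i = 0) ->
    (forall y, y \in yl -> eigencomb s y.1 y.2) ->
  qser s (gsum (fun p => mspan (nf W) p) (@lform F _) (fun=> @ideal_full S)
      (map (theta_comb iota) (map fst yl))) =
  pser (\prod_(y <- yl) (1 - y.2 *: 'X)) * qser s (fun p => mspan (nf W) p).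
Proof.
move=> sW fyl ylW eig; have := mspan_full_regular iota ylW fyl.
have sI : stable s (fun p : S => mspan (nf W) p).
  by move=> p /(nf_act s); rewrite sW.
set P0 := fun p => _ in sI *.
have IP0 : is_ideal P0 by apply: iw_ideal.
have gP0 : graded P0 by apply: mspan_graded.
elim: yl eig {fyl ylW} => [|[y lam] yl IHyl] eig reg.
  by rewrite big_nil rmorph1 mul1r.
have [reg' ryl] := reg; have eig' y' : y' \in yl -> eigencomb s y'.1 y'.2.
  by move=> y'l; apply: eig; rewrite inE y'l orbT.
have {}IHyl := IHyl eig' reg'; set P := gsum _ _ _ _ in IHyl.
have IP : is_ideal P by apply: gsum_ideal.
have gP : graded P by apply: gsum_graded => // v; apply: lform_homog.
have sP : stable s P.
  rewrite /P; elim: (yl) eig' => [|[z mu] l IHl] eigl //= p [c _ pc].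
  exists (mu *: sa s c) => //.
  have := IHl _ _ pc; rewrite sactB sactMr (eigl (z, mu) (mem_head _ _)) /= -scalerAl -scalerAr.
  by apply=> y' y'l; apply: eigl; rewrite inE y'l orbT.
have [hS h0] := TR_mul IP gP sP (eig (y, lam) (mem_head _ _)) (fun c => ryl c I).
rewrite big_cons rmorphM /= -mulrA -IHyl.
apply: fpsP => d; rewrite -mul_polyC rmorphB rmorph1 rmorphM mulrBl mul1r -mulrA fps_coefB fps_coefCM fps_coefXM.
case: d => [|d] /=; rewrite ?mulr0 ?subr0.
  by move/eqP: h0; rewrite subr_eq0 => /eqP ->.
rewrite -hS; ring.
Qed.

End KnActions.

(** * Stable subsets are unions of cycles *)

Section StableSets.
Variables (n : nat) (s : 'S_n).
Implicit Types (V W : {set 'I_n}) (i : 'I_n).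

Definition cyclesin W : {set {set 'I_n}} := [set c in porbits s | c \subset W].

Lemma stable_iter W i k : s @: W = W -> i \in W -> iter k s i \in W.
Proof. by move=> sW iW; elim: k => //= k IHk; rewrite -sW imset_f. Qed.

Lemma stable_porbit W i : s @: W = W -> i \in W -> porbit s i \subset W.
Proof.
by move=> sW iW; apply/subsetP => j; rewrite porbit_traject => /trajectP[k _ ->]; apply: stable_iter.
Qed.

Lemma cover_cyclesin W : s @: W = W -> cover (cyclesin W) = W.
Proof.
move=> sW; apply/setP => i; apply/bigcupP/idP => [[c /setIdP[_ /subsetP cW] /cW //]|iW].
by exists (porbit s i); rewrite ?porbit_id // inE imset_f //= stable_porbit.
Qed.

Lemma trivIset_porbits : trivIset (porbits s).
Proof.
apply/trivIsetP => _ _ /imsetP[x _ ->] /imsetP[y _ ->]; apply: contraR => /pred0Pn[z /andP[zx zy]].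
have /eqP <- : porbit s z == porbit s x by rewrite eq_porbit_mem.
by have /eqP <- : porbit s z == porbit s y by rewrite eq_porbit_mem.
Qed.

Lemma trivIset_cyclesin W : trivIset (cyclesin W).
Proof. by apply: trivIsetS trivIset_porbits; apply/subsetP => c /setIdP[]. Qed.

Lemma card_cyclesin W : s @: W = W -> (\sum_(c in cyclesin W) #|c|)%N = #|W|.
Proof. by move=> sW; have /eqP := trivIset_cyclesin W; rewrite cover_cyclesin. Qed.

End StableSets.

(** * Sums and products over roots of unity *)

Section RootsOfUnity.
Variable F : fieldType.

Lemma sum_prim_root m (z : F) k l : m.-primitive_root z -> (k < m)%N -> (l < m)%N ->
  \sum_(j < m) z ^+ (j * l) / z ^+ (j * k) = if k == l then m%:R else 0.
Proof.
move=> pz km lm; have z0 j : z ^+ j != 0.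
  by rewrite expf_neq0 // (prim_root_eq0 pz) -lt0n (leq_ltn_trans _ km).
pose w := z ^+ l / z ^+ k.
have -> : \sum_(j < m) z ^+ (j * l) / z ^+ (j * k) = \sum_(j < m) w ^+ j.
  by apply: eq_bigr => j _; rewrite expr_div_n -!exprM ![(_ * j)%N]mulnC.
have [kl|kl] := eqVneq k l.
  by rewrite (eq_bigr (fun=> 1)) ?sumr_const ?card_ord // => j _; rewrite /w kl mulfV ?expr1n.
have w1 : w - 1 != 0.
  rewrite subr_eq0; apply: contra kl => /eqP w1; have : z ^+ l == z ^+ k.
    by rewrite -[z ^+ l](divfK (z0 k)) -/w w1 mul1r.
  by rewrite (eq_prim_root_expr pz) !modn_small // eq_sym.
apply/eqP; rewrite -(mulrI_eq0 _ (mulfI w1)) -subrX1 expr_div_n -!exprM ![(_ * m)%N]mulnC.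
by rewrite !exprM (prim_expr_order pz) !expr1n divr1 subrr.
Qed.

Lemma prod_one_subZX m (z : F) : (0 < m)%N -> m.-primitive_root z ->
  \prod_(j < m) (1 - (z ^+ j)^-1 *: 'X) = 1 - 'X^m :> {poly F}.
Proof.
move=> m0 pz; have z0 j : z ^+ j != 0.
  by rewrite expf_neq0 // (prim_root_eq0 pz) -lt0n.
pose a := \prod_(j < m) - (z ^+ j)^-1.
have pE : \prod_(j < m) (1 - (z ^+ j)^-1 *: 'X) = a *: ('X^m - 1) :> {poly F}.
  rewrite -(factor_Xn_sub_1 pz) big_mkord /a -mul_polyC rmorph_prod /= -big_split /=.
  by apply: eq_bigr => j _; rewrite polyCN mulNr mulrBr opprB -polyCM mulVf // mul_polyC.
have : (\prod_(j < m) (1 - (z ^+ j)^-1 *: 'X)).[0] = 1.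
  by rewrite horner_prod big1 // => j _; rewrite !hornerE ?mulr0 ?subr0.
rewrite pE !hornerE expr0n eqn0Ngt m0 /= sub0r mulrN1 => /eqP; rewrite eqr_oppLR => /eqP ->.
by rewrite scaleN1r opprB.
Qed.

End RootsOfUnity.

(** * Eigenvectors in the span of the parameters *)

Section EigenBasis.
Variables (R : realType) (n : nat) (F : fieldType) (iota : {rmorphism R -> F}) (s : 'S_n).
Hypothesis prim : forall m, (0 < m)%N -> exists z : F, m.-primitive_root z.
Local Notation th := (theta iota (Kn n R)).
Implicit Types (V W : {set 'I_n}) (i : 'I_n).

Let e i : 'rV[F]_n := delta_mx 0 i.

(** Discrete Fourier transform along the cycle: [y j] has eigenvalue $z^{-j}$, and the inverse
    transform recovers the coordinate vectors. *)
Lemma cycle_eigen (x : 'I_n) (m := #|porbit s x|) : exists yl : seq ('rV[F]_n * F),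
  [/\ size yl = m, forall y, y \in yl -> eigencomb iota s y.1 y.2,
      \prod_(y <- yl) (1 - y.2 *: 'X) = 1 - 'X^m,
      forall y, y \in map fst yl -> forall i, i \notin porbit s x -> y 0 i = 0
    & forall i, i \in porbit s x -> e i \in <<map fst yl>>%VS].
Proof.
have m0 : (0 < m)%N by rewrite /m (cardD1 x) porbit_id.
have [z pz] := prim m0; have z0 j : z ^+ j != 0.
  by rewrite expf_neq0 // (prim_root_eq0 pz) -lt0n.
pose y j := \sum_(k < m) z ^+ (j * k) *: e (iter k s x).
exists [seq (y j, (z ^+ j)^-1) | j <- seq.iota 0 m].
have mapfst : map fst [seq (y j, (z ^+ j)^-1) | j <- seq.iota 0 m] = [seq y j | j <- seq.iota 0 m].
  by rewrite -map_comp.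
split.
- by rewrite size_map size_iota.
- move=> _ /mapP[j _ ->]; rewrite /eigencomb /=.
  pose g k := z ^+ (j * k) *: th (iter k s x).
  have LE : lform (theta_comb iota (y j)) = \sum_(k < m) g k.
    transitivity (\sum_(k < m) lform (theta_comb iota (z ^+ (j * k) *: e (iter k s x)))).
      rewrite /y; apply: (big_morph (fun v => lform (theta_comb iota v))) => [u v|].
        by rewrite -lformD -[u]scale1r theta_comb_linear !scale1r.
      by rewrite /theta_comb big1 ?lform0 // => i _; rewrite mxE scale0r.
    apply: eq_bigr => k _; rewrite /g -theta_comb_delta -lformZ; congr lform.
    rewrite -[_ *: e _]addr0 theta_comb_linear [X in _ + X]big1 ?addr0 // => i _.
    by rewrite mxE scale0r.
  have gm : g m = g 0%N by rewrite /g /m iter_porbit -/m mulnC exprM (prim_expr_order pz) expr1n muln0 expr0.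
  have gS : \sum_(k < m) g k.+1 = \sum_(k < m) g k.
    have e1 : \sum_(k < m.+1) g k = g 0%N + \sum_(k < m) g k.+1 by rewrite big_ord_recl.
    have e2 : \sum_(k < m.+1) g k = \sum_(k < m) g k + g m by rewrite big_ord_recr.
    by apply: (addrI (g 0%N)); rewrite -e1 e2 gm addrC.
  rewrite LE sact_sum -gS scaler_sumr; apply: eq_bigr => k _.
  rewrite sactZ sact_th /g scalerA; congr (_ *: _).
  by rewrite mulnS exprD mulKf.
- rewrite big_map; have := prod_one_subZX m0 pz => <-.
  by rewrite -[RHS](big_mkord xpredT (fun j => 1 - (z ^+ j)^-1 *: 'X)) /index_iota subn0.
- move=> v; rewrite mapfst => /mapP[j _ ->] i ix; rewrite summxE big1 // => k _.
  rewrite mxE mxE eqxx /=; case: eqP => [ik|]; last by rewrite mulr0.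
  case/negP: ix; rewrite ik porbit_traject; apply/trajectP; exists k => //.
move=> i; rewrite porbit_traject => /trajectP[l lm ->]; rewrite mapfst.
have mF : m%:R != 0 :> F := prim_root_natf_neq0 pz.
have -> : e (iter l s x) = m%:R^-1 *: \sum_(j < m) (z ^+ (j * l))^-1 *: y j.
  rewrite /y; under eq_bigr => j _ do rewrite scaler_sumr.
  rewrite exchange_big /= (bigD1 (Ordinal lm)) //= [X in _ + X]big1 ?addr0 => [|k kl].
    under eq_bigr => j _ do rewrite scalerA mulVf // scale1r.
    by rewrite sumr_const card_ord -[e _ *+ m]scaler_nat scalerA mulVf ?scale1r.
  under eq_bigr => j _ do rewrite scalerA mulrC.
  rewrite -scaler_suml (sum_prim_root pz lm (ltn_ord k)).
  by rewrite eq_sym -[_ == _]/(k == Ordinal lm) (negbTE kl) scale0r.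
apply: memvZ; apply: memv_suml => j _; apply: memvZ; apply: memv_span.
by apply: map_f; rewrite mem_iota /=.
Qed.

Lemma stable_eigen W : s @: W = W -> exists yl : seq ('rV[F]_n * F),
  [/\ size yl = #|W|, forall y, y \in yl -> eigencomb iota s y.1 y.2,
      \prod_(y <- yl) (1 - y.2 *: 'X) = \prod_(c in cyclesin s W) (1 - 'X^#|c|),
      forall y, y \in map fst yl -> forall i, i \notin W -> y 0 i = 0
    & forall i, i \in W -> e i \in <<map fst yl>>%VS].
Proof.
move=> sW.
have cov i : i \in W -> exists2 c, c \in enum (cyclesin s W) & i \in c.
  by rewrite -{1}(cover_cyclesin sW) => /bigcupP[c cW ic]; exists c; rewrite ?mem_enum.
have cyc c : c \in enum (cyclesin s W) -> c \subset W /\ exists x, c = porbit s x.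
  by rewrite mem_enum => /setIdP[/imsetP[x _ ->] cW]; split=> //; exists x.
suff [yl [h1 h2 h3 h4 h5]] : exists yl : seq ('rV[F]_n * F),
    [/\ size yl = (\sum_(c <- enum (cyclesin s W)) #|c|)%N, forall y, y \in yl -> eigencomb iota s y.1 y.2,
      \prod_(y <- yl) (1 - y.2 *: 'X) = \prod_(c <- enum (cyclesin s W)) (1 - 'X^#|c|),
      forall y, y \in map fst yl -> forall i, i \notin W -> y 0 i = 0
    & forall c i, c \in enum (cyclesin s W) -> i \in c -> e i \in <<map fst yl>>%VS].
  exists yl; split=> //; first by rewrite h1 big_enum card_cyclesin.
    by rewrite h3 big_enum.
  by move=> i /cov[c cW]; apply: h5.
elim: (enum _) cyc => [|c r IHr] cyc; first by exists [::]; rewrite !big_nil.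
have [|yl [h1 h2 h3 h4 h5]] := IHr; first by move=> d dr; apply: cyc; rewrite inE dr orbT.
have [cW [x cx]] := cyc c (mem_head _ _).
have [yl' [h1' h2' h3' h4' h5']] := cycle_eigen x; rewrite -cx in h1' h3' h4' h5'.
exists (yl' ++ yl); rewrite !big_cons size_cat h1 h1' big_cat h3 h3' map_cat span_cat; split=> //.
- by move=> y; rewrite mem_cat => /orP[/h2'|/h2].
- move=> y; rewrite mem_cat => /orP[/h4' h|/h4 h] i iW; last exact: h.
  by apply: h; apply: contra iW; apply: (subsetP cW).
move=> d i; rewrite inE => /predU1P[->|dr] id.
  by apply: (subvP (addvSl _ _)); apply: h5'.
by apply: (subvP (addvSr _ _)); apply: h5 dr id.
Qed.

Local Notation T := (vtx (Kn n R)).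
Local Notation S := {mpoly F[#|T|]}.

(* The ideal [Theta] over [W]. *)
Definition tw W : S -> Prop :=
  gsum (fun p : S => mspan (nf W) p) th (fun=> @ideal_full S) (enum W).

Lemma tw_ideal W : is_ideal (tw W).
Proof. by apply: gsum_ideal => *; [apply: iw_ideal | apply: is_ideal_full]. Qed.

Lemma tw_nf W p : mspan (nf W) p -> tw W p.
Proof. by move=> pW; apply: gsum_base. Qed.

Lemma tw_th W i c : tw W (th i * c).
Proof.
have [iW|iW] := boolP (i \in W); last by apply/tw_nf/theta_iw.
by apply: gsum_mem => //; [apply: mspan0 | rewrite mem_enum].
Qed.

Lemma tw_sub W (Q : S -> Prop) : is_ideal Q -> (forall p, mspan (nf W) p -> Q p) ->
  (forall i c, i \in W -> Q (th i * c)) -> forall p, tw W p -> Q p.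
Proof.
move=> IQ h1 h2; apply: gsum_sub_in => // i c; rewrite mem_enum => iW _; exact: h2.
Qed.

Lemma tw_mono V W p : V \subset W -> tw W p -> tw V p.
Proof.
move=> VW; apply: tw_sub (tw_ideal V) _ _ p => [p pW|i c _]; last exact: tw_th.
by apply: tw_nf; apply: mspan_sub pW => G; apply: nf_mono.
Qed.

Lemma tw_graded W : graded (tw W).
Proof.
apply: gsum_graded => //; [exact: iw_ideal | exact: mspan_graded |].
by move=> i; rewrite thetaE; apply: lform_homog.
Qed.

Lemma tw_stable W : s @: W = W -> stable s (tw W).
Proof.
move=> sW; apply: tw_sub => [|p pW|i c _].
- have [I0 ID IM] := tw_ideal W; split=> [|p q|a p].
  + by rewrite (_ : sact s 0 = 0) // /sact raddf0.
  + by rewrite sactD; apply: ID.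
  + by rewrite sactMr; apply: IM.
- by apply: tw_nf; rewrite -sW; apply: nf_act.
by rewrite sactMr sact_th; apply: tw_th.
Qed.

(** The eigenvectors span the same space as the parameters of [W], so they generate the same ideal;
    unlike single parameters, they can be divided out one at a time compatibly with [s]. *)
Lemma qser_tw W : s @: W = W ->
  qser s (tw W) = pser (\prod_(c in cyclesin s W) (1 - 'X^#|c|)) * qser s (fun p : S => mspan (nf W) p).
Proof.
move=> sW; have [yl [szl eig <- ylW ylspan]] := stable_eigen sW.
have fr : free (map fst yl).
  rewrite /free eqn_leq dim_span size_map szl /=.
  have := free_delta F (enum_uniq (mem W)); rewrite /free => /eqP fe.
  rewrite cardE -(size_map e) -fe; apply/dimvS/span_subvP => v /mapP[i iW ->].
  by apply: ylspan; rewrite -mem_enum.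
rewrite -(qser_eigen sW fr ylW eig); congr qser; apply: funext => p; apply: propext.
set Q := gsum _ _ _ _; have IQ : is_ideal Q by apply: gsum_ideal => *; [apply: iw_ideal | apply: is_ideal_full].
split.
  apply: tw_sub => // [q qW|i c iW]; first exact: gsum_base.
  rewrite -theta_comb_delta -/(e i) (@coord_span _ _ _ (in_tuple (map fst yl)) _ (ylspan i iW)).
  set f := coord _; have -> : lform (theta_comb iota (\sum_(a < size (map fst yl)) f a (e i) *: (in_tuple (map fst yl))`_a)) =
      \sum_(a < size (map fst yl)) f a (e i) *: lform (theta_comb iota (map fst yl)`_a).
    rewrite (big_morph (theta_comb iota) (id1 := 0) (op1 := +%R)) => [|u v|].
    - rewrite lform_sum; apply: eq_bigr => a _; rewrite -lformZ; congr lform.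
      rewrite -[_ *: _`_a]addr0 theta_comb_linear [X in _ + X]big1 ?addr0 // => j _.
      by rewrite mxE scale0r.
    - by rewrite -[u]scale1r theta_comb_linear !scale1r.
    by rewrite /theta_comb big1 // => j _; rewrite mxE scale0r.
  rewrite mulr_suml; apply: (big_ind Q) => [||a _]; [exact: ideal0 | exact: idealD |].
  rewrite -scalerAl scalerAr; apply: gsum_mem => [|_|//|//]; first exact: mspan0.
    exact: is_ideal_full.
  exact/map_f/mem_nth.
apply: gsum_sub_in => [|q|u c /mapP[y _ ->] _]; [exact: tw_ideal | exact: tw_nf |].
rewrite theta_combE mulr_suml; have [I0 ID _] := tw_ideal W.
apply: (big_ind (tw W)) => // i _; rewrite -scalerAl scalerAr; exact: tw_th.
Qed.

End EigenBasis.

(** * Distributing products over subsets, and sums over stable subsets *)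

Section SubsetProducts.
Variables (A : comPzSemiRingType) (K : finType).
Implicit Types (X Y : {set K}) (x y : K -> A).

Lemma prodD_subsets X x y :
  \prod_(c in X) (x c + y c) = \sum_(Y : {set K} | Y \subset X) (\prod_(c in Y) x c) * \prod_(c in X :\: Y) y c.
Proof.
pose f c := if c \in X then x c else 0; pose g c := if c \in X then y c else 1.
have -> : \prod_(c in X) (x c + y c) = \prod_c (f c + g c).
  rewrite big_mkcond; apply: eq_bigr => c _; rewrite /f /g; case: (c \in X) => //.
  by rewrite add0r.
rewrite bigA_distr [LHS](bigID (fun Y : {set K} => Y \subset X)) /= [X in _ + X]big1 ?addr0.
  apply: eq_bigr => Y YX; rewrite [X in _ = X * _]big_mkcond [X in _ = _ * X]big_mkcond -big_split /=.
  apply: eq_bigr => c _; rewrite !inE /f /g; case: (boolP (c \in Y)) => cY /=.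
    by rewrite (subsetP YX) // mulr1.
  by rewrite mul1r.
move=> Y /subsetPn[c cY cX]; rewrite (bigD1 c) //= cY /f (negbTE cX) mul0r //.
Qed.

Lemma sum_subsets_exp X (a : A) : \sum_(Y : {set K} | Y \subset X) a ^+ #|Y| = (a + 1) ^+ #|X|.
Proof.
rewrite -prodr_const prodD_subsets; apply: eq_bigr => Y _.
by rewrite prodr_const big1 ?mulr1.
Qed.

End SubsetProducts.

Section StableSums.
Variables (n : nat) (s : 'S_n).
Implicit Types (D U W : {set 'I_n}) (X Y : {set {set 'I_n}}).

Lemma coverS X Y : X \subset Y -> cover X \subset cover Y.
Proof. by move=> /subsetP XY; apply/bigcupsP => c /XY cY; apply: bigcup_sup cY. Qed.

Lemma cover_stable X : X \subset porbits s -> s @: cover X = cover X.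
Proof.
move=> /subsetP XP.
suff sub (Z : {set {set 'I_n}}) : Z \subset porbits s -> s @: cover Z \subset cover Z.
  apply/eqP; rewrite eqEcard (card_imset _ (@perm_inj _ s)) leqnn andbT.
  by apply: sub; apply/subsetP.
move=> /subsetP ZP; apply/subsetP => _ /imsetP[i /bigcupP[c cZ ic] ->].
apply/bigcupP; exists c => //; have /imsetP[x _ cx] := ZP c cZ.
have /eqP ix : porbit s i == porbit s x by rewrite eq_porbit_mem -cx.
by rewrite cx -ix; have := mem_porbit s 1 i; rewrite expg1.
Qed.

Lemma cyclesin_cover X : X \subset porbits s -> cyclesin s (cover X) = X.
Proof.
move=> /subsetP XP; apply/setP => c; rewrite inE; apply/andP/idP => [[cP cX]|cX]; last first.
  by split; [exact: XP | exact: bigcup_sup cX].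
have /imsetP[x _ cx] := cP.
have : x \in cover X by apply: (subsetP cX); rewrite cx porbit_id.
case/bigcupP => d dX xd; suff -> : c = d by [].
have /imsetP[y _ dy] := XP d dX; rewrite cx dy; apply/eqP.
by rewrite eq_porbit_mem -dy.
Qed.

Lemma cyclesin_sub W : cyclesin s W \subset porbits s.
Proof. by apply/subsetP => c /setIdP[]. Qed.

Lemma cyclesinS D W : D \subset W -> cyclesin s D \subset cyclesin s W.
Proof. by move=> DW; apply/subsetP => c; rewrite !inE => /andP[-> /subset_trans->]. Qed.

Lemma cyclesinT : cyclesin s setT = porbits s.
Proof. by apply/setP => c; rewrite inE subsetT andbT. Qed.

Lemma cyclesin0 : cyclesin s set0 = set0.
Proof.
apply/setP => c; rewrite !inE; apply/negP => /andP[/imsetP[x _ ->] /subsetP/(_ x (porbit_id _ _))].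
by rewrite inE.
Qed.

Lemma cyclesinD D W : s @: D = D -> s @: W = W -> cyclesin s (W :\: D) = cyclesin s W :\: cyclesin s D.
Proof.
move=> sD sW; apply/setP => c; rewrite !inE; apply/andP/andP => [[cP cWD]|[nD /andP[cP cW]]].
  rewrite cP (subset_trans cWD (subsetDl _ _)); split=> //; apply/negP => cD.
  have /imsetP[x _ cx] := cP; have xc : x \in c by rewrite cx porbit_id.
  by have := subsetP cWD x xc; rewrite inE (subsetP cD).
split=> //; apply/subsetP => i ic; rewrite inE (subsetP cW) // andbT; apply: contra nD => iD.
have /imsetP[x _ cx] := cP; have -> : c = porbit s i.
  by rewrite cx; apply/eqP; rewrite eq_sym eq_porbit_mem -cx.
by rewrite imset_f //= stable_porbit.
Qed.

Lemma stableD D W : s @: D = D -> s @: W = W -> s @: (W :\: D) = W :\: D.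
Proof.
move=> sD sW; rewrite -{2}sD -{2}sW; apply/setP => i.
have -> : i = s (s^-1%g i) by rewrite permKV.
by rewrite !inE !(mem_imset _ _ (@perm_inj _ s)) !inE.
Qed.

Lemma sum_stable (A : nmodType) W (f : {set 'I_n} -> A) : s @: W = W ->
  \sum_(D : {set 'I_n} | (D \subset W) && (s @: D == D)) f D =
  \sum_(X : {set {set 'I_n}} | X \subset cyclesin s W) f (cover X).
Proof.
move=> sW; rewrite (reindex_onto (@cover 'I_n) (cyclesin s)) /=; last first.
  by move=> D /andP[_ /eqP]; apply: cover_cyclesin.
apply: eq_bigl => X; apply/andP/idP => [[/andP[XW /eqP sX] /eqP <-]|XW].
  exact: cyclesinS.
have XP := subset_trans XW (cyclesin_sub W).
rewrite cyclesin_cover ?eqxx // cover_stable ?eqxx // andbT; split=> //.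
by rewrite -(cover_cyclesin sW); apply: coverS.
Qed.

Local Notation nc D := #|cyclesin s D|.

Lemma sum_stable_exp W (a : nat) : s @: W = W ->
  (\sum_(D : {set 'I_n} | (D \subset W) && (s @: D == D)) a ^ nc D = a.+1 ^ nc W)%N.
Proof.
move=> sW; rewrite (@sum_stable nat W (fun D => a ^ nc D)%N sW).
rewrite (eq_bigr (fun X : {set {set 'I_n}} => (a ^ #|X|)%N)).
  have := @sum_subsets_exp nat _ (cyclesin s W) a; rewrite natrDE addn1 natrXE => <-.
  by apply: eq_bigr => X _; rewrite natrXE.
by move=> X XW; rewrite cyclesin_cover // (subset_trans XW (cyclesin_sub W)).
Qed.

(* Complementation inside [W]. *)
Lemma sum_stable_compl (A : nmodType) U W (f : {set 'I_n} -> A) : U \subset W -> s @: U = U -> s @: W = W ->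
  \sum_(D : {set 'I_n} | [&& U \subset D, D \subset W & s @: D == D]) f D =
  \sum_(D : {set 'I_n} | (D \subset W :\: U) && (s @: D == D)) f (W :\: D).
Proof.
move=> UW sU sW; rewrite (reindex_onto (fun D => W :\: D) (fun D => W :\: D)) /=; last first.
  by move=> D /and3P[_ DW _]; rewrite setDDr setDv set0U (setIidPr DW).
apply: eq_bigl => D; apply/andP/andP => [[/and3P[UD _ /eqP sD] /eqP DE]|[DWU /eqP sD]].
  have DW : D \subset W by rewrite -DE subsetDl.
  split; last by rewrite -{1}DE stableD // DE.
  apply/subsetP => i iD; rewrite inE (subsetP DW) // andbT; apply/negP => /(subsetP UD).
  by rewrite inE iD.
have DW : D \subset W := subset_trans DWU (subsetDl _ _).
rewrite setDDr setDv set0U (setIidPr DW) eqxx subsetDl stableD // eqxx !andbT; split=> //.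
apply/subsetP => i iU; rewrite inE (subsetP UW) // andbT; apply/negP => /(subsetP DWU).
by rewrite inE iU.
Qed.

End StableSums.

(** * Traces on face rings as counts of fixed monomials *)

Section FixedMonomials.
Variables (R : realType) (n : nat) (F : fieldType) (s : 'S_n).
Local Notation T := (vtx (Kn n R)).
Local Notation N := #|T|.
Local Notation S := {mpoly F[N]}.
Local Notation act I := (vact (Kn n R) I s).
Implicit Types (W D : {set 'I_n}) (I J : T) (Q : pred T) (m : 'X_{1..N}) (d : nat).

Local Notation nc D := #|cyclesin s D|.

(** The monomials whose support is outside [X] form a basis of the quotient that [s] permutes. *)
Lemma mxtrace_fixed d (X : pred {set T}) : upclosed X ->
  (forall G : {set T}, X [set act v | v in G] = X G) ->
  TR (Gamma := Kn n R) s d (@ideal_full S) - TR (Gamma := Kn n R) s d (fun p : S => mspan X p) =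
  #|[set j : 'I_(hdim N d) | ~~ X (supp (hmnm j)) && (smnm s (hmnm j) == hmnm j)]|%:R.
Proof.
move=> uX sX; pose K := [set j : 'I_(hdim N d) | ~~ X (supp (hmnm j))].
have IX : is_ideal (fun p : S => mspan X p) by apply: mspan_ideal.
have stX : stable s (fun p : S => mspan X p) by move=> p; apply: mspan_sact => G; rewrite sX.
pose B : 'M[F]_(#|K|, hdim N d) := \matrix_(a < #|K|) delta_mx 0 (enum_val a).
pose Y : 'M[F]_#|K| := \matrix_(a, b) (smnm s (hmnm (enum_val a)) == hmnm (enum_val b))%:R.
have hdelta (j : 'I_(hdim N d)) : hpoly (delta_mx 0 j : 'rV[F]_(hdim N d)) = 'X_[hmnm j].
  rewrite /hpoly (bigD1 j) //= mxE !eqxx scale1r big1 ?addr0 // => k kj.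
  by rewrite mxE (negbTE kj) andbF scale0r.
have uB (u : 'rV[F]_#|K|) : hpoly (u *m B) = \sum_a u 0 a *: 'X_[hmnm (enum_val a)].
  rewrite mulmx_sum_row hpoly_sum; apply: eq_bigr => a _.
  by rewrite hpolyZ rowK hdelta.
have IF : is_ideal (@ideal_full S) by [].
have hK (j : 'I_(hdim N d)) : j \in K -> exists a : 'I_#|K|, enum_val a = j.
  by move=> jK; exists (enum_rank_in jK j); rewrite enum_rankK_in.
have cB (u : 'rV[F]_#|K|) (j : 'I_(hdim N d)) : (u *m B) 0 j =
    \sum_a u 0 a * (enum_val a == j)%:R.
  by rewrite mxE; apply: eq_bigr => a _; rewrite !mxE eqxx eq_sym.
transitivity (\tr Y).
  apply: (@trU_rel _ _ _ _ _ _ _ _ B Y).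
  - exact: hmx_stable.
  - exact: hmx_mono.
  - by apply: hmx_sub.
  - apply/rV_subP => u _.
    pose v : 'rV[F]_(hdim N d) := \row_j (if j \in K then 0 else u 0 j).
    rewrite -[u](subrK v) addrC addmx_sub_adds //.
      apply/hmxP => //; rewrite /hpoly; apply: mspan_sum => j _; rewrite mxE inE.
      case: (boolP (X _)) => /= XX; last by rewrite scale0r mspan0.
      by rewrite mspanZ // mspanX.
    apply/submxP; exists (\row_a u 0 (enum_val a)); apply/rowP => j.
    rewrite cB !mxE; case: (boolP (j \in K)) => jK.
      have [a <-] := hK j jK; rewrite subr0 (bigD1 a) //= mxE eqxx mulr1 big1 ?addr0 //.
      by move=> b ba; rewrite (inj_eq enum_val_inj) (negbTE ba) mulr0.
    rewrite subrr big1 // => a _; case: eqP => [aj|_]; last by rewrite mulr0.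
    by rewrite -aj enum_valP in jK.
  - move=> u /(hmxP _ IX); rewrite uB => /mspanP Xu; apply/rowP => a; rewrite mxE.
    apply/eqP/contraT => ua; have := enum_valP a; rewrite inE => /negP[]; apply: Xu.
    rewrite raddf_sum /= (bigD1 a) //= mcoeffZ mcoeffX eqxx mulr1 big1 ?addr0 //.
    move=> b ba; rewrite mcoeffZ mcoeffX (inj_eq (@hmnm_inj _ _)) (inj_eq enum_val_inj).
    by rewrite (negbTE ba) mulr0.
  suff -> : B *m sact_mx F (Kn n R) d s = Y *m B by rewrite subrr sub0mx.
  apply/row_matrixP => a; rewrite !row_mul; apply: hpoly_inj.
  rewrite sact_mxE uB rowK hdelta sact_mpolyX.
  have mj : mdeg (smnm s (hmnm (enum_val a))) = d.
    apply: etrans (mdeg_hmnm (enum_val a)); rewrite !mdegE.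
    rewrite (reindex (fun b : 'I_N => enum_rank (act (enum_val b : T)))) /=; last first.
      exists (fun b : 'I_N => enum_rank (vact (Kn n R) (enum_val b : T) s^-1%g)) => b _; rewrite enum_rankK.
        by rewrite act_inVK enum_valK.
      exact: (etrans (congr1 enum_rank (act_inK s _)) (enum_valK _)).
    by apply: eq_bigr => b _; rewrite mnmE enum_rankK act_inVK enum_valK.
  have [j hj] := hmnmP mj; have jK : j \in K.
    by rewrite inE hj supp_smnm sX; have := enum_valP a; rewrite inE.
  have [b bj] := hK j jK; rewrite (bigD1 b) //= !mxE -hj bj eqxx scale1r big1 ?addr0 // => c cb.
  rewrite !mxE -hj (inj_eq (@hmnm_inj _ _)) -bj eq_sym (inj_eq enum_val_inj) (negbTE cb).
  by rewrite scale0r.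
rewrite /mxtrace; under eq_bigr => a _ do rewrite mxE.
transitivity (\sum_(j in K) (smnm s (hmnm j) == hmnm j)%:R : F).
  by apply/esym; exact: (big_enum_val (fun j => (smnm s (hmnm j) == hmnm j)%:R)).
rewrite -natr_sum -sum1_card big_mkcond [in RHS]big_mkcond /=; congr _%:R.
by apply: eq_bigr => j _; rewrite !inE; case: (~~ X _) => //=; case: (_ == _).
Qed.

End FixedMonomials.

Section IntervalSums.
Variables (n : nat) (s : 'S_n).
Implicit Types (A B D L W : {set 'I_n}) (a : nat).
Local Notation nc D := #|cyclesin s D|.

Lemma sum_stable_between L W a : L \subset W -> s @: L = L -> s @: W = W ->
  (\sum_(D : {set 'I_n} | [&& L \subset D, D \subset W & s @: D == D]) a ^ nc (W :\: D) =
   a.+1 ^ nc (W :\: L))%N.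
Proof.
move=> LW sL sW; rewrite (sum_stable_compl (fun D => a ^ nc (W :\: D))%N LW sL sW).
rewrite -(sum_stable_exp a (stableD sL sW)); apply: eq_bigr => D /andP[DW _].
by rewrite setDDr setDv set0U (setIidPr (subset_trans DW (subsetDl _ _))).
Qed.

Lemma sum_stable_above L W a : L \subset W -> s @: L = L -> s @: W = W ->
  (\sum_(D : {set 'I_n} | [&& L \subset D, D \subset W & s @: D == D]) a ^ nc (D :\: L) =
   a.+1 ^ nc (W :\: L))%N.
Proof.
move=> LW sL sW; rewrite (sum_stable_compl (fun D => a ^ nc (D :\: L))%N LW sL sW).
have s0 : s @: set0 = set0 :> {set 'I_n} by rewrite imset0.
rewrite -[in RHS](setD0 (W :\: L)) -(sum_stable_between a (sub0set _) s0 (stableD sL sW)).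
apply: eq_big => [D|D _]; first by rewrite sub0set.
by rewrite setDDl setUC -setDDl.
Qed.

(** Each cycle of [W :\: L] lies in [A], or in [B :\: A] with weight [a], or outside [B]: the
    weights of these choices add up to [a.+2]. *)
Lemma sum_stable_pairs L W a : L \subset W -> s @: L = L -> s @: W = W ->
  (\sum_(B : {set 'I_n} | [&& L \subset B, B \subset W & s @: B == B])
     \sum_(A : {set 'I_n} | [&& L \subset A, A \subset B & s @: A == A]) a ^ nc (B :\: A) =
   a.+2 ^ nc (W :\: L))%N.
Proof.
move=> LW sL sW; rewrite -(sum_stable_above a.+1 LW sL sW); apply: eq_bigr => B.
by case/and3P => LB _ /eqP sB; rewrite sum_stable_between.
Qed.

End IntervalSums.

(** * Counting fixed multichains of intervals *)

Section FixedMonomialCount.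
Variables (R : realType) (n : nat) (s : 'S_n).
Local Notation T := (vtx (Kn n R)).
Local Notation N := #|T|.
Local Notation act v := (vact (Kn n R) v s).
Implicit Types (W D : {set 'I_n}) (I J : T) (Q : pred T) (m : 'X_{1..N}) (d : nat).
Local Notation nc D := #|cyclesin s D|.

Definition isub I J := interval_set I \subset interval_set J.

Lemma isub_anti I J : isub I J -> isub J I -> I = J.
Proof.
rewrite /isub !interval_subE => /andP[a b] /andP[c d].
by apply: interval_inj; apply/eqP; rewrite eqEsubset ?a ?b ?c ?d.
Qed.

Definition itop m I := (I \in supp m) && [forall J in supp m, isub J I].

Lemma itop_uniq m I J : itop m I -> itop m J -> I = J.
Proof.
by move=> /andP[Im /forall_inP Imax] /andP[Jm /forall_inP Jmax]; apply: isub_anti; auto.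
Qed.

Lemma itop_ex m : interval_chain (supp m) -> supp m != set0 -> exists I, itop m I.
Proof.
move=> /forall_inP cm /set0Pn[I0 I0m].
case: (arg_maxnP (fun I : T => #|interval_set I|) I0m) => I Im Imax; exists I.
apply/andP; split; first exact: Im.
apply/forall_inP => J Jm; have /forall_inP/(_ J Jm)/orP[IJ|//] := cm I Im.
by rewrite /isub; have/eqP-> : interval_set I == interval_set J by rewrite eqEcard IJ; apply: Imax.
Qed.

Definition fixmon d Q := [set j : 'I_(hdim N d) | [&& interval_chain (supp (hmnm j)),
  [forall v in supp (hmnm j), Q v] & smnm s (hmnm j) == hmnm j]].

Lemma smnmD m1 m2 : smnm s (m1 + m2)%MM = (smnm s m1 + smnm s m2)%MM.
Proof. by apply/mnmP => a; rewrite !mnmE. Qed.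

Lemma smnm1 I : smnm s U_(enum_rank I)%MM = U_(enum_rank (act I))%MM.
Proof.
apply/mnmP => a; rewrite !mnmE; congr (nat_of_bool _); apply/eqP/eqP => [/enum_rank_inj->|<-].
  by rewrite act_inK enum_valK.
by rewrite enum_rankK act_inVK.
Qed.

Lemma fixmon0 Q : #|fixmon 0 Q| = 1%N.
Proof.
have [j hj] := @hmnmP N 0 0%MM mdeg0.
apply/eqP/cards1P; exists j; apply/setP => k; rewrite !inE.
have -> : k = j.
  by apply: hmnm_inj; rewrite hj; apply/eqP; rewrite -mdeg_eq0 mdeg_hmnm.
rewrite eqxx hj supp0 interval_chain0 /=; apply/andP; split.
  by apply/forall_inP => v; rewrite inE.
by apply/eqP/mnmP => a; rewrite !mnmE.
Qed.

(** A monomial supported on a chain has a largest interval, which is fixed when the monomial is.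
    Dividing by its variable leaves a fixed monomial supported on intervals below it. *)
Lemma fixmonS d Q : (forall I J, isub I J -> Q J -> Q I) ->
  #|fixmon d.+1 Q| = (\sum_(I : T | Q I && (act I == I)) #|fixmon d (isub^~ I)|)%N.
Proof.
move=> Qdown; rewrite -sum1_card.
transitivity (\sum_(j in fixmon d.+1 Q) \sum_(I : T | (Q I && (act I == I)) && itop (hmnm j) I) 1)%N.
  apply: eq_bigr => j; rewrite inE => /and3P[cj /forall_inP Qj /eqP fj].
  have [|I tI] := itop_ex cj.
    apply/set0Pn; have : hmnm j != 0%MM by rewrite -mdeg_eq0 mdeg_hmnm.
    case: (pickP (fun a : 'I_N => hmnm j a != 0%N)) => [a ja _|j0 /eqP[]].
      by exists (enum_val a); rewrite inE enum_valK.
    by apply/mnmP => a; rewrite mnmE; apply/eqP; move/negbFE: (j0 a).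
  rewrite (big_pred1 I) // => J; apply/andP/eqP => [[_ /itop_uniq]|->]; first exact.
  have [Im /forall_inP Imax] := andP tI; rewrite Qj //; split => //.
  apply/eqP/(@itop_uniq (hmnm j)) => //; rewrite -fj; apply/andP; split.
    by rewrite supp_smnm; apply: (imset_f (fun v : T => act v)); exact: Im.
  apply/forall_inP => J'; rewrite supp_smnm => /imsetP[K Km ->].
  by rewrite /isub !interval_set_act; apply: imsetS; apply: Imax.
rewrite (exchange_big_dep (fun I => Q I && (act I == I))) /=; last by move=> ? ? _ /andP[].
apply: eq_bigr => I /andP[QI /eqP fI]; rewrite sum1_card.
have dd (j : 'I_(hdim N d)) : mdeg (hmnm j + U_(enum_rank I))%MM = d.+1.
  by rewrite mdegD mdeg1 mdeg_hmnm addn1.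
pose phi j := projT1 (cid (hmnmP (dd j))).
have phiE j : hmnm (phi j) = (hmnm j + U_(enum_rank I))%MM by rewrite /phi; case: cid.
have phi_inj : injective phi.
  by move=> j k /(congr1 (@hmnm N d.+1)); rewrite !phiE => /addIm/hmnm_inj.
rewrite -[RHS](card_imset _ phi_inj); apply: eq_card => j; rewrite unfold_in /=.
have suppI k : supp (hmnm (phi k)) = I |: supp (hmnm k).
  by rewrite phiE supp_add supp1 enum_rankK setUC.
apply/idP/imsetP => [|[k]].
  case/andP; rewrite inE => /and3P[cj Qj /eqP fj] /andP[_ /andP[Ij /forall_inP Imax]].
  have Uj : (U_(enum_rank I) <= hmnm j)%MM.
    by apply/mnm_lepP => a; rewrite mnmE; case: eqP => //= <-; rewrite lt0n; rewrite inE in Ij.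
  have [|k hk] := @hmnmP N d (hmnm j - U_(enum_rank I))%MM.
    by apply: succn_inj; rewrite -[RHS](mdeg_hmnm j) -[in RHS](submK Uj) mdegD mdeg1 addn1.
  have kj : phi k = j by apply: hmnm_inj; rewrite phiE hk submK.
  exists k => //; rewrite inE; have sk := suppI k; rewrite kj in sk.
  have skj : supp (hmnm k) \subset supp (hmnm j) by rewrite sk subsetUr.
  apply/and3P; split; first exact: interval_chainS skj cj.
    by apply/forall_inP => v /(subsetP skj)/Imax.
  apply/eqP/(@addIm _ U_(enum_rank I)%MM); rewrite -phiE kj -[RHS]fj -kj phiE smnmD smnm1.
  by have -> : act I = I by exact: fI.
rewrite inE => /and3P[ck /forall_inP kI /eqP fk] ->.
have top : itop (hmnm (phi k)) I.
  rewrite /itop suppI setU11; apply/forall_inP => J; rewrite in_setU1 => /orP[/eqP->|/kI//].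
  by rewrite /isub subxx.
apply/andP; split; last by rewrite QI; apply/andP; split=> //; apply/eqP.
rewrite inE.
have Qk : [forall v in supp (hmnm (phi k)), Q v].
  apply/forall_inP => v; rewrite suppI in_setU1 => /orP[/eqP->//|vk].
  by apply: Qdown QI; apply: kI.
have fI' : act I = I by exact: fI.
rewrite Qk phiE smnmD smnm1 fk fI' eqxx !andbT -phiE.
apply/forall_inP => J; rewrite suppI in_setU1 => JI; apply/forall_inP => K; rewrite in_setU1 => KI.
have kI' v : v \in supp (hmnm k) -> interval_set v \subset interval_set I by apply: kI.
case/orP: JI => [/eqP->|Jk]; first by case/orP: KI => [/eqP->|/kI' ->]; rewrite ?subxx ?orbT.
case/orP: KI => [/eqP->|Kk]; first by rewrite kI'.
by have /forall_inP/(_ K Kk) := forall_inP ck J Jk.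
Qed.

Lemma sum_intervals (P : pred ({set 'I_n} * {set 'I_n})) (f : {set 'I_n} * {set 'I_n} -> nat) :
  (\sum_(I : T | P (val I)) f (val I) =
   \sum_(x : {set 'I_n} * {set 'I_n} | [&& x.1 != set0, x.1 \subset x.2 & P x]) f x)%N.
Proof.
rewrite -(big_sub_cond (fun x : {set 'I_n} * {set 'I_n} => (x.1 != set0) && (x.1 \subset x.2)) P f).
by apply: eq_bigl => x; rewrite unfold_in -andbA.
Qed.

Lemma act_fixed I : (act I == I) = (s @: ilo I == ilo I) && (s @: ihi I == ihi I).
Proof. by rewrite -val_eqE /= -pair_eqE. Qed.

Lemma sum_fixed_intervals (g : {set 'I_n} -> {set 'I_n} -> bool) (f : {set 'I_n} -> nat) :
  (\sum_(I : T | g (ilo I) (ihi I) && (act I == I)) f (ihi I :\: ilo I) =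
   \sum_(B : {set 'I_n} | s @: B == B) \sum_(A : {set 'I_n} |
      [&& A != set0, A \subset B, s @: A == A & g A B]) f (B :\: A))%N.
Proof.
under eq_bigl => I do rewrite act_fixed.
rewrite (sum_intervals (fun x => g x.1 x.2 && ((s @: x.1 == x.1) && (s @: x.2 == x.2)))
  (fun x => f (x.2 :\: x.1))) /=.
rewrite (exchange_big_dep xpredT) //= pair_big_dep /=; apply: eq_bigl => -[A B] /=.
by case: (A != _); case: (A \subset B); case: (g A B); case: (s @: A == A); case: (s @: B == B).
Qed.

Lemma card_fixmon_below d J : act J = J ->
  (#|fixmon d (isub^~ J)| = d.*2.+1 ^ nc (ihi J :\: ilo J))%N.
Proof.
elim: d J => [|d IHd] J fJ; first by rewrite fixmon0 exp1n.
have /andP[/eqP sL /eqP sH] : (s @: ilo J == ilo J) && (s @: ihi J == ihi J).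
  by rewrite -act_fixed fJ.
rewrite fixmonS; last by move=> I I' II' I'J; apply: subset_trans I'J.
rewrite (eq_bigr (fun I => d.*2.+1 ^ nc (ihi I :\: ilo I))%N) => [|I /andP[_ /eqP fI]]; last exact: IHd.
pose g (A B : {set 'I_n}) := (ilo J \subset A) && (B \subset ihi J).
rewrite (eq_bigl (fun I => g (ilo I) (ihi I) && (act I == I))) => [|I]; last by rewrite /isub interval_subE.
rewrite (sum_fixed_intervals g (fun D => d.*2.+1 ^ nc D)%N) doubleS -(sum_stable_pairs _ (ilo_hi J) sL sH).
rewrite big_mkcond [RHS]big_mkcond; apply: eq_bigr => B _.
case: (boolP (s @: B == B)) => sB; rewrite ?andbF ?andbT //.
case: (boolP (B \subset ihi J)) => BH; last first.
  by rewrite andbF big1 // => A; rewrite /g (negbTE BH) !andbF.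
rewrite andbT; case: (boolP (ilo J \subset B)) => LB; last first.
  rewrite big1 // => A /and4P[_ AB _ /andP[LA _]].
  by rewrite (subset_trans LA AB) in LB.
apply: eq_bigl => A; rewrite /g BH andbT; case: (boolP (ilo J \subset A)) => LA; rewrite ?andbF //.
rewrite andbT; suff -> : A != set0 by [].
by apply: contraNneq (ilo_neq0 J) => A0; rewrite A0 subset0 in LA.
Qed.

(** Intervals have nonempty lower ends. The pairs with empty lower end contribute the second
    summand, and together with them the count runs over all stable pairs, to which
    [sum_stable_pairs] applies. *)
Lemma card_fixmon_in d W : s @: W = W ->
  (#|fixmon d.+1 (fun I => ihi I \subset W)| + d.*2.+2 ^ nc W = d.*2.+3 ^ nc W)%N.
Proof.
move=> sW; have s0 : s @: set0 = set0 :> {set 'I_n} by rewrite imset0.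
rewrite fixmonS; last first.
  by move=> I J; rewrite /isub interval_subE => /andP[_ IJ]; apply: subset_trans.
rewrite (eq_bigr (fun I => d.*2.+1 ^ nc (ihi I :\: ilo I))%N) => [|I /andP[_ /eqP fI]]; last exact: card_fixmon_below.
rewrite (sum_fixed_intervals (fun _ B => B \subset W) (fun D => d.*2.+1 ^ nc D)%N).
rewrite -[in RHS](setD0 W) -(sum_stable_pairs _ (sub0set W) s0 sW).
rewrite -(sum_stable_exp _ sW) big_mkcond [X in (_ + X)%N]big_mkcond [RHS]big_mkcond -big_split /=.
apply: eq_bigr => B _; rewrite sub0set /=.
case: (boolP (s @: B == B)) => sB; rewrite ?andbF ?andbT //.
case: (boolP (B \subset W)) => BW; last first.
  by rewrite big1 // => A; rewrite !andbF.
rewrite [RHS](bigD1 set0) /= ?sub0set ?s0 ?eqxx // setD0 addnC; congr (_ + _)%N.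
by apply: eq_bigl => A; rewrite sub0set andbT /= andbC -andbA.
Qed.

Lemma qser_nf_coef (F : fieldType) W d : s @: W = W ->
  fps_coef (qser (n := n) (R := R) s (fun p : {mpoly F[N]} => mspan (nf W) p)) d.+1 =
  (d.*2.+3 ^ nc W)%:R - (d.*2.+2 ^ nc W)%:R.
Proof.
move=> sW; refine (etrans (@mxtrace_fixed R n F s d.+1 (nf W) _ _) _); first exact: nf_up.
  by move=> G; rewrite /nf -[in LHS]sW faceW_actE.
rewrite -(card_fixmon_in d sW) natrD addrK; congr _%:R; apply: eq_card => j.
by rewrite !inE negbK /faceW andbA.
Qed.

Lemma qser_nf_coef0 (F : fieldType) W : s @: W = W ->
  fps_coef (qser (n := n) (R := R) s (fun p : {mpoly F[N]} => mspan (nf W) p)) 0 = 1.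
Proof.
move=> sW; refine (etrans (@mxtrace_fixed R n F s 0 (nf W) _ _) _); first exact: nf_up.
  by move=> G; rewrite /nf -[in LHS]sW faceW_actE.
rewrite -[RHS](congr1 (GRing.natmul 1) (fixmon0 (fun I => ihi I \subset W))).
by congr _%:R; apply: eq_card => j; rewrite !inE negbK /faceW andbA.
Qed.

End FixedMonomialCount.

(** * The filtration by carriers and the decomposition into local face modules *)

Section IdealSum.
Variable S : comNzRingType.
Implicit Types (P Q : S -> Prop) (p : S).

Definition isum P Q p := exists2 q, P q & Q (p - q).

Lemma isum_ideal P Q : is_ideal P -> is_ideal Q -> is_ideal (isum P Q).
Proof.
move=> IP IQ; split=> [|p q [a Pa Qa] [b Pb Qb]|c p [a Pa Qa]].
- by exists 0; [apply: ideal0 | rewrite subr0; apply: ideal0].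
- by exists (a + b); rewrite ?opprD 1?addrACA; apply: idealD.
by exists (c * a); rewrite -?mulrBr; apply: idealM.
Qed.

Lemma isum_l P Q p : is_ideal Q -> P p -> isum P Q p.
Proof. by move=> IQ Pp; exists p; [exact: Pp | rewrite subrr; apply: ideal0]. Qed.

Lemma isum_r P Q p : is_ideal P -> Q p -> isum P Q p.
Proof. by move=> IP Qp; exists 0; [apply: ideal0 | rewrite subr0]. Qed.

Lemma isum_sub P Q M : is_ideal M -> (forall p, P p -> M p) -> (forall p, Q p -> M p) ->
  forall p, isum P Q p -> M p.
Proof. by move=> IM PM QM p [q /PM Mq /QM Mpq]; apply: (idealBr IM Mq). Qed.

End IdealSum.

Section CarrierFiltration.
Variables (R : realType) (n : nat) (F : fieldType) (iota : {rmorphism R -> F}) (s : 'S_n).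
Local Notation T := (vtx (Kn n R)).
Local Notation S := {mpoly F[#|T|]}.
Implicit Types (W U V : {set 'I_n}) (G H : {set T}) (i j k : 'I_n) (p q c x : S) (l d : nat).
Local Notation th := (theta iota (Kn n R)).
Local Notation tw := (tw (n := n) (R := R) iota).
Local Notation TRs d P := (TR (Gamma := Kn n R) s d P).
Local Notation iw W := (fun p : S => mspan (nf W) p).
Local Notation J U W := (fun p : S => mspan (jp U W) p).

Definition large l W : pred {set T} := fun G => nf W G || (l <= #|carr G|)%N.

Lemma large_up l W : upclosed (large l W).
Proof.
move=> G H GH /orP[nG|UG]; first by rewrite /large (nf_up GH nG).
by rewrite /large (leq_trans UG) ?orbT // subset_leq_card // carr_sub.
Qed.

(** Modulo [tw W], the image of the monomials whose carrier has at least [l] elements: everything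
    for [l = 0], and zero once [l] exceeds the size of [W]. Likewise [lw W] modulo [tw W] is the
    local face module over [W]. *)
Definition filt l W : S -> Prop := isum (fun p => mspan (large l W) p) (tw W).
Definition lw W : S -> Prop := isum (J W W) (tw W).

Lemma large_ideal l W : is_ideal (fun p : S => mspan (large l W) p).
Proof. exact/mspan_ideal/large_up. Qed.

Lemma filt_ideal l W : is_ideal (filt l W).
Proof. by apply: isum_ideal; [exact: large_ideal | exact: tw_ideal]. Qed.

Lemma lw_ideal W : is_ideal (lw W).
Proof. by apply: isum_ideal; [exact: J_ideal | exact: tw_ideal]. Qed.

Lemma isum_stable (P Q : S -> Prop) : stable (Gamma := Kn n R) s P -> stable (Gamma := Kn n R) s Q ->
  stable (Gamma := Kn n R) s (isum P Q).
Proof.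
by move=> sP sQ p [q /sP Pq /sQ Qq]; exists (sact (Gamma := Kn n R) s q); rewrite // -sactB.
Qed.

Lemma filt_stable l W : s @: W = W -> stable (Gamma := Kn n R) s (filt l W).
Proof.
move=> sW; apply: isum_stable; last exact: tw_stable.
move=> p; apply: mspan_sact => G /orP[nG|lG].
  by rewrite /large /nf -{1}sW faceW_actE [~~ _]nG.
by rewrite /large carr_act (card_imset _ (@perm_inj _ s)) lG orbT.
Qed.

Local Notation gradedK P := (graded (Gamma := Kn n R) P).
Lemma isum_graded (P Q : S -> Prop) : gradedK P -> gradedK Q -> gradedK (isum P Q).
Proof.
move=> gP gQ p d [q Pq Qq]; exists (pihomog mdeg d q); first exact: gP.
by rewrite -pihomogB; apply: gQ.
Qed.

(* This is where [local_cap] enters: an element of the interior ideal of [W] that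
   lies in [Theta_W] lies in [Theta], up to monomials with a larger carrier. *)
Lemma interior_theta_filt U W y : U \subset W -> mspan (jp U W) y -> tw U y ->
  filt #|U|.+1 W y.
Proof.
move=> UW yJ yU; have yJU : mspan (jp U U) y by apply: mspan_sub yJ => G; apply: jp_monoW.
pose Q x := exists2 t, mspan (jp U W) t /\ tw W t & mspan (nf U) (x - t).
have IW := @tw_ideal R n F iota W; have IJ := @J_ideal R n F U W.
have IU := @iw_ideal R n F U.
have IQ : is_ideal Q.
  split=> [|p q [a [Ja ta] na] [b [Jb tb] nb]|c p [a [Ja ta] na]].
  - by exists 0; [split; [exact: mspan0 | exact: (ideal0 IW)] | rewrite subr0 mspan0].
  - exists (a + b); first by split; [exact: mspanD | exact: (idealD IW)].
    by rewrite opprD addrACA mspanD.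
  exists (c * a); first by split; [exact: (idealM IJ) | exact: (idealM IW)].
  by rewrite -mulrBr; exact: (idealM IU).
have [t [tJ tW] rt] : Q y.
  have := local_cap (enum_uniq U) yJU yU.
  apply: gsum_sub_in => // [p pU|i c]; first by exists 0; [split; [exact: mspan0 | exact: (ideal0 IW)] | rewrite subr0].
  rewrite mem_enum => iU cJ.
  have [c' c'J c'U] : exists2 q : S, mspan (jp (U :\ i) W) q & mspan (nf U) (c - q).
    by apply: mspan_split cJ => G /orP[->|UG]; rewrite ?orbT // /jp UG !orbT.
  exists (th i * c'); first by split; [apply: theta_J | apply: tw_th].
  by rewrite -mulrBr; exact: (idealM IU).
exists (y - t); last by rewrite opprB addrC subrK.
apply: mspan_sub (mspan_and rt (mspanB yJ tJ)) => G /= /andP[nU /orP[nG|UG]]; rewrite /large ?nG //.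
have [nG|fG] := boolP (nf W G); rewrite //=; apply: proper_card.
rewrite properE UG; move: nU fG; rewrite negbK /nf !faceW_carr.
by case: (interval_chain G) => //= ->.
Qed.

(** Restriction to the face [U] maps this piece of the filtration onto the local face module of [U]:
    it kills carriers larger than [U], and its injectivity is [interior_theta_filt]. *)
Lemma TR_lw U W d : s @: W = W -> s @: U = U -> U \subset W ->
  TRs d (isum (J U W) (filt #|U|.+1 W)) - TRs d (filt #|U|.+1 W) = TRs d (lw U) - TRs d (tw U).
Proof.
move=> sW sU UW; set D := filt _ _; have ID : is_ideal D := filt_ideal _ _.
have IT : is_ideal (tw U) := tw_ideal _ _.
have DT p : D p -> tw U p.
  apply: isum_sub => // [q qL|q]; last exact: tw_mono.
  apply: tw_nf; apply: mspan_sub qL => G /orP[/(nf_mono UW)//|lG].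
  rewrite /nf faceW_carr negb_and; apply/orP; right; apply: contraTN lG => /subset_leq_card.
  by rewrite -ltnNge ltnS.
have sJ V : s @: V = V -> stable (Gamma := Kn n R) s (J U V).
  by move=> sV p /(jp_act s); rewrite sU sV.
have IJ V : is_ideal (J U V) := J_ideal _ _ _ _.
have sT : stable (Gamma := Kn n R) s (tw U) := tw_stable sU.
apply/esym/TR_subquotient => //.
- exact: isum_ideal.
- exact: lw_ideal.
- by apply: isum_stable; [exact: sJ | exact: filt_stable].
- exact: filt_stable.
- by move=> p; apply: isum_r.
- by move=> p; apply: isum_r.
- apply: isum_sub => [|p pJ|p /DT]; [exact: lw_ideal | | by apply: isum_r].
  by apply: isum_l => //; apply: mspan_sub pJ => G; apply: jp_monoW.
- move=> q hq [a aJ tq]; have [b bJ bU] : exists2 b : S, mspan (jp U W) b & mspan (nf U) (a - b).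
    by apply: mspan_split aJ => G /orP[->|UG]; rewrite ?orbT // /jp UG !orbT.
  exists (pihomog mdeg d b); split; first exact: pihomogP.
    by apply: isum_l => //; apply: mspan_graded.
  have : tw U (q - b).
    by rewrite -[q](subrK a) -addrA; apply: idealD => //; apply: tw_nf.
  by move/(@tw_graded _ _ _ _ _ _ d); rewrite pihomogB pihomog_dE.
move=> p [a aJ Dpa] Tp; apply: (idealBr ID _ Dpa); apply: interior_theta_filt => //.
have Tpa := DT _ Dpa; rewrite -[a](subKr p); apply: idealB => //.
Qed.

(** The piece of level [l] is the direct sum of the images of the ideals attached to the [U] of size
    [l]. Restricting to one [U] kills the other summands, and [interior_theta_filt] then shows
    directness. Since [s] permutes the summands, only stable [U] contribute to the trace. *)
Lemma filt_split l W d : s @: W = W ->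
  TRs d (filt l W) - TRs d (filt l.+1 W) =
  \sum_(U : {set 'I_n} | [&& s @: U == U, U \subset W & #|U| == l]) (TRs d (lw U) - TRs d (tw U)).
Proof.
move=> sW; set D := filt l.+1 W; have ID : is_ideal D := filt_ideal _ _.
have sD : stable (Gamma := Kn n R) s D := filt_stable sW.
pose cond U := (U \subset W) && (#|U| == l).
pose xp U : pred {set T} := fun G => nf W G || (cond U && (U \subset carr G)).
have xp_up U : upclosed (xp U).
  move=> G H GH /orP[nG|/andP[cU UG]]; first by rewrite /xp (nf_up GH nG).
  by rewrite /xp cU (subset_trans UG (carr_sub GH)) orbT.
have Ixp U : is_ideal (fun p : S => mspan (xp U) p) by apply: mspan_ideal.
(* For [U] not of size [l] or not inside [W], [X U] is [D] itself and contributes nothing, so all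
   subsets can index the family. *)
pose X U : S -> Prop := isum (fun p => mspan (xp U) p) D.
have DX U p : D p -> X U p by apply: isum_r.
have iwD p : mspan (nf W) p -> D p by move=> ?; apply: isum_r; [exact: large_ideal | exact: tw_nf].
have large_nf U : cond U -> forall p, D p -> tw U p.
  case/andP=> UW /eqP Ul p; apply: isum_sub => [|q qL|q]; [exact: tw_ideal | | exact: tw_mono].
  apply: tw_nf; apply: mspan_sub qL => G /orP[/(nf_mono UW)//|lG].
  rewrite /nf faceW_carr negb_and; apply/orP; right; apply: contraTN lG => /subset_leq_card.
  by rewrite Ul -ltnNge ltnS.
have large_D p : mspan (large l.+1 W) p -> D p by move=> ?; apply: isum_l => //; apply: tw_ideal.
have DQ p : D p -> filt l W p.
  apply: isum_sub; [exact: filt_ideal | | by move=> q tq; apply: isum_r; [exact: large_ideal|]].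
  move=> q qL; apply: isum_l; first exact: tw_ideal.
  by apply: mspan_sub qL => G /orP[nG|lG]; rewrite /large ?nG // (ltnW lG) orbT.
rewrite (@TR_permuted _ _ _ _ _ _ (fun U => s @: U) s d D (filt l W) X) => //.
- rewrite big_mkcond [RHS]big_mkcond; apply: eq_bigr => U _; case: eqP => //= sU.
  rewrite -/(cond U); case: ifP => cU.
    have /andP[UW /eqP Ul] := cU; rewrite -(TR_lw d sW sU UW) Ul; congr (TRs d _ - _).
    congr isum; apply: funext => p; congr is_true; apply: eq_all => m.
    by rewrite /xp cU.
  apply/eqP; rewrite subr_eq0; apply/eqP; congr (TRs d _); apply: funext => p; apply: propext; split; last exact: DX.
  apply: isum_sub => // q qX; apply: iwD; apply: mspan_sub qX => G.
  by rewrite /xp cU orbF.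
- exact: filt_ideal.
- by move=> U; apply: isum_ideal.
- move=> U p; apply: isum_sub; first exact: filt_ideal.
    move=> q qX; apply: isum_l; first exact: tw_ideal.
    apply: mspan_sub qX => G /orP[nG|/andP[/andP[_ /eqP <-] UG]]; rewrite /large ?nG //.
    by rewrite (subset_leq_card UG) orbT.
  exact: DQ.
- move=> q hq [a0 La0 tq]; set a := pihomog mdeg d a0.
  have La : mspan (large l W) a by apply: mspan_graded.
  have tqa : tw W (q - a).
    by have := @tw_graded _ _ _ _ _ _ d tq; rewrite pihomogB pihomog_dE.
  pose Y U : pred {set T} := fun G => [&& carr G == U, cond U & faceW W G].
  exists (fun U => mproj (Y U) a).
    move=> U; split.
      apply: isum_l => //; apply: mspan_sub (mspan_proj _ _) => G /and3P[/eqP cG cU _].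
      by rewrite /xp cU cG subxx orbT.
    apply/dhomogP => m; rewrite mcoeff_msupp mcoeff_proj.
    case: ifP => [_|]; last by rewrite eqxx.
    by rewrite /a mcoeff_pihomog; case: (eqVneq (mdeg m) d) => // _; rewrite eqxx.
  have -> : q - \sum_U mproj (Y U) a = (a - \sum_U mproj (Y U) a) + (q - a).
    by rewrite [RHS]addrC addrA subrK.
  apply: idealD => //; last by apply: isum_r; [exact: large_ideal|].
  apply: large_D; apply/mspanP => m; 
  have mc : (\sum_U mproj (Y U) a)@_m = \sum_U (if Y U (supp m) then a@_m else 0).
    by rewrite raddf_sum; apply: eq_bigr => U _; exact: mcoeff_proj.
  rewrite mcoeffB mc.
  move: La => /mspanP/(_ m); case: eqVneq => [am|am /(_ isT) Lm].
    by rewrite am big1 ?subrr ?eqxx // => U _; rewrite if_same.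
  apply: contraR => nl; rewrite (bigD1 (carr (supp m))) //= big1 ?addr0; last first.
    by move=> U; rewrite eq_sym /Y => /negbTE ->.
  move: nl; rewrite /large negb_or -leqNgt => /andP[fm cm].
  move: Lm; rewrite /large (negbTE fm) /= => lm.
  suff -> : Y (carr (supp m)) (supp m) by rewrite subrr.
  move: fm; rewrite negbK /Y eqxx /cond eqn_leq cm lm /= andbT => fm; rewrite fm andbT.
  by move: fm; rewrite (@faceW_carr R n) => /andP[].
- move=> U p [q qX Dq]; exists (sact (Gamma := Kn n R) s q); last by rewrite -sactB; apply: sD.
  apply: mspan_sact qX => G; rewrite /xp carr_act /nf -{2}sW faceW_actE => /orP[->//|].
  case/andP=> /andP[UW Ul] UG; apply/orP; right.
  by rewrite /cond (card_imset _ (@perm_inj _ s)) Ul -{1}sW !imsetS.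
- move=> x xX xD U; have {}xX V : exists y, mspan (xp V) y /\ D (x V - y).
    by have [y yX Dy] := xX V; exists y.
  pose y V := projT1 (cid (xX V)); have yP V : mspan (xp V) (y V) /\ D (x V - y V).
    by rewrite /y; case: (cid _).
  have yD : D (\sum_V y V).
    have -> : \sum_V y V = \sum_V x V - \sum_V (x V - y V) by rewrite sumrB opprB addrC subrK.
    apply: idealB => //; apply: (big_ind D) => [||V _]; [exact: ideal0 | exact: idealD | by case: (yP V)].
  have [yU DU] := yP U; apply: (idealBr ID _ DU); case: (boolP (cond U)) => cU; last first.
    apply: iwD; apply: mspan_sub yU => G; rewrite /xp (negbTE cU) orbF //.
  have /andP[UW /eqP Ul] := cU; rewrite /D -Ul; apply: interior_theta_filt => //.
    by apply: mspan_sub yU => G; rewrite /xp cU.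
  have := large_nf U cU _ yD; rewrite (bigD1 U) //=; apply: idealDr; first exact: tw_ideal.
  have IT := @tw_ideal R n F iota U.
  apply: (big_ind (tw U)) => [||V VU]; [exact: ideal0 | exact: idealD |].
  have [yV _] := yP V; apply: tw_nf; apply: mspan_sub yV => G /orP[/(nf_mono UW)//|].
  case/andP=> /andP[VW /eqP Vl] VG; rewrite /nf faceW_carr negb_and; apply/orP; right.
  apply: contra VU => GU; rewrite eqEcard (subset_trans VG GU) Vl Ul leqnn //.
Qed.

Lemma qser_filtration W d : s @: W = W ->
  fps_coef (qser s (tw W)) d =
  \sum_(U : {set 'I_n} | (s @: U == U) && (U \subset W)) (TRs d (lw U) - TRs d (tw U)).
Proof.
move=> sW; transitivity (TRs d (filt 0 W) - TRs d (filt #|W|.+1 W)).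
  rewrite /qser /=; congr (TRs d _ - TRs d _); apply: funext => p; apply: propext; split=> //.
  - move=> _; apply: isum_l; first exact: tw_ideal.
    by apply: mspan_sub (mspanT p) => G _; rewrite /large leq0n orbT.
  - by move=> tp; apply: isum_r => //; apply: large_ideal.
  suff : filt #|W|.+1 W p -> tw W p by apply.
  apply: isum_sub => // [|q qL]; first exact: tw_ideal.
  apply: tw_nf; apply: mspan_sub qL => G /orP[//|lG].
  rewrite /nf faceW_carr negb_and; apply/orP; right; apply: contraTN lG => /subset_leq_card.
  by rewrite -ltnNge ltnS.
transitivity (\sum_(0 <= l < #|W|.+1) (TRs d (filt l W) - TRs d (filt l.+1 W))).
  rewrite -[LHS]opprB -(telescope_sumr (fun l => TRs d (filt l W))) // -sumrN.
  by apply: eq_bigr => l _; rewrite opprB.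
rewrite big_mkord; under eq_bigr do rewrite filt_split //.
rewrite (exchange_big_dep (fun U : {set 'I_n} => (s @: U == U) && (U \subset W))) /=; last first.
  by move=> l U _ /and3P[-> ->].
apply: eq_bigr => U /andP[sU UW].
have lU : (#|U| < #|W|.+1)%N by rewrite ltnS subset_leq_card.
by rewrite (big_pred1 (Ordinal lU)) // => l; rewrite sU UW /= -val_eqE eq_sym.
Qed.

End CarrierFiltration.

(** * The representations of the statement in terms of these ideals *)

Section ModuleTraces.
Variables (F : fieldType) (gT : finGroupType) (G : {group gT}) (m : nat) (rG : mx_representation F G m).

Lemma mxtrace_submod_trU (U : 'M[F]_m) (modU : mxmodule rG U) x : x \in G ->
  \tr (submod_repr modU x) = trU (rG x) U.
Proof.
move=> Gx; apply/esym; apply: (trU_basis (X := val_submod (1%:M : 'M_(\rank U)))).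
- by rewrite /val_submod /= mul1mx row_base_free.
- exact: val_submod1.
by rewrite -(val_submodJ modU) // mul1mx val_submodE.
Qed.

Lemma mxtrace_factmod_trU (U : 'M[F]_m) (modU : mxmodule rG U) x : x \in G ->
  \tr (factmod_repr modU x) = \tr (rG x) - trU (rG x) U.
Proof.
by move=> Gx; rewrite -(mxtrace_submod_trU modU Gx) -(mxtrace_sub_fact_mod modU x) addrC addKr.
Qed.

Lemma mxtrace_section_trU (U V : 'M[F]_m) (modU : mxmodule rG U) (modV : mxmodule rG V) x :
  x \in G -> (U <= V)%MS -> \tr (mxrepresentation.section_repr modU modV x) = trU (rG x) V - trU (rG x) U.
Proof.
move=> Gx UV; apply/esym; set W := <<in_factmod U V>>%MS.
have WV : (W :=: in_factmod U V)%MS by apply: genmxE.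
apply: (trU_rel (X := val_factmod (val_submod (1%:M : 'M_(\rank W))))) => //.
- exact: mxmoduleP modU x Gx.
- apply: submx_trans (_ : val_factmod (in_factmod U V) <= _)%MS.
    by rewrite val_factmodS val_submod1 WV.
  by rewrite (submx_trans (proj_factmodS _ _)) // addsmx_sub UV /=.
- rewrite -{1}(in_factmodsK UV) addsmxS // val_factmodS.
  by rewrite -WV val_submod1.
- move=> u; rewrite -in_factmod_eq0 val_factmodE mulmxA -val_factmodE -val_submodE val_factmodK.
  by rewrite val_submod_eq0 => /eqP.
rewrite -in_factmod_eq0 linearB /= (in_factmodJ modU) // val_factmodK subr_eq0.
rewrite -(val_submodJ (section_module modU modV)) // mul1mx.
have E : mxrepresentation.section_repr modU modV x *m val_factmod (val_submod (1%:M : 'M_(\rank W))) =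
    val_factmod (val_submod (mxrepresentation.section_repr modU modV x)).
  by rewrite /val_factmod /val_submod /= !mulmxA mulmx1.
by rewrite E val_factmodK.
Qed.

End ModuleTraces.

Lemma ideal_gen_sub (A : comNzRingType) (M : A -> Prop) (gs : seq A) p :
  is_ideal M -> (forall g, g \in gs -> M g) -> ideal_gen gs p -> M p.
Proof.
move=> IM gsM [c ->]; apply: (big_ind M) => [||j _]; [exact: ideal0 | exact: idealD |].
by apply: idealM => //; apply: gsM; apply: mem_nth.
Qed.

Lemma ideal_gen_ideal (A : comNzRingType) (gs : seq A) : is_ideal (ideal_gen gs).
Proof. by split; [exact: ideal_gen0 | exact: ideal_genD | exact: ideal_genM]. Qed.

Section FaceModuleTraces.
Variables (R : realType) (n : nat) (F : fieldType) (iota : {rmorphism R -> F}).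
Local Notation T := (vtx (Kn n R)).
Local Notation S := {mpoly F[#|T|]}.
Local Notation tw := (tw (n := n) (R := R) iota).
Local Notation lw := (lw (n := n) (R := R) iota).

Lemma xmonE (A : {set T}) : xmon F A = 'X_[setmnm A] :> S.
Proof.
rewrite mpolyXE_id /xmon big_mkcond (reindex (fun i : 'I_#|T| => enum_val i : T)) /=; last first.
  by exists (@enum_rank T) => i _; rewrite ?enum_rankK ?enum_valK.
apply: eq_bigr => i _; rewrite mnmE /xvar enum_valK.
by case: (enum_val i \in A).
Qed.

Lemma mspan_ideal_gen (X : pred {set T}) (gs : seq S) p :
  (forall A, X A -> xmon F A \in gs) -> mspan X p -> ideal_gen gs p.
Proof.
move=> Xgs /allP pX; rewrite [p]mpolyE big_seq.
apply: (big_ind (ideal_gen gs)) => [||m mp]; [exact: ideal_gen0 | exact: ideal_genD |].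
have [q ->] : exists q : S, 'X_[m] = 'X_[setmnm (supp m)] * q.
  by apply: setmnm_dvd; rewrite mspanX.
rewrite -xmonE mulrC -mul_mpolyC mulrA; apply/ideal_genM/ideal_gen_mem/Xgs.
exact: pX.
Qed.

Lemma quot_gens_tw p : ideal_gen (quot_gens iota (Kn n R)) p <-> tw setT p.
Proof.
have faceE (A : {set T}) : nf setT A = ~~ face A.
  by rewrite /nf faceW_carr subsetT andbT.
split.
  apply: ideal_gen_sub; first exact: tw_ideal.
  move=> g; rewrite mem_cat => /orP[/mapP[A]|/mapP[i _ ->]].
    rewrite mem_filter => /andP[fA _] ->; apply: tw_nf.
    by rewrite xmonE mspanX supp_setmnm faceE.
  by rewrite -[theta _ _ _]mulr1; apply: tw_th.
apply: tw_sub => [|q|i c _]; first exact: ideal_gen_ideal.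
  apply: mspan_ideal_gen => A fA; rewrite mem_cat map_f // mem_filter mem_enum andbT.
  by rewrite -faceE.
by rewrite mulrC; apply/ideal_genM/ideal_gen_mem; rewrite mem_cat map_f ?orbT // mem_enum.
Qed.

Lemma in_simplex_faceE (W : {set 'I_n}) (A : {set T}) : in_simplex_face W A = (carr A \subset W).
Proof.
apply/forall_inP/bigcupsP => AW v vA.
  apply/subsetP => i iv; apply: contraTT (AW v vA) => iW; apply/forallP => /(_ i).
  by rewrite iW /= interval_pos_eq0 iv.
apply/forallP => i; apply/implyP => iW; rewrite interval_pos_eq0.
by apply: contra iW; apply: subsetP (AW v vA) i.
Qed.

Lemma interior_faceE (A : {set T}) : interior_face A = face A && (setT \subset carr A).
Proof.
congr (_ && _); apply/idP/idP => [|AT].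
  apply: contraR => nT; apply/existsP; exists (carr A); rewrite in_simplex_faceE subxx andbT.
  by apply: contra nT => /eqP ->.
apply/existsP => -[W /andP[/eqP WT]]; rewrite in_simplex_faceE => AW; apply: WT.
by apply/eqP; rewrite eqEsubset subsetT (subset_trans AT AW).
Qed.

Lemma local_gens_lw p : ideal_gen (local_gens iota (Kn n R)) p <-> lw setT p.
Proof.
have faceE (A : {set T}) : nf setT A = ~~ face A.
  by rewrite /nf faceW_carr subsetT andbT.
have Il := @lw_ideal R n F iota setT.
have qg q : ideal_gen (quot_gens iota (Kn n R)) q -> ideal_gen (local_gens iota (Kn n R)) q.
  apply: ideal_gen_sub => [|g gq]; first exact: ideal_gen_ideal.
  by apply: ideal_gen_mem; rewrite mem_cat gq orbT.
split.
  apply: ideal_gen_sub => // g; rewrite mem_cat => /orP[/mapP[A]|gq].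
    rewrite mem_filter => /andP[+ _] ->; rewrite interior_faceE => /andP[_ AT].
    by apply: isum_l; [exact: tw_ideal | rewrite xmonE mspanX supp_setmnm /jp AT orbT].
  by apply: isum_r; [exact: J_ideal | apply/quot_gens_tw/ideal_gen_mem].
apply: isum_sub => [|q|q /quot_gens_tw]; [exact: ideal_gen_ideal | | exact: qg].
apply: mspan_ideal_gen => A /orP[fA|AT]; rewrite mem_cat.
  rewrite [X in _ || X](_ : _ = true) ?orbT // mem_cat map_f // mem_filter mem_enum andbT.
  by rewrite -faceE.
case: (boolP (face A)) => fA.
  by rewrite map_f // mem_filter mem_enum andbT interior_faceE fA AT.
by rewrite [X in _ || X](_ : _ = true) ?orbT // mem_cat map_f // mem_filter mem_enum andbT fA.
Qed.

Lemma TR_hideal s d (gs : seq S) (P : S -> Prop) : is_ideal P -> stable (Gamma := Kn n R) s P ->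
  (forall p, ideal_gen gs p <-> P p) ->
  trU (sact_mx F (Kn n R) d s) (hideal d gs) = TR (Gamma := Kn n R) s d P.
Proof.
move=> IP sP gsP; apply/esym/trU_eqmx; last exact: hmx_stable.
apply/eqmxP/andP; split; apply/rV_subP => u.
  by move=> /(hmxP _ IP)/gsP/hidealP.
by move=> /hidealP/gsP/(hmxP _ IP).
Qed.

Lemma setT_stable (s : 'S_n) : s @: setT = setT :> {set 'I_n}.
Proof. by apply/eqP; rewrite eqEcard subsetT (card_imset _ (@perm_inj _ s)) leqnn. Qed.

Lemma lw_stable (s : 'S_n) (W : {set 'I_n}) : s @: W = W -> stable (Gamma := Kn n R) s (lw W).
Proof.
move=> sW; apply: isum_stable; last exact: tw_stable.
by move=> p /(jp_act s); rewrite sW.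
Qed.

Lemma mxtrace_face_quot d (s : 'S_n) :
  \tr (face_quot_repr iota (Kn n R) d s) = fps_coef (qser s (tw setT)) d.
Proof.
rewrite /= (mxtrace_factmod_trU (quot_module iota (Kn n R) d)) ?inE //.
rewrite (TR_hideal _ (tw_ideal _ _) (tw_stable (setT_stable s)) quot_gens_tw).
by rewrite /qser /= TR_full.
Qed.

Lemma mxtrace_local_face d (s : 'S_n) :
  \tr (local_face_repr iota (Kn n R) d s) =
  TR (Gamma := Kn n R) s d (lw setT) - TR (Gamma := Kn n R) s d (tw setT).
Proof.
have [sT sL] := (tw_stable (iota := iota) (setT_stable s), lw_stable (setT_stable s)).
rewrite /= (mxtrace_section_trU (quot_module iota (Kn n R) d) (local_module iota (Kn n R) d)) ?inE //.
  by rewrite (TR_hideal _ (tw_ideal _ _) sT quot_gens_tw) (TR_hideal _ (lw_ideal _ _) sL local_gens_lw).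
apply/rV_subP => u /hidealP/quot_gens_tw tu; apply/hidealP/local_gens_lw.
by apply: isum_r => //; apply: J_ideal.
Qed.

End FaceModuleTraces.

(** * Truncated agreement of series, and finite differences of polynomial sequences *)

Section FiniteDifferences.
Variable A : comNzRingType.
Implicit Types (f g : fps A) (d D k m : nat).

Definition agree D f g := forall d, (d < D)%N -> fps_coef f d = fps_coef g d.

Lemma agree_mul D h f g : agree D f g -> agree D (h * f) (h * g).
Proof.
move=> fg d dD; rewrite !fps_coefM; apply: eq_bigr => j _; rewrite fg //.
exact: leq_ltn_trans (leq_subr _ _) dD.
Qed.

End FiniteDifferences.

Section PolynomialSequences.
Variable F : fieldType.
Implicit Types (p : {poly F}) (f : fps F).

Lemma size_shift_diff p : (size (p - (p \Po ('X - 1)))%R <= (size p).-1)%N.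
Proof.
have X1 : 'X - 1 = 'X - 1%:P :> {poly F} by rewrite polyC1.
have sX : size ('X - 1 : {poly F}) = 2%N by rewrite X1 size_XsubC.
have [->|p0] := eqVneq p 0; first by rewrite comp_poly0 subrr size_poly0.
have sz : size (p \Po ('X - 1)) = size p by rewrite size_comp_poly2.
have lc : lead_coef (p \Po ('X - 1)) = lead_coef p.
  by rewrite lead_coef_comp ?sX // X1 lead_coefXsubC expr1n mulr1.
apply/leq_sizeP => j; rewrite leq_eqVlt => /orP[/eqP <-|pj].
  by rewrite coefB -{2}sz -!lead_coefE lc subrr.
have jp : (size p <= j)%N by move: pj; case: (size p) => //.
by rewrite coefB !nth_default ?sz // subrr.
Qed.

(** Multiplication by [1 - 'X] is a backward difference: it lowers the degree of the polynomial and
    is valid one index later. *)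
Lemma difference_vanish m k p f : (size p <= m)%N ->
    (forall d, (k <= d)%N -> fps_coef f d = p.[d%:R]) ->
  forall d, (m + k <= d)%N -> fps_coef (pser ((1 - 'X) ^+ m) * f) d = 0.
Proof.
elim: m k p f => [|m IHm] k p f pm fp d; first last.
  rewrite exprSr rmorphM -mulrA addSnnS; apply: (IHm k.+1 (p - (p \Po ('X - 1)))).
    by apply: leq_trans (size_shift_diff p) _; case: (size p) pm.
  case=> // e ke; rewrite rmorphB rmorph1 mulrBl mul1r fps_coefB fps_coefXM.
  rewrite (fp e.+1 (ltnW ke)) (fp e ke) hornerD hornerN horner_comp !hornerE.
  by have -> : e%:R = e.+1%:R - 1 :> F by rewrite mulrSr addrK.
rewrite expr0 rmorph1 mul1r add0n => /fp ->.
by move: pm; rewrite leqn0 size_poly_eq0 => /eqP ->; rewrite horner0.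
Qed.

Lemma ex_odd_even_poly m : exists p : {poly F}, (size p <= m)%N /\
  forall d, p.[d%:R] = (d.*2.+1 ^ m)%:R - (d.*2 ^ m)%:R.
Proof.
pose g : {poly F} := 'X^m; pose h := g - (g \Po ('X - 1)).
pose q : {poly F} := 2%:R *: 'X + 1.
exists (h \Po q); split.
  have hm : (size h <= m)%N by rewrite (leq_trans (size_shift_diff g)) // size_polyXn.
  apply: leq_trans hm; have [->|h0] := eqVneq h 0; first by rewrite comp_poly0 size_poly0.
  apply: leq_trans (size_comp_poly_leq _ _) _.
  have s2 : (size q <= 2)%N.
    rewrite (leq_trans (size_polyD _ _)) // geq_max size_poly1 (leq_trans (size_scale_leq _ _)) ?size_polyX //.
  apply: (@leq_trans ((size h).-1 * 1).+1); first by rewrite ltnS leq_mul2l; case: (size _) s2 => [|[|[|]]] //; rewrite orbT.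
  by rewrite muln1 prednK // lt0n size_poly_eq0.
move=> d; rewrite horner_comp /q !hornerE /h /g ?hornerD ?hornerN ?horner_comp ?hornerE ?hornerXn.
by rewrite addrK !natrX -[d.*2.+1]addn1 natrD -muln2 natrM [2 * _]mulrC.
Qed.

End PolynomialSequences.

(** * Explicit trace series, and inversion over stable subsets *)

Section ExplicitSeries.
Variables (R : realType) (n : nat) (F : fieldType) (iota : {rmorphism R -> F}) (s : 'S_n).
Hypothesis prim : forall m, (0 < m)%N -> exists z : F, m.-primitive_root z.
Local Notation T := (vtx (Kn n R)).
Local Notation S := {mpoly F[#|T|]}.
Local Notation tw := (tw (n := n) (R := R) iota).
Local Notation lw := (lw (n := n) (R := R) iota).
Local Notation TRs d P := (TR (Gamma := Kn n R) s d P).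
Implicit Types (W U : {set 'I_n}) (d D : nat) (z : fps F).

Definition cyc1 (c : {set 'I_n}) : fps F := pser (1 - 'X^#|c|).

(** One formula for both modules, truncated at [D]: [z = 0] for the face ring modulo the parameters,
    [z = -1] for the local face module. The product of the $1-t^{|c|}$ is distributed over the
    cycles, so that the inversion only shifts each factor. The last product cancels the one
    subtracted at [d = 0]. *)
Definition expl D z W : fps F :=
  \sum_(d < D) pser 'X^d * (\prod_(c in cyclesin s W) (d.*2.+1%:R * cyc1 c + z)
                        - \prod_(c in cyclesin s W) (d.*2%:R * cyc1 c + z))
  + \prod_(c in cyclesin s W) z.

Lemma qser_agree W D : s @: W = W -> agree D (qser s (tw W)) (expl D 0 W).
Proof.
move=> sW; rewrite (qser_tw iota prim sW).
pose g d : F := (d.*2.+1 ^ #|cyclesin s W|)%:R - (d.*2 ^ #|cyclesin s W|)%:R.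
have -> : expl D 0 W = pser (\prod_(c in cyclesin s W) (1 - 'X^#|c|)) *
    pser (\poly_(d < D) g d + (0 ^ #|cyclesin s W|)%:R%:P).
  have pr (k : nat) : \prod_(c in cyclesin s W) (k%:R * cyc1 c + 0) =
      pser (\prod_(c in cyclesin s W) (1 - 'X^#|c|)) * pser (k ^ #|cyclesin s W|)%:R%:P.
    under eq_bigr do rewrite addr0.
    rewrite big_split /= prodr_const rmorph_prod mulrC; congr (_ * _).
    by rewrite natrX polyC_exp rmorphXn; congr (_ ^+ _); rewrite polyCMn !rmorph_nat.
  have e1 : \sum_(d < D) pser 'X^d * (\prod_(c in cyclesin s W) (d.*2.+1%:R * cyc1 c + 0)
      - \prod_(c in cyclesin s W) (d.*2%:R * cyc1 c + 0)) =
      pser (\prod_(c in cyclesin s W) (1 - 'X^#|c|)) * pser (\poly_(d < D) g d).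
    rewrite poly_def [X in _ = _ * X]rmorph_sum mulr_sumr; apply: eq_bigr => d _.
    rewrite (pr d.*2.+1) (pr d.*2) -mulrBr mulrCA -rmorphB -rmorphM -polyCB -/(g d).
    by congr (_ * pser _); rewrite mulrC mul_polyC.
  rewrite /expl e1 [in RHS]rmorphD mulrDr; congr (_ + _).
  rewrite -(pr 0%N); apply: eq_bigr => c _; by rewrite mul0r addr0.
apply: agree_mul => d dD; rewrite [RHS]/= coefD coef_poly dD coefC.
case: d dD => [|d] dD; last by rewrite [RHS]addr0 (qser_nf_coef R F d sW) /g doubleS.
by rewrite (qser_nf_coef0 R F sW) /g exp1n /= subrK.
Qed.

(** Writing a factor as $y_c=(y_c-1)+1$ and distributing gives a sum over sets of cycles, that is
    over stable subsets. *)
Lemma expl_sum D W : s @: W = W ->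
  \sum_(U : {set 'I_n} | (U \subset W) && (s @: U == U)) expl D (-1) U = expl D 0 W.
Proof.
move=> sW; have pr (y : {set 'I_n} -> fps F) :
    \sum_(U : {set 'I_n} | (U \subset W) && (s @: U == U)) \prod_(c in cyclesin s U) (y c - 1) =
    \prod_(c in cyclesin s W) (y c + 0).
  rewrite (sum_stable (fun U => \prod_(c in cyclesin s U) (y c - 1)) sW).
  transitivity (\prod_(c in cyclesin s W) ((y c - 1) + 1)).
    rewrite prodD_subsets; apply: eq_bigr => X XW.
    by rewrite cyclesin_cover ?(subset_trans XW (cyclesin_sub s W)) // [X in _ * X]big1 ?mulr1.
  by apply: eq_bigr => c _; rewrite subrK addr0.
rewrite /expl big_split /=; congr (_ + _).
  rewrite exchange_big /=; apply: eq_bigr => d _; rewrite -mulr_sumr; congr (_ * _).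
  by rewrite sumrB !pr.
have := pr (fun=> 0); under [X in _ = X]eq_bigr do rewrite addr0; move=> <-.
by apply: eq_bigr => U _; apply: eq_bigr => c _; rewrite sub0r.
Qed.

Definition lser W : fps F := Fps (fun d => TRs d (lw W) - TRs d (tw W)).

Lemma stable_moebius (A : zmodType) (f g : {set 'I_n} -> A) :
    (forall W, s @: W = W -> \sum_(U : {set 'I_n} | (U \subset W) && (s @: U == U)) f U =
                             \sum_(U : {set 'I_n} | (U \subset W) && (s @: U == U)) g U) ->
  forall W, s @: W = W -> f W = g W.
Proof.
move=> fg W; have [m] := ubnP #|W|; elim: m W => // m IHm W; rewrite ltnS => Wm sW.
have := fg W sW; rewrite (bigD1 W) ?subxx ?sW ?eqxx //= [RHS](bigD1 W) ?subxx ?sW ?eqxx //=.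
rewrite [X in _ + X = _](eq_bigr g); first exact: addIr.
move=> U /andP[/andP[UW /eqP sU] nUW]; apply: IHm => //.
by apply: leq_trans Wm; apply: proper_card; rewrite properEneq nUW.
Qed.

Lemma lser_sum W : s @: W = W ->
  qser s (tw W) = \sum_(U : {set 'I_n} | (U \subset W) && (s @: U == U)) lser U.
Proof.
move=> sW; apply: fpsP => d; rewrite (qser_filtration _ _ sW) fps_coef_sum.
by apply: eq_bigl => U; rewrite andbC.
Qed.

Lemma lser_agree W D : s @: W = W -> agree D (lser W) (expl D (-1) W).
Proof.
move=> sW d dD.
apply: (stable_moebius (f := fun U => fps_coef (lser U) d) (g := fun U => fps_coef (expl D (-1) U) d)) sW.
move=> V sV; rewrite -!fps_coef_sum -(lser_sum sV) expl_sum //; exact: qser_agree.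
Qed.

End ExplicitSeries.

(** * Vanishing above degree n *)

Section Vanishing.
Variables (R : realType) (n : nat) (F : fieldType) (iota : {rmorphism R -> F}).
Hypothesis prim : forall m, (0 < m)%N -> exists z : F, m.-primitive_root z.
Hypothesis F0 : [pchar F] =i pred0.
Local Notation tw := (tw (n := n) (R := R) iota).

Lemma imset_perm1 (W : {set 'I_n}) : (1%g : 'S_n) @: W = W.
Proof. exact: perm_imset1. Qed.

Lemma card_porbit1 (c : {set 'I_n}) : c \in porbits 1%g -> #|c| = 1%N.
Proof.
case/imsetP => i _ ->; apply/eqP/cards1P; exists i; apply/setP => j; rewrite inE.
by apply/porbitP/eqP => [[k ->]|->]; [rewrite expg1n perm1 | exists 0%N; rewrite perm1].
Qed.

(** For the identity the series is $(1-t)^{|W|}$ times a series whose coefficients of positive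
    degree are given by a polynomial with at most $|W|$ coefficients. This computes dimensions, and
    in characteristic zero a vanishing dimension makes all traces vanish, by [mxtrace_deg0]. *)
Lemma qser1_vanish (W : {set 'I_n}) d : (n < d)%N -> fps_coef (qser (1%g : 'S_n) (tw W)) d = 0.
Proof.
move=> nd; rewrite (qser_tw iota prim (imset_perm1 W)).
have cW : #|cyclesin 1%g W| = #|W|.
  rewrite -[RHS](card_cyclesin (imset_perm1 W)) -sum1_card; apply: eq_bigr => c.
  by rewrite inE => /andP[/card_porbit1].
have -> : \prod_(c in cyclesin 1%g W) (1 - 'X^#|c|) = (1 - 'X) ^+ #|W| :> {poly F}.
  by rewrite -cW -prodr_const; apply: eq_bigr => c; rewrite inE => /andP[/card_porbit1 ->].
have [p [pW pE]] := ex_odd_even_poly F #|W|.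
apply: (difference_vanish (k := 1) pW); last first.
  by apply: leq_trans nd; rewrite addn1 ltnS -[X in (_ <= X)%N]card_ord max_card.
by case=> // e _; rewrite (qser_nf_coef R F e (imset_perm1 W)) pE cW doubleS.
Qed.

Lemma mxtrace_deg0 k (rG : mx_representation F [set: 'S_n] k) s : \tr (rG 1%g) = 0 -> \tr (rG s) = 0.
Proof.
rewrite repr_mx1 mxtrace1 => /eqP; rewrite ((pcharf0P F).1 F0) => /eqP k0.
by move: rG; rewrite k0 => rG; rewrite /mxtrace big_ord0.
Qed.

Lemma mxtrace_face_quot_vanish d s : (n < d)%N -> \tr (face_quot_repr iota (Kn n R) d s) = 0.
Proof. by move=> nd; apply: mxtrace_deg0; rewrite mxtrace_face_quot qser1_vanish. Qed.

Lemma mxtrace_local_face_vanish d s : (n < d)%N -> \tr (local_face_repr iota (Kn n R) d s) = 0.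
Proof.
move=> nd; apply: mxtrace_deg0; rewrite mxtrace_local_face -/(fps_coef (lser iota _ _) d).
apply: (stable_moebius (s := 1%g) (f := fun U => fps_coef (lser iota 1%g U) d) (g := fun=> 0)).
  by move=> W sW; rewrite -fps_coef_sum -(lser_sum _ sW) qser1_vanish // big1.
exact: imset_perm1.
Qed.

End Vanishing.

(** * Sums over the symmetric group of products over cycles *)

Section StabilizerSum.
Variables (n : nat).
Implicit Types (U : {set 'I_n}) (s : 'S_n).

Definition intertwines U s (t : 'S_#|U|) := forall a : 'I_#|U|, s (enum_val a) = enum_val (t a).

Lemma ex_restriction U s : s @: U = U -> exists t : 'S_#|U|, intertwines s t.
Proof.
move=> sU; have sx (a : 'I_#|U|) : s (enum_val a) \in U.
  have sub x : x \in U -> s x \in U by move=> xU; rewrite -sU imset_f.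
  exact/sub/enum_valP.
pose f (a : 'I_#|U|) := enum_rank_in (sx a) (s (enum_val a)).
have fE a : enum_val (f a) = s (enum_val a) by rewrite enum_rankK_in.
have f_inj : injective f.
  by move=> a b ab; apply/enum_val_inj/(@perm_inj _ s); rewrite -!fE ab.
by exists (perm f_inj) => a; rewrite permE fE.
Qed.

Lemma intertwines_cycles U s (t : 'S_#|U|) : intertwines s t ->
  cyclesin s U = (fun c : {set 'I_#|U|} => enum_val @: c) @: porbits t.
Proof.
move=> st; have stX k (a : 'I_#|U|) : (s ^+ k)%g (enum_val a) = enum_val ((t ^+ k)%g a).
  by elim: k => [|k IHk]; rewrite ?expg0 ?perm1 // !expgSr !permM IHk st.
have orb (a : 'I_#|U|) : porbit s (enum_val a) = enum_val @: porbit t a.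
  apply/setP => x; apply/porbitP/imsetP => [[k ->]|[b /porbitP[k ->] ->]].
    by exists ((t ^+ k)%g a); rewrite ?mem_porbit.
  by exists k.
apply/setP => c; rewrite inE; apply/andP/imsetP => [[/imsetP[x _ ->] cU]|[d /imsetP[a _ ->] ->]].
  have xU : x \in U by apply: (subsetP cU); rewrite porbit_id.
  exists (porbit t (enum_rank_in xU x)); first exact: imset_f.
  by rewrite -orb enum_rankK_in.
rewrite -orb; split; first exact: imset_f.
by rewrite orb; apply/subsetP => _ /imsetP[b _ ->]; apply: enum_valP.
Qed.

Lemma ex_glue U (t1 : 'S_#|U|) (t2 : 'S_#|~: U|) : exists s, intertwines s t1 /\ intertwines s t2.
Proof.
pose f x := if @idP (x \in U) is ReflectT xU then enum_val (t1 (enum_rank_in xU x))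
            else if @idP (x \in ~: U) is ReflectT xU then enum_val (t2 (enum_rank_in xU x)) else x.
have f1 (a : 'I_#|U|) : f (enum_val a) = enum_val (t1 a).
  by rewrite /f; case: {-}_ / idP => [xU|]; rewrite ?enum_valK_in // enum_valP.
have f2 (a : 'I_#|~: U|) : f (enum_val a) = enum_val (t2 a).
  have aU := enum_valP a; rewrite /f; case: {-}_ / idP => [xU|_]; first by rewrite inE xU in aU.
  by case: {-}_ / idP => [xU|//]; rewrite ?enum_valK_in.
have ex x : (exists a : 'I_#|U|, x = enum_val a) \/ (exists a : 'I_#|~: U|, x = enum_val a).
  have [xU|xU] := boolP (x \in U); first by left; exists (enum_rank_in xU x); rewrite enum_rankK_in.
  have xU' : x \in ~: U by rewrite inE.
  by right; exists (enum_rank_in xU' x); rewrite enum_rankK_in.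
have ne (a : 'I_#|U|) (b : 'I_#|~: U|) : enum_val a = enum_val b -> False.
  by move=> ab; have := enum_valP b; rewrite -ab inE enum_valP.
have f_inj : injective f.
  move=> x y; case: (ex x) => [[a ->]|[a ->]]; case: (ex y) => [[b ->]|[b ->]]; rewrite ?f1 ?f2.
  - by move/enum_val_inj/perm_inj ->.
  - by move/ne.
  - by move/esym/ne.
  by move/enum_val_inj/perm_inj ->.
by exists (perm f_inj); split=> a; rewrite permE.
Qed.

Lemma intertwines_stable U s (t : 'S_#|U|) : intertwines s t -> s @: U = U.
Proof.
move=> st; apply/eqP; rewrite eqEcard (card_imset _ (@perm_inj _ s)) leqnn andbT.
apply/subsetP => _ /imsetP[x xU ->]; rewrite -[x](enum_rankK_in xU) // st; exact: enum_valP.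
Qed.

End StabilizerSum.

Section ExponentialSums.
Variable B : comNzRingType.
Implicit Types (y : nat -> B) (n k : nat).

Definition hsum n y : B := \sum_(s : 'S_n) \prod_(c in porbits s) y #|c|.

Lemma prod_intertwines n (U : {set 'I_n}) (s : 'S_n) (t : 'S_#|U|) y : intertwines s t ->
  \prod_(c in cyclesin s U) y #|c| = \prod_(c in porbits t) y #|c|.
Proof.
move=> st; rewrite (intertwines_cycles st) big_imset => [|c d _ _ /imset_inj]; last first.
  by apply; apply: enum_val_inj.
by apply: eq_bigr => c _; rewrite card_imset //; apply: enum_val_inj.
Qed.

(** The stabilizer of [U] is the product of the symmetric groups of [U] and of its complement. *)
Lemma hsum_stabilizer n (U : {set 'I_n}) y1 y2 :
  \sum_(s : 'S_n | s @: U == U)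
     (\prod_(c in cyclesin s U) y1 #|c|) * (\prod_(c in cyclesin s (~: U)) y2 #|c|) =
  hsum #|U| y1 * hsum #|~: U| y2.
Proof.
rewrite /hsum big_distrlr /= pair_big /=.
pose g (t : 'S_#|U| * 'S_#|~: U|) := projT1 (cid (ex_glue t.1 t.2)).
have gP t : intertwines (g t) t.1 /\ intertwines (g t) t.2 by rewrite /g; case: cid.
have int_inj (V : {set 'I_n}) s (t t' : 'S_#|V|) : intertwines s t -> intertwines s t' -> t = t'.
  by move=> st st'; apply/permP => a; apply: enum_val_inj; rewrite -st st'.
have g_inj : injective g.
  move=> t t' tt'; have [[a b] [c d]] := (gP t, gP t'); rewrite -tt' in c d.
  by rewrite [t]surjective_pairing [t']surjective_pairing (int_inj _ _ _ _ a c) (int_inj _ _ _ _ b d).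
transitivity (\sum_(s in g @: setT)
     (\prod_(c in cyclesin s U) y1 #|c|) * (\prod_(c in cyclesin s (~: U)) y2 #|c|)).
  apply: eq_bigl => s; apply/eqP/imsetP => [sU|[t _ ->]]; last exact: intertwines_stable (gP t).1.
  have sU' : s @: (~: U) = ~: U by rewrite -setTD stableD // setT_stable.
  have [[t1 h1] [t2 h2]] := (ex_restriction sU, ex_restriction sU').
  exists (t1, t2) => //; have [k1 k2] := gP (t1, t2); apply/permP => x.
  have [xU|xU] := boolP (x \in U); first by rewrite -[x](enum_rankK_in xU) // h1 k1.
  have {}xU : x \in ~: U by rewrite inE.
  by rewrite -[x](enum_rankK_in xU) // h2 k2.
rewrite big_imset /= => [|? ? _ _ /g_inj //]; apply: eq_big => [t|t _]; first by rewrite inE.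
by have [k1 k2] := gP t; rewrite (prod_intertwines _ k1) (prod_intertwines _ k2).
Qed.

(** Expanding the product over cycles amounts to choosing the union [U] of the cycles that carry
    [y1]. Exchanging the sums leaves, for each [U], a sum over its stabilizer. *)
Lemma hsumD n y1 y2 : hsum n (fun j => y1 j + y2 j) =
  \sum_(k < n.+1) (hsum k y1 * hsum (n - k) y2) *+ 'C(n, k).
Proof.
transitivity (\sum_(U : {set 'I_n}) hsum #|U| y1 * hsum #|~: U| y2).
  under [RHS]eq_bigr do rewrite -hsum_stabilizer.
  rewrite (exchange_big_dep xpredT) //=; apply: eq_bigr => s _.
  pose f U := (\prod_(c in cyclesin s U) y1 #|c|) * (\prod_(c in cyclesin s (~: U)) y2 #|c|).
  transitivity (\sum_(U : {set 'I_n} | (U \subset setT) && (s @: U == U)) f U); last first.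
    by apply: eq_bigl => U; rewrite subsetT.
  rewrite (sum_stable f (setT_stable s)) cyclesinT prodD_subsets; apply: eq_bigr => X XP.
  rewrite /f cyclesin_cover // -setTD cyclesinD ?setT_stable ?cover_stable // cyclesinT.
  by rewrite cyclesin_cover.
rewrite (partition_big (fun U : {set 'I_n} => inord #|U| : 'I_n.+1) xpredT) //=.
apply: eq_bigr => k _.
have Uk (U : {set 'I_n}) : (inord #|U| == k) = (#|U| == k).
  by rewrite -val_eqE /= inordK // ltnS -[X in (_ <= X)%N](card_ord n) max_card.
transitivity (\sum_(U in [set A : {set 'I_n} | #|A| == k]) hsum k y1 * hsum (n - k) y2).
  apply: eq_big => [U|U]; first by rewrite Uk inE.
  rewrite Uk => /eqP Uk'; have -> : #|~: U| = (n - k)%N by rewrite cardsCs setCK card_ord Uk'.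
  by rewrite Uk'.
by rewrite sumr_const card_draws card_ord.
Qed.

Lemma eq_hsum n y1 y2 : (forall j, (0 < j)%N -> y1 j = y2 j) -> hsum n y1 = hsum n y2.
Proof.
move=> y12; apply: eq_bigr => s _; apply: eq_bigr => c /imsetP[i _ ->].
by apply: y12; apply/card_gt0P; exists i; apply: porbit_id.
Qed.

Lemma hsum_scale n x y : hsum n (fun j => x ^+ j * y j) = x ^+ n * hsum n y.
Proof.
rewrite /hsum mulr_sumr; apply: eq_bigr => s _; rewrite big_split /=; congr (_ * _).
rewrite -expr_sum; congr (_ ^+ _); rewrite -cyclesinT (card_cyclesin (setT_stable s)).
by rewrite cardsT card_ord.
Qed.

End ExponentialSums.

Section ExponentialSeries.
Variables (B : comNzRingType) (kappa : nat -> B).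
Hypothesis kappaE : forall n, kappa n * n`!%:R = 1.
Implicit Types (y : nat -> B).

(** With [kappa n] the inverse of $n!$, this is $\exp(\sum_{j>0}y_jz^j/j)$; [HsD] is the functional
    equation of the exponential. *)
Definition Hs y : fps B := Fps (fun n => kappa n * hsum n y).

Lemma HsD y1 y2 : Hs (fun j => y1 j + y2 j) = Hs y1 * Hs y2.
Proof.
apply: fpsP => n; rewrite fps_coefM /= hsumD mulr_sumr; apply: eq_bigr => k _.
have kn : (k <= n)%N by rewrite -ltnS.
have -> : kappa k * hsum k y1 * (kappa (n - k)%N * hsum (n - k) y2) =
   (kappa n * n`!%:R) * (kappa k * kappa (n - k)%N) * (hsum k y1 * hsum (n - k) y2).
  by rewrite kappaE mul1r mulrACA.
rewrite -(bin_fact kn) !natrM -[X in _ * X *+ _]mulr1 -mulrnAr -mulr_natr.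
have := kappaE k; have := kappaE (n - k)%N; set f1 := _%:R; set f2 := _%:R => e1 e2.
transitivity (kappa n * ('C(n, k)%:R * ((kappa k * f2) * (kappa (n - k)%N * f1))) * (hsum k y1 * hsum (n - k) y2)).
  by rewrite e1 e2 !mulr1; ring.
ring.
Qed.

Lemma Hs0 : Hs (fun=> 0) = 1.
Proof.
apply: fpsP => n; rewrite fps_coef1 /=; case: n => [|n] /=.
  rewrite -[RHS](kappaE 0) /hsum (big_pred1 1%g) => [|s]; last first.
    by rewrite /= [in RHS]eq_sym; apply/esym/eqP/permP => -[].
  by rewrite big1 // => c /imsetP[[]].
rewrite /hsum big1 ?mulr0 // => s _; apply/eqP.
by rewrite (bigD1 (porbit s ord0)) ?imset_f //= mul0r.
Qed.

Lemma HsMn k y : Hs (fun j => k%:R * y j) = Hs y ^+ k.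
Proof.
elim: k => [|k IHk]; first by rewrite expr0 -Hs0; congr Hs; apply: funext => j; rewrite mul0r.
rewrite exprS -IHk -HsD; congr Hs; apply: funext => j.
by rewrite mulrS mulrDl mul1r.
Qed.

Lemma HsNK y : Hs (fun j => - y j) * Hs y = 1.
Proof. by rewrite -HsD -Hs0; congr Hs; apply: funext => j; rewrite addNr. Qed.

Lemma Hs_scale x y : Hs (fun j => x ^+ j * y j) = Fps (fun n => x ^+ n * fps_coef (Hs y) n).
Proof. by apply: fpsP => n /=; rewrite hsum_scale mulrCA. Qed.

Lemma Hs1 : Hs (fun=> 1) = Fps (fun=> 1).
Proof.
apply: fpsP => n /=; rewrite -(kappaE n) /hsum; congr (_ * _).
under eq_bigr do rewrite big1 //.
by rewrite sumr_const card_Sn.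
Qed.

End ExponentialSeries.

(** * Power sums and complete homogeneous symmetric functions *)

Section FpsMap.
Variables (A A' : comNzRingType) (phi : {rmorphism A -> A'}).

Definition fmap (f : fps A) : fps A' := Fps (fun i => phi (fps_coef f i)).

Lemma fmap_is_zmod : zmod_morphism fmap.
Proof. by move=> f g; apply: fpsP => i /=; rewrite rmorphB. Qed.
Lemma fmap_is_monoid : monoid_morphism fmap.
Proof.
split; first by apply: fpsP => -[|i] /=; rewrite ?rmorph1 ?rmorph0.
by move=> f g; apply: fpsP => i /=; rewrite rmorph_sum; apply: eq_bigr => j _; rewrite rmorphM.
Qed.
HB.instance Definition _ := GRing.isZmodMorphism.Build (fps A) (fps A') fmap fmap_is_zmod.
HB.instance Definition _ := GRing.isMonoidMorphism.Build (fps A) (fps A') fmap fmap_is_monoid.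

Lemma fmap_inj : injective phi -> injective fmap.
Proof.
by move=> phi_inj f g fg; apply: fpsP => i; apply: phi_inj; have := congr1 (fun h => fps_coef h i) fg.
Qed.

Lemma hsum_morph n (y : nat -> A) : phi (hsum n y) = hsum n (fun j => phi (y j)).
Proof. by rewrite rmorph_sum; apply: eq_bigr => s _; rewrite rmorph_prod. Qed.

End FpsMap.

Lemma fps_lreg (A : comNzRingType) (f : fps A) : GRing.lreg (fps_coef f 0) -> GRing.lreg f.
Proof.
move=> f0 g h fgh; apply: fpsP => n; have [m] := ubnP n; elim: m n => // m IHm n; rewrite ltnS => nm.
have := congr1 (fun u => fps_coef u n) fgh; rewrite !fps_coefM !big_ord_recl !subn0.
rewrite [X in _ + X = _](eq_bigr (fun i : 'I_n => fps_coef f (lift ord0 i) * fps_coef h (n - lift ord0 i)%N)).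
  by move/addIr/f0.
by move=> i _; rewrite IHm // lift0; have := ltn_ord i; lia.
Qed.

Section PowerSums.
Variable F : fieldType.
Hypothesis F0 : [pchar F] =i pred0.

Definition kap (A : lalgType F) n : A := (n`!%:R^-1 : F)%:A.

Lemma natf_neq0 n : (0 < n)%N -> n%:R != 0 :> F.
Proof. by rewrite ((pcharf0P F).1 F0) lt0n. Qed.

Lemma kapE (A : lalgType F) n : kap A n * n`!%:R = 1.
Proof.
rewrite /kap -[n`!%:R in X in _ * X](scaler_nat n`! 1) -scalerAl mul1r scalerA mulVf ?scale1r //.
by rewrite natf_neq0 ?fact_gt0.
Qed.

Definition evN N (f : symfun F) : {mpoly F[N]} := sf_val f N.
Lemma evN_is_zmod N : zmod_morphism (@evN N).
Proof. by move=> f g; rewrite /evN /= scaleN1r. Qed.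
Lemma evN_is_monoid N : monoid_morphism (@evN N).
Proof. by split. Qed.
HB.instance Definition _ N := GRing.isZmodMorphism.Build (symfun F) {mpoly F[N]} (@evN N) (@evN_is_zmod N).
HB.instance Definition _ N := GRing.isMonoidMorphism.Build (symfun F) {mpoly F[N]} (@evN N) (@evN_is_monoid N).

Lemma prod_geometric N n :
  fps_coef (\prod_(i < N) Fps (fun k => 'X_i ^+ k : {mpoly F[N]})) n = sf_val (sf_h F n) N.
Proof.
pose g (i : 'I_N) : {poly {mpoly F[N]}} := \sum_(k < n.+1) ('X_i)%:P ^+ k * 'X^k.
have ag (r : seq 'I_N) : agree n.+1 (\prod_(i <- r) Fps (fun k => 'X_i ^+ k : {mpoly F[N]})) (\prod_(i <- r) pser (g i)).
  elim: r => [|i r IHr]; first by rewrite !big_nil.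
  rewrite !big_cons => d dn; rewrite (agree_mul _ IHr) // mulrC [in RHS]mulrC.
  apply: agree_mul dn => e en; rewrite /= /g coef_sum (bigD1 (Ordinal en)) //= big1 => [|k ke].
    by rewrite -polyC_exp coefCM coefXn eqxx mulr1 addr0.
  rewrite -polyC_exp coefCM coefXn; case: eqP => [ek|]; last by rewrite mulr0.
  by case/eqP: ke; apply: val_inj; rewrite /= ek.
rewrite ag // -rmorph_prod /= /g bigA_distr_bigA /= coef_sum.
have tm (f : {ffun 'I_N -> 'I_n.+1}) : (\prod_(i < N) (('X_i : {mpoly F[N]})%:P ^+ f i * 'X^(f i)))`_n =
    if (\sum_i f i == n)%N then 'X_[[multinom (f i : nat) | i < N]] else 0.
  rewrite big_split /= prodrXr; under eq_bigr do rewrite -polyC_exp.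
  rewrite -rmorph_prod coefCM coefXn eq_sym mpolyXE_id.
  case: eqP => _; rewrite ?mulr0 ?mulr1 //.
  by apply: eq_bigr => i _; rewrite mnmE.
rewrite (eq_bigr _ (fun f _ => tm f)).
apply/mpolyP => m; rewrite sf_h_coef raddf_sum /=.
have fm (f : {ffun 'I_N -> 'I_n.+1}) : mdeg [multinom (f i : nat) | i < N] = (\sum_i f i)%N.
  by rewrite mdegE; apply: eq_bigr => i _; rewrite mnmE.
have [md|md] := eqVneq (mdeg m) n; last first.
  rewrite big1 // => f _; case: eqP => fn; last by rewrite mcoeff0.
  by rewrite mcoeffX; case: eqP => // e; rewrite -e fm fn eqxx in md.
have mi i : (m i < n.+1)%N by rewrite ltnS -md mdegE (bigD1 i) //= leq_addr.
pose f0 : {ffun 'I_N -> 'I_n.+1} := [ffun i => Ordinal (mi i)].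
have f0m : [multinom (f0 i : nat) | i < N] = m by apply/mnmP => i; rewrite mnmE ffunE.
rewrite (bigD1 f0) //= -fm f0m md eqxx mcoeffX eqxx big1 ?addr0 // => f ff0.
case: eqP => _; last by rewrite mcoeff0.
rewrite mcoeffX; case: eqP => // /mnmP e; case/eqP: ff0; apply/ffunP => i; apply: val_inj.
by rewrite ffunE /= -(e i) mnmE.
Qed.

(** In finitely many variables the exponential of $\sum_ix_i^j$ factors into the geometric series
    $1/(1-x_iz)$, whose product generates the $h_n$ by [prod_geometric]. *)
Lemma hsum_power_sums n : hsum n (fun j => sf_pS F j.-1) = n`!%:R * sf_h F n.
Proof.
apply: symfunP => N; change (evN N (hsum n (fun j => sf_pS F j.-1)) = evN N (n`!%:R * sf_h F n)).
rewrite [RHS]rmorphM rmorph_nat hsum_morph.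
have pE j : (0 < j)%N -> evN N (sf_pS F j.-1) = \sum_(i < N) 'X_i ^+ j.
  by case: j.
rewrite (eq_hsum _ pE) {pE}.
suff hE : evN N (sf_h F n) = fps_coef (Hs (kap {mpoly F[N]}) (fun j => \sum_(i < N) 'X_i ^+ j)) n.
  by rewrite [X in _ = _ * X]hE /= mulrA [n`!%:R * _]mulrC kapE mul1r.
rewrite -[LHS]prod_geometric; congr (fps_coef _ n); apply/esym.
elim: (index_enum _) => [|i r IHr].
  rewrite big_nil -(Hs0 (kapE {mpoly F[N]})); congr Hs; apply: funext => j; exact: big_nil.
rewrite big_cons -IHr.
have -> : Fps (fun k => 'X_i ^+ k : {mpoly F[N]}) = Hs (kap {mpoly F[N]}) (fun j => 'X_i ^+ j * 1).
  by rewrite Hs_scale (Hs1 (kapE _)); apply: fpsP => k /=; rewrite mulr1.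
rewrite -(HsD (kapE _)); congr Hs; apply: funext => j; by rewrite big_cons mulr1.
Qed.

End PowerSums.

(** * Summation of the geometric series in t *)

Section TelescopingIdentity.
Variable C : comNzRingType.

(* With [q = t U^2] the sum is [(U - 1) V] times a geometric series, and
   [a^2 - t b^2 = a^2 (1 - q)]. *)
Lemma geometric_identity (t U V a b : C) D : U * a = b ->
  (\sum_(d < D) t ^+ d * (U ^+ d.*2.+1 * V - U ^+ d.*2 * V) + V) * (a ^+ 2 - t * b ^+ 2) =
  V * b * (a - t * b) - t ^+ D * (U ^+ D.*2 * (U - 1) * V * a ^+ 2).
Proof.
move=> <-; elim: D => [|D IHD]; first by rewrite big_ord0 double0 !expr0; ring.
rewrite big_ord_recr /= -addrA addrCA mulrDl {}IHD doubleS !exprS.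
set u := U ^+ D.*2; set w := t ^+ D; ring.
Qed.

End TelescopingIdentity.

Section SeriesIdentity.
Variable A : comNzRingType.
Local Notation B := (fps A).
Local Notation x := (pser 'X : B).
Local Notation t := (pser (x%:P) : fps B).

Lemma coef_tXM d (f : fps B) n : fps_coef (t ^+ d * f) n = x ^+ d * fps_coef f n.
Proof. by rewrite -(rmorphXn (@pser B)) -polyC_exp fps_coefCM. Qed.

(** [CH] is known only $t$-adically. For the coefficient of $z^nt^i$ the partial sum with [D = i.+1]
    is exact, and its remainder is divisible by $t^{i+1}$. *)
Lemma series_identity (CH U V a b : fps B) : U * a = b ->
    (forall n D, agree D (fps_coef CH n)
       (fps_coef (\sum_(d < D) t ^+ d * (U ^+ d.*2.+1 * V - U ^+ d.*2 * V) + V) n)) ->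
  CH * (a ^+ 2 - t * b ^+ 2) = V * b * (a - t * b).
Proof.
move=> Uab CHE; apply: fpsP => n; apply: fpsP => i.
have := geometric_identity t V i.+1 Uab; set G := _ + V; set Q := _ - t * _ => GQ.
transitivity (fps_coef (fps_coef (G * Q) n) i).
  rewrite !(fps_coefM _ Q n) !fps_coef_sum; apply: eq_bigr => j _; rewrite ![_ * fps_coef Q _]mulrC.
  exact: (agree_mul _ (CHE j i.+1)).
by rewrite GQ (fps_coefB _ _ n) (fps_coefB _ _ i) coef_tXM fps_coefXnM ltnn subr0.
Qed.

End SeriesIdentity.

(** * Generating functions of Frobenius characteristics *)

Section Characteristic.
Variable F : fieldType.
Hypothesis F0 : [pchar F] =i pred0.
Local Notation A := (symfun F).
Local Notation B := (fps A).
Local Notation x := (pser 'X : B).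
Local Notation cA a := (pser (a%:P) : B).
Local Notation emb := (fmap (in_alg A)).

Definition kapB n : B := cA (kap A n).
Lemma kapBE n : kapB n * n`!%:R = 1.
Proof.
rewrite /kapB -[n`!%:R](rmorph_nat (@pser A)) -rmorphM -[n`!%:R](rmorph_nat (@polyC A)) -rmorphM.
by rewrite (kapE F0) !rmorph1.
Qed.

Definition psum j : B := cA (sf_pS F j.-1).

(** The characteristic of a class function whose values are series in $t$. In the type [fps B] the
    outer variable is $z$ and the inner one $t$. *)
Definition chs n (g : 'S_n -> fps F) : B :=
  kapB n * \sum_(s : 'S_n) emb (g s) * cA (sf_p_cycle F s).

Lemma chs_coef n (g : 'S_n -> fps F) i :
  fps_coef (chs g) i = (n`!%:R)^-1 *: \sum_(s : 'S_n) fps_coef (g s) i *: sf_p_cycle F s.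
Proof.
rewrite fps_coefCM /kap mulr_algl fps_coef_sum; congr (_ *: _); apply: eq_bigr => s _.
by rewrite mulrC fps_coefCM mulrC /= mulr_algl.
Qed.

Lemma chs_prod n (w : nat -> fps F) : chs (fun s : 'S_n => \prod_(c in porbits s) w #|c|) =
  fps_coef (Hs kapB (fun j => emb (w j) * psum j)) n.
Proof.
rewrite /chs /=; congr (_ * _); apply: eq_bigr => s _.
rewrite rmorph_prod /sf_p_cycle [X in _ * pser X]rmorph_prod [X in _ * X]rmorph_prod -big_split /=.
by apply: eq_bigr.
Qed.

Lemma eq_chs n (g h : 'S_n -> fps F) : (forall s, g s = h s) -> chs g = chs h.
Proof. by move=> gh; rewrite /chs; congr (_ * _); apply: eq_bigr => s _; rewrite gh. Qed.

Lemma chsD n (g h : 'S_n -> fps F) : chs (fun s => g s + h s) = chs g + chs h.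
Proof.
rewrite /chs -mulrDr -big_split /=; congr (_ * _); apply: eq_bigr => s _.
by rewrite rmorphD mulrDl.
Qed.

Lemma chsB n (g h : 'S_n -> fps F) : chs (fun s => g s - h s) = chs g - chs h.
Proof.
rewrite /chs -mulrBr -sumrB; congr (_ * _); apply: eq_bigr => s _.
by rewrite rmorphB mulrBl.
Qed.

Lemma chsM n f (g : 'S_n -> fps F) : chs (fun s => f * g s) = emb f * chs g.
Proof.
rewrite /chs [RHS]mulrCA [X in _ = _ * X]mulr_sumr; congr (_ * _); apply: eq_bigr => s _.
by rewrite rmorphM mulrA.
Qed.

Lemma chs_sum n (I : Type) (r : seq I) (g : I -> 'S_n -> fps F) :
  chs (fun s => \sum_(i <- r) g i s) = \sum_(i <- r) chs (g i).
Proof.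
elim: r => [|i r IHr].
  rewrite big_nil /chs big1 ?mulr0 // => s _; by rewrite big_nil rmorph0 mul0r.
by rewrite big_cons -IHr -chsD; apply: eq_chs => s; rewrite big_cons.
Qed.

Lemma emb_pserX k : emb (pser 'X^k) = x ^+ k.
Proof. by apply: fpsP => i; rewrite -rmorphXn /= !coefXn; case: (i == k); rewrite ?scale1r ?scale0r. Qed.

Definition Useries : fps B := Hs kapB (fun j => (1 - x ^+ j) * psum j).
Definition Vseries (z : fps F) : fps B := Hs kapB (fun j => emb z * psum j).
Definition aseries : fps B := Hs kapB (fun j => x ^+ j * psum j).
Definition bseries : fps B := Hs kapB psum.
Local Notation t := (pser (x%:P) : fps B).

Lemma Ua_b : Useries * aseries = bseries.
Proof.
rewrite -(HsD kapBE); congr Hs; apply: funext => j.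
by rewrite -mulrDl subrK mul1r.
Qed.

Lemma UkV k z : Useries ^+ k * Vseries z =
  Hs kapB (fun j => emb (k%:R * pser (1 - 'X^j) + z) * psum j).
Proof.
rewrite -(HsMn kapBE) -(HsD kapBE); congr Hs; apply: funext => j.
have e1 : emb (pser (1 - 'X^j)) = 1 - x ^+ j.
  rewrite (rmorphB (@pser F)) (rmorph1 (@pser F)) (rmorphB emb) (rmorph1 emb).
  by congr (_ - _); exact: emb_pserX.
by rewrite (rmorphD emb) (rmorphM emb) (rmorph_nat emb) [RHS]mulrDl -[X in _ = X + _]mulrA; congr (_ * (_ * _) + _); exact: esym e1.
Qed.

Definition Gseries D z : fps B :=
  \sum_(d < D) t ^+ d * (Useries ^+ d.*2.+1 * Vseries z - Useries ^+ d.*2 * Vseries z) + Vseries z.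

Lemma chs_expl n D z : chs (fun s : 'S_n => expl s D z setT) = fps_coef (Gseries D z) n.
Proof.
rewrite chsD fps_coefD; congr (_ + _); last first.
  by rewrite -chs_prod; apply: eq_chs => s; rewrite cyclesinT.
rewrite chs_sum fps_coef_sum; apply: eq_bigr => d _.
rewrite chsM chsB emb_pserX coef_tXM fps_coefB; congr (_ * (_ - _)).
  by rewrite UkV -chs_prod; apply: eq_chs => s; rewrite cyclesinT.
by rewrite UkV -chs_prod; apply: eq_chs => s; rewrite cyclesinT.
Qed.

Lemma fmap_Hz : fmap (@pser A) (Hz F) = bseries.
Proof.
apply: fpsP => n /=; have := hsum_morph (@pser A \o @polyC A) n (fun j => sf_pS F j.-1).
rewrite /= -/(psum _) => <-; rewrite (hsum_power_sums F0) /= !rmorphM /= mulrA.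
by rewrite (rmorph_nat (@polyC A)) (rmorph_nat (@pser A)) kapBE mul1r.
Qed.

Lemma fmap_Htz : fmap (@pser A) (Htz F) = aseries.
Proof.
rewrite /aseries Hs_scale -/bseries -fmap_Hz; apply: fpsP => n /=.
by rewrite -mul_polyC mulrC rmorphM rmorphXn.
Qed.

Lemma fmap_t : fmap (@pser A) (fpsC 'X) = t.
Proof. by apply: fpsP => -[|n] /=; rewrite coefC ?rmorph0. Qed.

Lemma ch_gf_identity (V : forall n, nat -> representation F [set: 'S_n]) z :
    (forall n i s, (n < i)%N -> \tr (V n i s) = 0) ->
    (forall n D i s, (i < D)%N -> \tr (V n i s) = fps_coef (expl s D z setT) i) ->
  fmap (@pser A) (ch_gf V) * (aseries ^+ 2 - t * bseries ^+ 2) =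
  Vseries z * bseries * (aseries - t * bseries).
Proof.
move=> Vn VE; apply: series_identity Ua_b _ => n D i iD; rewrite -/(Gseries D z).
 rewrite -chs_expl; case: n => [|n].
    (* The constant term of [ch_gf] is 1 by convention; for [n = 0] the products in [expl] are empty
       and give the same value. *)
    have e1 (s : 'S_0) : expl s D z setT = \prod_(c in porbits s) 0.
      have e0 (f : {set 'I_0} -> fps F) : \prod_(c in cyclesin s setT) f c = 1.
        by rewrite big1 // cyclesinT => c /imsetP[[]].
      rewrite -cyclesinT /expl !e0 big1 ?add0r // => d _.
      by rewrite !e0 subrr mulr0.
    rewrite (eq_chs e1) (chs_prod 0 (fun=> 0)).
    have -> : (fun j => emb 0 * psum j) = (fun=> 0) by apply: funext => j; rewrite rmorph0 mul0r.
    rewrite (Hs0 kapBE) /=; by case: i iD => [|i] _; rewrite coef1.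
  (* [ch_gf] stops at degree [n]; beyond it the hypothesis [Vn] makes the other side vanish too. *)
  rewrite chs_coef [LHS]/= coef_sum; have [ni|ni] := ltnP n.+1 i.
    rewrite big1 => [|j _]; last first.
      by rewrite coefZ coefXn; case: eqP => [ij|_]; rewrite ?mulr0 //; have := ltn_ord j; rewrite -ij ltnS leqNgt ni.
    rewrite big1 ?scaler0 // => s _; by rewrite -(VE _ _ _ _ iD) Vn ?scale0r.
  have i2 : (i < n.+2)%N by [].
  rewrite (bigD1 (Ordinal i2)) //= coefZ coefXn eqxx mulr1 big1 ?addr0; last first.
    move=> j ji; rewrite coefZ coefXn; case: eqP => [ij|]; last by rewrite mulr0.
    by case/eqP: ji; apply: val_inj; rewrite /= ij.
  by congr (_ *: _); apply: eq_bigr => s _; rewrite (VE _ _ _ _ iD).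
Qed.

End Characteristic.

(** * The refined series in q as a sum over flags of stable subsets *)

Section Bits.

Fixpoint bits l : seq bitseq :=
  if l is l'.+1 then map (cons false) (bits l') ++ map (cons true) (bits l') else [:: [::]].

Lemma mem_bits l r : (r \in bits l) = (size r == l).
Proof.
elim: l r => [|l IHl] [|b r]; rewrite ?inE //= mem_cat.
  by apply/negP => /orP[] /mapP[].
have mc (c : bool) : (b :: r \in map (cons c) (bits l)) = (b == c) && (r \in bits l).
  apply/mapP/andP => [[r' rl [-> ->]]|[/eqP -> rl]]; first by rewrite eqxx.
  by exists r.
by rewrite !mc IHl eqSS; case: b {mc} => /=; rewrite ?orbF.
Qed.

Lemma bits_uniq l : uniq (bits l).
Proof.
elim: l => //= l IHl; rewrite cat_uniq !map_inj_uniq ?IHl /= ?andbT; try by move=> ? ? [].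
by apply/hasPn => _ /mapP[r _ ->]; apply/negP => /mapP[].
Qed.

Lemma big_bitsS (A : nmodType) l (f : bitseq -> A) :
  \sum_(r <- bits l.+1) f r = \sum_(r <- bits l) (f (false :: r) + f (true :: r)).
Proof. by rewrite /= big_cat !big_map big_split. Qed.

End Bits.

Section StableFlags.
Variables (A : comNzRingType) (q : A) (n : nat) (s : 'S_n).
Hypothesis reg : GRing.lreg (1 - q).
Implicit Types (U V W : {set 'I_n}) (r : bitseq) (l m D : nat).
Local Notation t := (q ^+ 2).

(* The pair consists of the value of the product of the [beta] of the blocks
   closed so far, times that of the current block, and of the former alone. *)
Definition mstep (b : bool) (x : A * A) : A * A :=
  if b then (q * x.1, x.1) else (t * x.1 + (q + t) * x.2, x.2).
Definition mrun r : A * A := foldr mstep (q, 1) r.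

(* [beta m = q + q^2 + ... + q^(2m - 1)] for [m > 0]. *)
Fixpoint beta m : A := if m is m'.+1 then t * beta m' + (q + t) else -1.

Lemma betaE m : (1 - q) * beta m = q - t ^+ m.
Proof.
elim: m => [|m IHm] /=; first by rewrite expr0; ring.
rewrite mulrDr mulrCA IHm [t ^+ m.+1]exprS; move: (t ^+ m) => T; ring.
Qed.

(* The number of [s]-stable flags of subsets of [W] with prescribed cardinals. *)
Fixpoint nflags r W : nat :=
  if r is b :: r' then
    if b then (\sum_(U : {set 'I_n} | [&& U \subset W, s @: U == U & #|U| == (size r').+1]) nflags r' U)%N
    else nflags r' W
  else 1%N.

(** The contribution of [W] to $1/(1-\sum_{m>0}\beta_mh_mz^m)$. A bit string encodes a composition
    of the size of [W]; [mrun] multiplies the $\beta$ of its blocks, and [nflags] is the value at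
    [s] of the corresponding product of $h$'s. *)
Definition flagsum W : A :=
  if W == set0 then 1 else \sum_(r <- bits #|W|.-1) (mrun r).1 * (nflags r W)%:R.

Lemma flagsum_machine l W :
  \sum_(r <- bits l) (mrun r).1 * (nflags r W)%:R =
    \sum_(U : {set 'I_n} | [&& U \subset W, s @: U == U & (#|U| <= l)%N]) flagsum U * beta (l.+1 - #|U|) /\
  \sum_(r <- bits l) (mrun r).2 * (nflags r W)%:R =
    \sum_(U : {set 'I_n} | [&& U \subset W, s @: U == U & (#|U| <= l)%N]) flagsum U.
Proof.
elim: l => [|l [IH1 IH2]].
  have E U : [&& U \subset W, s @: U == U & (#|U| <= 0)%N] = (U == set0).
    rewrite leqn0 cards_eq0; have [->|_] := eqVneq U set0; last by rewrite !andbF.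
    by rewrite sub0set imset0 eqxx.
  rewrite !(eq_bigl _ _ E) !big_pred1_eq !big_seq1 /= /flagsum eqxx cards0 /=; split; ring.
have sp (f : {set 'I_n} -> A) :
    \sum_(U : {set 'I_n} | [&& U \subset W, s @: U == U & (#|U| <= l.+1)%N]) f U =
    \sum_(U : {set 'I_n} | [&& U \subset W, s @: U == U & (#|U| <= l)%N]) f U +
    \sum_(U : {set 'I_n} | [&& U \subset W, s @: U == U & #|U| == l.+1]) f U.
  rewrite (bigID (fun U : {set 'I_n} => (#|U| <= l)%N)) /=; congr (_ + _); apply: eq_bigl => U.
    by case: (U \subset W) => //=; case: (s @: U == U) => //=; lia.
  by case: (U \subset W) => //=; case: (s @: U == U) => //=; lia.
have tr_ (g : bitseq -> A) : \sum_(r <- bits l) g r * (nflags (true :: r) W)%:R =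
    \sum_(U : {set 'I_n} | [&& U \subset W, s @: U == U & #|U| == l.+1])
      \sum_(r <- bits l) g r * (nflags r U)%:R.
  rewrite exchange_big /=; apply: eq_big_seq => r; rewrite mem_bits => /eqP <-.
  by rewrite natr_sum mulr_sumr.
have fl (U : {set 'I_n}) : #|U| == l.+1 -> flagsum U = \sum_(r <- bits l) (mrun r).1 * (nflags r U)%:R.
  by move=> /eqP Ul; rewrite /flagsum -cards_eq0 Ul.
rewrite !big_bitsS !sp; split.
  have -> : \sum_(r <- bits l) ((mrun (false :: r)).1 * (nflags (false :: r) W)%:R +
        (mrun (true :: r)).1 * (nflags (true :: r) W)%:R) =
      t * \sum_(r <- bits l) (mrun r).1 * (nflags r W)%:R +
      (q + t) * (\sum_(r <- bits l) (mrun r).2 * (nflags r W)%:R) +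
      q * \sum_(r <- bits l) (mrun r).1 * (nflags (true :: r) W)%:R.
    rewrite !mulr_sumr -!big_split; apply: eq_bigr => r _ /=; ring.
  rewrite IH1 IH2 tr_; congr (_ + _).
    rewrite !mulr_sumr -big_split; apply: eq_bigr => U /and3P[_ _ Ul].
    by rewrite (subSn (leqW Ul)) /=; ring.
  rewrite mulr_sumr; apply: eq_bigr => U /and3P[_ _ Ul].
  rewrite -(fl U Ul) (eqP Ul) subSn // subnn /=; ring.
have -> : \sum_(r <- bits l) ((mrun (false :: r)).2 * (nflags (false :: r) W)%:R +
        (mrun (true :: r)).2 * (nflags (true :: r) W)%:R) =
      \sum_(r <- bits l) (mrun r).2 * (nflags r W)%:R +
      \sum_(r <- bits l) (mrun r).1 * (nflags (true :: r) W)%:R.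
  by rewrite -big_split; apply: eq_bigr => r _ /=.
rewrite IH2 tr_; congr (_ + _); apply: eq_bigr => U /and3P[_ _ Ul].
by rewrite (fl U Ul).
Qed.

(** The value [beta 0 = -1] turns the recursion for [flagsum W] over proper stable subsets into a
    vanishing convolution. *)
Lemma flagsum_rec W : s @: W = W ->
  \sum_(U : {set 'I_n} | (U \subset W) && (s @: U == U)) flagsum U * beta (#|W| - #|U|) =
  - (W == set0)%:R.
Proof.
move=> sW; rewrite (bigD1 W) /=; last by rewrite subxx sW eqxx.
rewrite subnn /=; have [->|W0] := eqVneq W set0.
  rewrite /flagsum eqxx big1 => [|U /andP[/andP[]]]; first by rewrite mul1r addr0.
  by rewrite subset0 => ->.
rewrite {1}/flagsum (negbTE W0) (flagsum_machine _ W).1.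
have W1 : #|W|.-1.+1 = #|W| by rewrite prednK // lt0n cards_eq0.
rewrite W1 mulrN1 addrC oppr0; apply/eqP; rewrite subr_eq0; apply/eqP.
apply: eq_bigl => U; case: (boolP (U \subset W)) => UW //=; case: (s @: U == U) => //=.
by rewrite -ltnS W1 eqEcard UW -ltnNge.
Qed.

Definition xq (c : {set 'I_n}) : A := 1 - t ^+ #|c|.
(** The truncation at $q^D$ of the contribution of [W] to $(1-q)/(H(q^2z)-qH(z))=(1-q)\sum_e
    q^eU^{e+1}/H(z)$, where $U=H(z)/H(q^2z)$. *)
Definition gser D W : A :=
  (1 - q) * \sum_(e < D) q ^+ e * \prod_(c in cyclesin s W) (e.+1%:R * xq c - 1).

(** After multiplication by $1-q$, [beta] becomes $q-t^m$. Each of the two terms distributes over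
    cycles, turning the factor $(e+1)x_c-1$ into $(e+1)x_c$ and $ex_c$ respectively, so the sum over
    $e$ telescopes. *)
Lemma gser_rec D W : s @: W = W ->
  \sum_(U : {set 'I_n} | (U \subset W) && (s @: U == U)) gser D U * beta (#|W| - #|U|) =
  - (W == set0)%:R + q ^+ D * \prod_(c in cyclesin s W) (D%:R * xq c).
Proof.
move=> sW; apply: reg; rewrite mulr_sumr.
pose f e := \prod_(c in cyclesin s W) (e%:R * xq c).
have pr (y z : {set 'I_n} -> A) :
    \sum_(U : {set 'I_n} | (U \subset W) && (s @: U == U))
       (\prod_(c in cyclesin s U) y c) * \prod_(c in cyclesin s (W :\: U)) z c =
    \prod_(c in cyclesin s W) (y c + z c).
  rewrite (sum_stable (fun U => (\prod_(c in cyclesin s U) y c) * \prod_(c in cyclesin s (W :\: U)) z c) sW).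
  rewrite prodD_subsets; apply: eq_bigr => X XW; have XP := subset_trans XW (cyclesin_sub s W).
  by rewrite cyclesinD ?cover_stable // cyclesin_cover.
have tW U : U \subset W -> s @: U = U -> t ^+ (#|W| - #|U|) = \prod_(c in cyclesin s (W :\: U)) t ^+ #|c|.
  move=> UW sU; rewrite prodrXr (card_cyclesin (stableD sU sW)) cardsD.
  by rewrite (setIidPr UW).
transitivity ((1 - q) * \sum_(e < D) q ^+ e * (q * f e.+1 - f e)).
  transitivity (\sum_(U : {set 'I_n} | (U \subset W) && (s @: U == U)) gser D U * (q - t ^+ (#|W| - #|U|))).
    by apply: eq_bigr => U _; rewrite mulrCA betaE.
  under eq_bigr do rewrite /gser -mulrA.
  rewrite -mulr_sumr; congr (_ * _); under eq_bigr do rewrite mulr_suml.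
  rewrite exchange_big /=; apply: eq_bigr => e _; under eq_bigr do rewrite -mulrA mulrBr.
  rewrite -mulr_sumr sumrB; congr (_ * (_ - _)).
    transitivity (q * \sum_(U : {set 'I_n} | (U \subset W) && (s @: U == U))
       (\prod_(c in cyclesin s U) (e.+1%:R * xq c - 1)) * \prod_(c in cyclesin s (W :\: U)) 1).
      by rewrite mulr_sumr; apply: eq_bigr => U _; rewrite [X in _ = q * (_ * X)]big1 // mulr1 mulrC.
    by rewrite pr; congr (_ * _); apply: eq_bigr => c _; rewrite subrK.
  transitivity (\sum_(U : {set 'I_n} | (U \subset W) && (s @: U == U))
       (\prod_(c in cyclesin s U) (e.+1%:R * xq c - 1)) * \prod_(c in cyclesin s (W :\: U)) t ^+ #|c|).
    by apply: eq_bigr => U /andP[UW /eqP sU]; rewrite tW.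
  rewrite pr; apply: eq_bigr => c _; rewrite /xq -natr1; ring.
have f0 : f 0%N = (W == set0)%:R.
  have [W0|/set0Pn[i iW]] := eqVneq W set0; first by rewrite /f W0 cyclesin0 big_set0.
  rewrite /f (bigD1 (porbit s i)) /=; first by rewrite !mul0r.
  by rewrite inE imset_f //= stable_porbit.
congr (_ * _); rewrite -f0 -/(f D); elim: D => [|D IHD]; first by rewrite big_ord0 expr0; ring.
by rewrite big_ord_recr /= IHD exprS; ring.
Qed.

(** Both families satisfy the same recursion up to multiples of $q^D$, and the coefficient
    [beta 0 = -1] of the unknown term allows solving it. *)
Lemma gser_flagsum D W : s @: W = W -> exists z, gser D W = flagsum W + q ^+ D * z.
Proof.
have [m] := ubnP #|W|; elim: m W => // m IHm W; rewrite ltnS => Wm sW.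
pose P U := (U \subset W) && (s @: U == U).
have [z zE] : exists z, \sum_(U | P U && (U != W)) (gser D U - flagsum U) * beta (#|W| - #|U|) = q ^+ D * z.
  apply: (big_ind (fun y => exists z, y = q ^+ D * z)).
  - by exists 0; rewrite mulr0.
  - by move=> _ _ [y ->] [z ->]; exists (y + z); rewrite mulrDr.
  move=> U /andP[/andP[UW /eqP sU] nUW]; have [|//|z ->] := IHm U.
    by apply: leq_trans Wm; apply: proper_card; rewrite properEneq nUW.
  by exists (z * beta (#|W| - #|U|)); ring.
have := gser_rec D sW; rewrite -(flagsum_rec sW) (bigD1 W) /=; last by rewrite subxx sW eqxx.
rewrite [X in _ = X + _](bigD1 W) /=; last by rewrite subxx sW eqxx.
rewrite subnn /= !mulrN1 => E.
move: zE; under eq_bigr do rewrite mulrBl; rewrite sumrB -/(P _) => zE.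
exists (z - \prod_(c in cyclesin s W) (D%:R * xq c)).
rewrite mulrBr -zE; move: E; set a := \sum_(i | _) _; set b := \sum_(i | _) _ => E.
have -> : gser D W = a - (- gser D W + a) by ring.
rewrite E; ring.
Qed.

End StableFlags.

(** * Positivity of the coefficients of ribbons *)

Section HomogeneousExpansion.
Variables (A : comNzRingType) (q : A).
Local Notation sigma := (1 + q ^+ 2).
Implicit Types (P w v : A) (m : nat) (K r : bitseq).

(** For even $j=2k$ the term $q^j(1+q^2)^{m-j}$ is $t^k(1+t)^{m-2k}$, the shape required by the Gal
    phenomenon. *)
Definition hexp m (e : nat -> nat) : A := \sum_(j < m.+1) (e j)%:R * (q ^+ j * sigma ^+ (m - j)).
Definition nonneg_hom m P := exists e, P = hexp m e.

Lemma nonneg_hom0 : nonneg_hom 0 1.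
Proof. by exists (fun=> 1%N); rewrite /hexp big_ord1 !expr0 !mulr1. Qed.

Lemma nonneg_homD m P w : nonneg_hom m P -> nonneg_hom m w -> nonneg_hom m (P + w).
Proof.
move=> [e ->] [f ->]; exists (fun j => e j + f j)%N; rewrite /hexp -big_split /=.
by apply: eq_bigr => j _; rewrite natrD mulrDl.
Qed.

Lemma nonneg_homq m P : nonneg_hom m P -> nonneg_hom m.+1 (q * P).
Proof.
move=> [e ->]; exists (fun j => if j is i.+1 then e i else 0%N).
rewrite [RHS]big_ord_recl mul0r add0r mulr_sumr; apply: eq_bigr => j _.
rewrite lift0 subSS [q ^+ j.+1]exprS; move: (q ^+ j) (sigma ^+ _) => a b; ring.
Qed.

Lemma nonneg_homs m P : nonneg_hom m P -> nonneg_hom m.+1 (sigma * P).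
Proof.
move=> [e ->]; exists (fun j => if (j <= m)%N then e j else 0%N).
rewrite [RHS]big_ord_recr /= ltnn mul0r addr0 mulr_sumr; apply: eq_bigr => j _.
have jm : (j <= m)%N by rewrite -ltnS.
rewrite jm subSn // [sigma ^+ (m - j).+1]exprS; move: (q ^+ j) (sigma ^+ (m - j)) => a b; ring.
Qed.

Fixpoint leb K r := match K, r with
  | b :: K', c :: r' => (b ==> c) && leb K' r'
  | [::], [::] => true | _, _ => false end.

(** A set bit of [K] sends $(X,Y)$ to $(qX,X)$, a clear one to $((q+q^2)(X+Y),X+Y)$. The two
    alternatives are the shapes of the pair when the leading bit is set, or [K] is empty, and when
    it is clear; here [sigma + q + q] is $(1+q)^2$. *)
Lemma machine_above K (X := \sum_(r <- bits (size K) | leb K r) (mrun q r).1)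
    (Y := \sum_(r <- bits (size K) | leb K r) (mrun q r).2) :
  (exists w, [/\ nonneg_hom (size K) w, X = q * w & Y = w]) \/
  (exists m v, [/\ size K = m.+1, nonneg_hom m v, X = q * ((sigma + q + q) * v) & Y = (1 + q) * v]).
Proof.
rewrite {}/X {}/Y; elim: K => [|b K IHK] /=.
  left; exists 1; split; rewrite ?big_cons ?big_nil /= ?addr0 ?mulr1 //; exact: nonneg_hom0.
set X := \sum_(r <- _ | leb K r) _ in IHK; set Y := \sum_(r <- _ | leb K r) _ in IHK.
have XE : \sum_(r <- bits (size K).+1 | leb (b :: K) r) (mrun q r).1 =
    if b then q * X else (q + q ^+ 2) * (X + Y).
  rewrite big_mkcond big_bitsS /X /Y; case: b => /=.
    by rewrite mulr_sumr [RHS]big_mkcond; apply: eq_bigr => r _; rewrite add0r.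
  rewrite -big_split mulr_sumr [RHS]big_mkcond; apply: eq_bigr => r _.
  by case: (leb K r) => /=; rewrite ?addr0 //; ring.
have YE : \sum_(r <- bits (size K).+1 | leb (b :: K) r) (mrun q r).2 = if b then X else X + Y.
  rewrite big_mkcond big_bitsS /X /Y; case: b {XE} => /=.
    by rewrite [RHS]big_mkcond; apply: eq_bigr => r _; rewrite add0r.
  rewrite -big_split [RHS]big_mkcond; apply: eq_bigr => r _.
  by case: (leb K r) => /=; rewrite ?addr0 // addrC.
rewrite XE YE; case: b {XE YE}; [left|right].
  exists X; split=> //; case: IHK => [[w [hw -> _]]|[m [v [-> hv -> _]]]]; first exact: nonneg_homq.
  rewrite 2!mulrDl; apply/nonneg_homq/nonneg_homD; [apply: nonneg_homD; [exact: nonneg_homs|]|]; exact: nonneg_homq.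
case: IHK => [[w [hw -> ->]]|[m [v [sK hv -> ->]]]].
  by exists (size K), w; split=> //; ring.
exists (size K), ((sigma + q) * v); split=> //; last by ring.
  by rewrite sK mulrDl; apply: nonneg_homD; [exact: nonneg_homs | exact: nonneg_homq].
ring.
Qed.

Lemma machine_nonneg K : nonneg_hom (size K).+1 (\sum_(r <- bits (size K) | leb K r) (mrun q r).1).
Proof.
case: (machine_above K) => [[w [hw -> _]]|[m [v [-> hv -> _]]]]; first exact: nonneg_homq.
rewrite 2!mulrDl; apply/nonneg_homq/nonneg_homD; [apply: nonneg_homD; [exact: nonneg_homs|]|]; exact: nonneg_homq.
Qed.

End HomogeneousExpansion.

(** * Even parts in q *)

Section EvenPart.
Variable F : fieldType.
Implicit Types (p : {poly F}) (i k m n D : nat).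

Lemma coef_even p i : (p \Po 'X^2)`_(i.*2) = p`_i.
Proof. by rewrite coef_comp_poly_Xn // -muln2 dvdn_mull // mulnK. Qed.

Lemma coef_odd p i : ('X * (p \Po 'X^2))`_(i.*2) = 0.
Proof.
case: i => [|i]; rewrite ?coefXM //= coef_comp_poly_Xn //.
by rewrite dvdn2 /= negbK odd_double.
Qed.

Lemma sum_even (f : nat -> F) m : (forall j, odd j -> f j = 0) ->
  \sum_(j < m) f j = \sum_(k < uphalf m) f k.*2.
Proof.
move=> fo; elim: m => [|m IHm]; first by rewrite !big_ord0.
rewrite big_ord_recr IHm uphalfE /=; case: (boolP (odd m)) => om.
  by rewrite fo // addr0 uphalf_half om.
rewrite uphalf_half (negbTE om) add0n big_ord_recr /=; congr (_ + f _).
by rewrite -[LHS](odd_double_half m) (negbTE om).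
Qed.

Lemma coef_natpoly k m i : ((('X^k * (1 + 'X) ^+ m : {poly nat})`_i)%R%:R : F) = ('X^k * (1 + 'X) ^+ m)`_i.
Proof.
rewrite !coefXnM; case: (i < k)%N => //; move: (i - k)%N => {}i.
elim: m i => [|m IHm] i; first by rewrite !expr0 !coef1; case: (i == 0%N).
by rewrite !exprS !mulrDl !mul1r !coefD natrD IHm !coefXM; case: i => [|i] /=; rewrite ?IHm.
Qed.

Lemma coef_natM k p i : (k%:R * p)`_i = k%:R * p`_i.
Proof. by rewrite mulr_natl coefMn mulr_natl. Qed.

Lemma even_monomial j m : 'X^(j.*2) * (1 + 'X^2) ^+ m = ('X^j * (1 + 'X) ^+ m) \Po 'X^2 :> {poly F}.
Proof.
have e1 : (1 + 'X) \Po 'X^2 = 1 + 'X^2 :> {poly F} by rewrite (rmorphD (comp_poly 'X^2)) (rmorph1 (comp_poly 'X^2)) /= comp_polyX.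
rewrite (rmorphM (comp_poly 'X^2)) !(rmorphXn (comp_poly 'X^2)) /= e1 comp_polyX.
by rewrite -exprM -mul2n.
Qed.

(** A term with odd $j$ has only odd powers of $q$. *)
Lemma coef_hexp n (e : nat -> nat) i :
  (hexp ('X : {poly F}) n e)`_(i.*2) =
  \sum_(k < n./2.+1) (e k.*2 * (('X^k * (1 + 'X) ^+ (n - k.*2) : {poly nat})`_i)%R)%:R.
Proof.
pose f j : F := ((e j)%:R * ('X^j * (1 + 'X ^+ 2) ^+ (n - j)) : {poly F})`_(i.*2).
transitivity (\sum_(j < n.+1) f j); first by rewrite /hexp coef_sum.
rewrite (@sum_even f n.+1) => [|j oj].
  by apply: eq_bigr => k _; rewrite /f natrM coef_natpoly coef_natM even_monomial coef_even.
have jE : j = j./2.*2.+1 by rewrite -[LHS](odd_double_half j) oj.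
have Xj : 'X^j = 'X * 'X^(j./2.*2) :> {poly F} by rewrite -exprS -jE.
by rewrite /f coef_natM Xj -mulrA even_monomial coef_odd mulr0.
Qed.

Variables (n' : nat) (s : 'S_n').
Implicit Type W : {set 'I_n'}.

Definition evenfac k W : {poly F} := \prod_(c in cyclesin s W) (k%:R * (1 - 'X^#|c|) - 1).
Definition explP D W : {poly F} :=
  \sum_(d < D) 'X^d * (evenfac d.*2.+1 W - evenfac d.*2 W) + evenfac 0 W.

Lemma pser_explP D W : pser (explP D W) = expl s D (-1) W.
Proof.
have pf k : pser (evenfac k W) = \prod_(c in cyclesin s W) (k%:R * cyc1 F c + -1).
  rewrite rmorph_prod; apply: eq_bigr => c _.
  by rewrite (rmorphB (@pser F)) (rmorphM (@pser F)) (rmorph_nat (@pser F)) (rmorph1 (@pser F)).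
rewrite (rmorphD (@pser F)) rmorph_sum /expl; congr (_ + _).
  by apply: eq_bigr => d _; rewrite (rmorphM (@pser F)) (rmorphB (@pser F)); congr (_ * (_ - _)); exact: pf.
by apply: etrans (pf 0%N) _; apply: eq_bigr => c _; rewrite mul0r add0r.
Qed.

(** Multiplied by $1-q$, the terms $e=2d$ and $e=2d+1$ split into an even part [ev d] and an odd
    part. The sum of the even parts is an Abel rearrangement of [explP], up to a boundary term of
    degree at least [D]. *)
Lemma coef_gser_even D W i : (i < D)%N -> (gser ('X : {poly F}) s D.*2 W)`_(i.*2) = (explP D W)`_i.
Proof.
move=> iD; pose P k := evenfac k W \Po 'X^2.
have PE k : \prod_(c in cyclesin s W) (k%:R * xq ('X : {poly F}) c - 1) = P k.
  rewrite /P (rmorph_prod (comp_poly 'X^2)); apply: eq_bigr => c _.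
  rewrite (rmorphB (comp_poly 'X^2)) (rmorphM (comp_poly 'X^2)) (rmorph_nat (comp_poly 'X^2)).
  by rewrite (rmorphB (comp_poly 'X^2)) (rmorph1 (comp_poly 'X^2)) (rmorphXn (comp_poly 'X^2)) /= comp_polyX.
pose ev (d : nat) : {poly F} := ('X ^+ d * evenfac d.*2.+1 W - 'X ^+ d.+1 * evenfac d.+1.*2 W)%R.
pose od (d : nat) : {poly F} := ('X ^+ d * (evenfac d.+1.*2 W - evenfac d.*2.+1 W))%R.
have gE m : gser ('X : {poly F}) s m.*2 W =
    \sum_(d < m) ((ev d \Po 'X^2) + 'X * (od d \Po 'X^2)).
  rewrite /gser; under eq_bigr do rewrite PE.
  elim: m => [|m IHm]; first by rewrite !big_ord0 mulr0.
  rewrite doubleS !big_ord_recr /= -IHm -addrA [LHS]mulrDr; congr (_ + _).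
  have evE : ev m \Po 'X^2 = 'X^(m.*2) * P m.*2.+1 - 'X^(m.*2.+2) * P m.+1.*2.
    rewrite (rmorphB (comp_poly 'X^2)) !(rmorphM (comp_poly 'X^2)) !(rmorphXn (comp_poly 'X^2)) /= comp_polyX.
    by rewrite -!exprM !mul2n.
  have odE : od m \Po 'X^2 = 'X^(m.*2) * (P m.+1.*2 - P m.*2.+1).
    rewrite (rmorphM (comp_poly 'X^2)) (rmorphB (comp_poly 'X^2)) (rmorphXn (comp_poly 'X^2)) /= comp_polyX.
    by rewrite -!exprM !mul2n.
  rewrite evE odE doubleS !exprS; move: (P _) (P _) => a b; ring.
rewrite gE coef_sum; under eq_bigr do rewrite coefD coef_even coef_odd addr0.
have eE m : explP m W = \sum_(d < m) ev d + 'X^m * evenfac m.*2 W.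
  rewrite /explP; elim: m => [|m IHm]; first by rewrite !big_ord0 expr0 mul1r.
  rewrite !big_ord_recr /= addrAC IHm /ev; ring.
by rewrite eE coefD coefXnM iD addr0 coef_sum.
Qed.

End EvenPart.

(** * Flags of subsets as prefix sets of permutations *)

Section Flags.
Variable n : nat.
Implicit Types (w : seq 'I_n) (U W : {set 'I_n}) (r K : bitseq) (l : seq {set 'I_n}).

Definition prefix_set k w : {set 'I_n} := [set x in take k w].

(* The first bit of [r] tells whether the flag contains a set of [size r]
   elements, and so on downwards. *)
Fixpoint wflag r w : seq {set 'I_n} :=
  if r is b :: r' then
    if b then prefix_set (size r').+1 w :: wflag r' w else wflag r' w
  else [::].

Fixpoint flags r W : seq (seq {set 'I_n}) :=
  if r is b :: r' then
    if b then [seq U :: l | U <- enum [set U : {set 'I_n} | (U \subset W) && (#|U| == (size r').+1)], l <- flags r' U]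
    else flags r' W
  else [:: [::]].

Lemma wflag_take r w m : (size r <= m)%N -> wflag r (take m w) = wflag r w.
Proof.
elim: r => [|b r IHr] //= rm; rewrite IHr ?(ltnW rm) //; case: b => //; congr (_ :: _).
by rewrite /prefix_set take_takel.
Qed.

Lemma wflagP r w w' :
  wflag r w = wflag r w' <->
  forall k, (k < size r)%N -> nth false (rev r) k -> prefix_set k.+1 w = prefix_set k.+1 w'.
Proof.
elim: r => [|b r IHr] //=; split.
  move=> E k; rewrite ltnS rev_cons nth_rcons size_rev.
  have Er : wflag r w = wflag r w' by case: b E => // -[].
  case: ltngtP => // [kr _|-> _ b1]; first exact: (IHr.1 Er).
  by move: E; rewrite b1 => -[].
move=> H; have Er : wflag r w = wflag r w'.
  apply/IHr => k kr rk; apply: H; first exact: ltnW.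
  by rewrite rev_cons nth_rcons size_rev kr.
case: b H => // H; rewrite Er; congr (_ :: _); apply: H => //.
by rewrite rev_cons nth_rcons size_rev ltnn eqxx.
Qed.

Lemma wflag_map r w (s : 'S_n) : wflag r (map s w) = map (fun U : {set 'I_n} => s @: U) (wflag r w).
Proof.
elim: r => //= -[] r IHr /=; rewrite IHr //; congr (_ :: _).
apply/setP => x; rewrite inE -map_take; apply/mapP/imsetP => -[y yw ->]; exists y => //.
  by rewrite inE.
by rewrite inE in yw.
Qed.

Lemma wflag_leb K r w w' : leb K r -> wflag r w = wflag r w' -> wflag K w = wflag K w'.
Proof.
elim: K r => [|b K IHK] [|c r] //= /andP[bc Kr].
have sKr : size K = size r.
  by elim: (K) (r) Kr => [|? ? IH] [|? ?] //= /andP[_ /IH ->].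
case: c b bc => -[] // _; last exact: IHK.
  by move=> [E /(IHK _ Kr) ->]; rewrite sKr E.
by move=> [_ /(IHK _ Kr)].
Qed.

Lemma set_word W w : perm_eq w (enum W) -> [set x in w] = W.
Proof. by move=> /perm_mem pw; apply/setP => x; rewrite inE pw mem_enum. Qed.

Lemma wflag_flags r w W : uniq w -> [set x in w] = W -> (size r < size w)%N -> wflag r w \in flags r W.
Proof.
elim: r w W => [|b r IHr] w W uw wW //= rw; case: b; last by apply: IHr => //; apply: ltnW.
have st : size (take (size r).+1 w) = (size r).+1 by rewrite size_takel // ltnW.
apply/allpairsPdep; exists (prefix_set (size r).+1 w), (wflag r w); split=> //.
  rewrite mem_enum inE; apply/andP; split.
    by apply/subsetP => x; rewrite inE -wW inE => /mem_take.
  by rewrite /prefix_set cardsE (card_uniqP _) ?take_uniq // st.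
rewrite -(@wflag_take r w (size r).+1) //; apply: IHr; rewrite ?take_uniq // st //.
Qed.

Lemma flags_wflag r W l : (size r < #|W|)%N -> l \in flags r W ->
  exists2 w, perm_eq w (enum W) & wflag r w = l.
Proof.
elim: r W l => [|b r IHr] W l /= rW.
  by rewrite inE => /eqP ->; exists (enum W).
case: b; last by apply: IHr; apply: ltnW.
case/allpairsPdep => U [l' [UW l'U ->]]; move: UW; rewrite mem_enum inE => /andP[UW /eqP Ur].
have [|w pw wl] := IHr U l' _ l'U; first by rewrite Ur.
have sw : size w = (size r).+1 by rewrite (perm_size pw) -cardE Ur.
exists (w ++ enum (W :\: U)).
  apply: uniq_perm; rewrite ?enum_uniq //.
    rewrite cat_uniq (perm_uniq pw) enum_uniq enum_uniq /= andbT; apply/hasPn => x.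
    by rewrite mem_enum inE => /andP[xU _]; rewrite (perm_mem pw) mem_enum.
  move=> x; rewrite mem_cat (perm_mem pw) !mem_enum inE.
  by case: (boolP (x \in U)) => // xU; rewrite (subsetP UW).
have tw : take (size r).+1 (w ++ enum (W :\: U)) = w by rewrite take_size_cat.
rewrite /prefix_set tw -wl -(@wflag_take r (w ++ _) (size r).+1) // tw; congr (_ :: _).
exact: set_word.
Qed.

Lemma flags_uniq r W : uniq (flags r W).
Proof.
elim: r W => //= -[] r IHr W //; apply: allpairs_uniq_dep => //; first exact: enum_uniq.
by move=> [U l] [U' l'] _ _ /= [-> ->].
Qed.

Lemma map_fix_all (T : eqType) (f : T -> T) (l : seq T) : (map f l == l) = all (fun x => f x == x) l.
Proof. by elim: l => //= x l <-; rewrite eqseq_cons. Qed.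

Lemma nflags_flags (s : 'S_n) r W :
  nflags s r W = (\sum_(l <- flags r W) (map (fun U : {set 'I_n} => s @: U) l == l))%N.
Proof.
elim: r W => [|b r IHr] W /=; first by rewrite big_seq1.
case: b => //; rewrite big_allpairs_dep big_enum /= big_mkcond [RHS]big_mkcond /=.
apply: eq_bigr => U _; rewrite inE; case: (U \subset W) => //=; case: (#|U| == _); rewrite ?andbF //= andbT.
rewrite IHr; case: eqP => sU.
  by apply: eq_bigr => l _; rewrite eqseq_cons sU eqxx.
by rewrite big1 // => l _; rewrite eqseq_cons; case: eqP.
Qed.

End Flags.

(** * Permutations ordered lexicographically, and their descents *)

Section CompleteFlags.
Variable n : nat.
Hypothesis n_gt0 : (0 < n)%N.
Local Notation Om := ('S_n).
Implicit Types (g h : 'S_n) (r K : bitseq).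

Definition pword g : seq 'I_n := map g (enum 'I_n).
(** Permutations become words with negative letters only, so that [wrank_min] and [word_desc] apply
    to them. *)
Definition nword g : seq (letter n) := map (pair false) (pword g).
Definition prank g := wrank (nword g).
(** Reversed because bit strings describe larger sets before smaller ones; [n.-1] bits suffice
    because a negative last letter is no descent. *)
Definition pdesc g : bitseq := rev [seq wdesc (nword g) k | k <- seq.iota 0 n.-1].

Lemma pword_uniq g : uniq (pword g).
Proof. by rewrite map_inj_uniq ?enum_uniq //; apply: perm_inj. Qed.
Lemma pword_size g : size (pword g) = n.
Proof. by rewrite size_map -cardE card_ord. Qed.
Lemma pword_mem g x : x \in pword g.
Proof. by rewrite -[x](permKV g) map_f // mem_enum. Qed.
Lemma pword_perm g : perm_eq (pword g) (enum 'I_n).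
Proof. by apply: uniq_perm; rewrite ?pword_uniq ?enum_uniq // => x; rewrite pword_mem mem_enum. Qed.

Lemma pwordM g h : pword (g * h)%g = map h (pword g).
Proof. by rewrite /pword -map_comp; apply: eq_map => k; rewrite /= permM. Qed.

Lemma ex_pword w : perm_eq w (enum 'I_n) -> exists g, pword g = w.
Proof.
move=> pw; have uw : uniq w by rewrite (perm_uniq pw) enum_uniq.
have sw : size w = n by rewrite (perm_size pw) -cardE card_ord.
pose x0 := Ordinal n_gt0; pose f (k : 'I_n) := nth x0 w k.
have f_inj : injective f.
  by move=> j k /eqP; rewrite /f nth_uniq ?sw // => /eqP/val_inj.
exists (perm f_inj); apply: (@eq_from_nth _ x0); rewrite size_map -cardE card_ord // => k km.
by rewrite (nth_map x0) ?size_enum_ord // permE /f nth_enum_ord.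
Qed.

Lemma pword_inj : injective pword.
Proof.
by move=> g h /eq_in_map gh; apply/permP => k; apply: gh; rewrite mem_enum.
Qed.

Lemma map_snd_nword g : map snd (nword g) = pword g.
Proof. by rewrite -map_comp map_id_in. Qed.

Lemma nword_size g : size (nword g) = n.
Proof. by rewrite size_map pword_size. Qed.

Lemma perm_enumT w : perm_eq w (enum [set: 'I_n]) = perm_eq w (enum 'I_n).
Proof.
have p : perm_eq (enum [set: 'I_n]) (enum 'I_n).
  by apply: uniq_perm; rewrite ?enum_uniq // => x; rewrite !mem_enum inE.
by rewrite (permPr p).
Qed.

Lemma nword_word g : word setT (nword g).
Proof.
by rewrite /word map_snd_nword perm_enumT pword_perm /nword; case: (pword g).
Qed.

Lemma size_pdesc g : size (pdesc g) = n.-1.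
Proof. by rewrite size_rev size_map size_iota. Qed.

Lemma wdesc_nword g k : wdesc (nword g) k -> (k < n.-1)%N.
Proof.
move=> dk; have := wdesc_size dk; rewrite nword_size => kn.
rewrite ltn_neqAle -ltnS prednK // kn andbT; apply/eqP => kE.
have /(all_nthP n)/(_ k) : all (fun v => v < n)%N (map (@lkey n) (nword g)).
  by rewrite /nword -map_comp all_map; apply/allP => x _; rewrite /= lkey_neg.
rewrite size_map nword_size => /(_ kn) ln; move: dk; rewrite /wdesc nth_default; first by rewrite ltnNge ltnW.
by rewrite size_map nword_size kE prednK.
Qed.

Lemma pdescE g k : nth false (rev (pdesc g)) k = wdesc (nword g) k.
Proof.
rewrite revK; have [kn|nk] := ltnP k n.-1.
  by rewrite (nth_map 0) ?size_iota // nth_iota.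
rewrite nth_default ?size_map ?size_iota //; apply/esym/negP => /wdesc_nword.
by rewrite ltnNge nk.
Qed.

Lemma take_nword g h k : take k (nword g) =i take k (nword h) <-> prefix_set k (pword g) = prefix_set k (pword h).
Proof.
have tE g' : take k (nword g') = map (pair false) (take k (pword g')) by rewrite /nword map_take.
rewrite !tE; split=> E.
  apply/setP => x; rewrite !inE; have := E (false, x).
  have inj : injective (pair false : 'I_n -> letter n) by move=> ? ? [].
  by rewrite !(mem_map inj).
move=> [b x].
by apply/mapP/mapP => -[y yw [-> ->]]; exists y => //;
  have := congr1 (fun U : {set 'I_n} => y \in U) E; rewrite !inE yw // => <-.
Qed.

(** A permutation has the least rank among those sharing its flag at its own descents. *)
Lemma prank_min g h : wflag (pdesc g) (pword g) = wflag (pdesc g) (pword h) -> g != h -> (prank g < prank h)%N.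
Proof.
move=> E gh; apply: wrank_min; rewrite ?map_snd_nword ?pword_uniq //.
- by rewrite (perm_trans (pword_perm g)) // perm_sym pword_perm.
- move=> k dk; apply/take_nword/esym; apply: ((wflagP _ _ _).1 E); last by rewrite pdescE.
  by rewrite size_pdesc; apply: wdesc_nword dk.
by apply: contra gh => /eqP/(congr1 (map snd)); rewrite !map_snd_nword => /pword_inj ->.
Qed.

Lemma leb_nth K r : size K = size r ->
  (forall k, nth false (rev K) k -> nth false (rev r) k) -> leb K r.
Proof.
elim: K r => [|b K IHK] [|c r] //= [sKr] H; have := H (size r).
rewrite !rev_cons !nth_rcons !size_rev sKr ltnn eqxx => /implyP -> /=.
apply: IHK => // k Kk; have kr : (k < size r)%N.
  by rewrite -sKr -size_rev; case: ltnP Kk => // /(nth_default _) ->.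
by have := H k; rewrite !rev_cons !nth_rcons !size_rev sKr kr; apply.
Qed.

(** A descent that [r] does not mark can be undone without changing the flag of type [r]. *)
Lemma prank_desc r g : size r = n.-1 -> ~~ leb (pdesc g) r ->
  exists2 h, (prank h < prank g)%N & wflag r (pword h) = wflag r (pword g).
Proof.
move=> sr nle.
have [k dk nk] : exists2 k, wdesc (nword g) k & ~~ nth false (rev r) k.
  apply: contrapT => nex; case/negP: nle; apply: leb_nth; first by rewrite size_pdesc sr.
  by move=> k; rewrite pdescE => dk; apply: contraT => nk; case: nex; exists k.
have [w' ww' [rk cond neg]] := word_desc (nword_word g) dk.
have {}neg : all (fun x : letter n => ~~ x.1) w' by apply: neg; rewrite all_map; apply/allP.
have [h hw] : exists h, pword h = map snd w'.
  by apply: ex_pword; rewrite -perm_enumT; case/andP: ww'.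
have hE : nword h = w'.
  rewrite /nword hw -map_comp map_id_in // => -[b x] /(allP neg) /= /negbTE -> //.
exists h; first by rewrite /prank hE.
apply/wflagP => l lr rl; apply/take_nword; rewrite hE; apply: cond.
  by rewrite nword_size -(prednK n_gt0) -sr ltnW.
by apply: contraNneq nk => <-.
Qed.

End CompleteFlags.

(** * Ribbon representations inside the regular representation *)

Section RibbonRepresentations.
Variables (F : fieldType) (n : nat).
Hypothesis n_gt0 : (0 < n)%N.
Local Notation N := #|{: 'S_n}|.
Implicit Types (g h s : 'S_n) (r K : bitseq) (u : 'rV[F]_N) (P : {set 'S_n}).

Definition fval u g : F := u 0 (enum_rank g).

Lemma fvalP u v : (forall g, fval u g = fval v g) -> u = v.
Proof. by move=> uv; apply/rowP => a; have := uv (enum_val a); rewrite /fval enum_valK. Qed.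

Lemma fvalD u v g : fval (u + v) g = fval u g + fval v g. Proof. by rewrite /fval mxE. Qed.
Lemma fvalZ a u g : fval (a *: u) g = a * fval u g. Proof. by rewrite /fval mxE. Qed.
Lemma fval_sum (I : Type) (t : seq I) (Q : pred I) (f : I -> 'rV[F]_N) g :
  fval (\sum_(i <- t | Q i) f i) g = \sum_(i <- t | Q i) fval (f i) g.
Proof. by rewrite /fval summxE. Qed.

Definition flag_mx s : 'M[F]_N := \matrix_(a, b) (enum_val a * s == enum_val b :> 'S_n)%g%:R.

Lemma fval_flag_mx u s g : fval (u *m flag_mx s) g = fval u (g * s^-1)%g.
Proof.
rewrite /fval mxE (bigD1 (enum_rank (g * s^-1)%g)) //= mxE !enum_rankK mulgKV eqxx mulr1.
rewrite big1 ?addr0 // => a ag; rewrite mxE enum_rankK; case: eqP => [ags|]; last by rewrite mulr0.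
by case/eqP: ag; rewrite -ags mulgK enum_valK.
Qed.

Lemma flag_mx_repr : mx_repr [set: 'S_n] flag_mx.
Proof.
have ext (A B : 'M[F]_N) : (forall u g, fval (u *m A) g = fval (u *m B) g) -> A = B.
  by move=> AB; apply/row_matrixP => a; rewrite !rowE; apply: fvalP.
split=> [|s t _ _]; apply: ext => u g; rewrite ?mulmxA !fval_flag_mx ?mulmx1 ?invg1 ?mulg1 //.
by rewrite invMg mulgA.
Qed.
Definition flag_repr := MxRepresentation flag_mx_repr.

(** These functions form a copy, inside the regular representation, of the permutation module on
    flags of type [r]. *)
Definition flag_constant r u := forall g h, wflag r (pword g) = wflag r (pword h) -> fval u g = fval u h.

(** The indicator of the permutations that share with [g] its flag at the descents of [g]. By
    [prank_min] this family is unitriangular for [prank]. *)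
Definition flag_basis g : 'rV[F]_N :=
  \row_b (wflag (pdesc g) (pword g) == wflag (pdesc g) (pword (enum_val b)))%:R.

Lemma flag_basisE g h : fval (flag_basis g) h = (wflag (pdesc g) (pword g) == wflag (pdesc g) (pword h))%:R.
Proof. by rewrite /fval mxE enum_rankK. Qed.

Lemma flag_basis_constant r g : leb (pdesc g) r -> flag_constant r (flag_basis g).
Proof. by move=> gr h h' hh'; rewrite !flag_basisE (wflag_leb gr hh'). Qed.

Lemma flag_constantD r u v : flag_constant r u -> flag_constant r v -> flag_constant r (u - v).
Proof. by move=> ur vr g h gh; rewrite /fval !mxE -!/(fval _ _) (ur g h gh) (vr g h gh). Qed.

Lemma flag_constant_mx r u s : flag_constant r u -> flag_constant r (u *m flag_mx s).
Proof.
move=> ur g h gh; rewrite !fval_flag_mx; apply: ur.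
by rewrite !pwordM 2!wflag_map gh.
Qed.

(* Clearing the values of [u] by increasing rank: by [prank_desc] the first
   nonzero values are at permutations [g] with [leb (pdesc g) r]. *)
Lemma flag_expansion r u : size r = n.-1 -> flag_constant r u ->
  exists c : 'S_n -> F, (forall g, c g != 0 -> leb (pdesc g) r) /\ u = \sum_g c g *: flag_basis g.
Proof.
move=> sr; pose B := \max_(g : 'S_n) (prank g).+1.
suff IH m : forall v, (forall g, (prank g < B - m)%N -> fval v g = 0) -> flag_constant r v ->
    exists c : 'S_n -> F, (forall g, c g != 0 -> leb (pdesc g) r) /\ v = \sum_g c g *: flag_basis g.
  by apply: (IH B) => g; rewrite subnn.
elim: m => [|m IHm] v v0 vr.
  exists (fun=> 0); split=> [g|]; first by rewrite /= eqxx.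
  rewrite big1 => [|g _]; last by rewrite scale0r.
  apply: fvalP => g; rewrite v0; first by rewrite /fval mxE.
  by rewrite subn0; apply: (@leq_bigmax _ (fun g => (prank g).+1)).
pose c g := if prank g == (B - m.+1)%N then fval v g else 0.
have cr g : c g != 0 -> leb (pdesc g) r.
  rewrite /c; case: (prank g =P (B - m.+1)%N) => [gm|]; last by rewrite eqxx.
  apply: contraR => nl; have [h hg wh] := prank_desc n_gt0 sr nl.
  by rewrite -(vr h g wh) v0 // -gm.
pose v' := v - \sum_g c g *: flag_basis g.
have v'r : flag_constant r v'.
  apply: flag_constantD => // g h gh; rewrite !fval_sum; apply: eq_bigr => k _; rewrite !fvalZ.
  have [->|/cr kr] := eqVneq (c k) 0; first by rewrite !mul0r.
  by rewrite (flag_basis_constant kr gh).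
have [g gm|d [dr dE]] := IHm v' _ v'r; last first.
  exists (fun g => d g + c g); split=> [g|].
    have [cg|/cr //] := eqVneq (c g) 0; rewrite cg addr0; exact: dr.
  under eq_bigr do rewrite scalerDl.
  by rewrite big_split /= -dE subrK.
rewrite /v' /fval !mxE -/(fval v g) summxE.
have term k : (c k *: flag_basis k) 0 (enum_rank g) = if k == g then c g else 0.
  rewrite -/(fval _ g) fvalZ flag_basisE; have [->|kg] := eqVneq k g; first by rewrite eqxx mulr1.
  case: eqP => [wk|]; last by rewrite mulr0.
  rewrite /c; case: (prank k =P (B - m.+1)%N) => [km|]; last by rewrite mul0r.
  have := prank_min n_gt0 wk kg; rewrite km => lt.
  by move: gm lt; clear; lia.
under eq_bigr do rewrite term.
rewrite -big_mkcond big_pred1_eq /c; case: (prank g =P (B - m.+1)%N) => [_|gm']; first by rewrite subrr.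
by rewrite subr0 v0 //; move: gm gm'; clear; lia.
Qed.

Lemma flag_basis_indep (c : 'S_n -> F) : \sum_g c g *: flag_basis g = 0 -> forall g, c g = 0.
Proof.
move=> c0 g; apply/eqP; have [m] := ubnP (prank g); elim: m g => // m IHm g; rewrite ltnS => gm.
have := congr1 (fval^~ g) c0; rewrite fval_sum (bigD1 g) //= fvalZ flag_basisE eqxx mulr1.
rewrite big1 => [|h hg]; first by rewrite addr0 /fval mxE => ->.
rewrite fvalZ flag_basisE; case: eqP => [wh|]; last by rewrite mulr0.
by rewrite (eqP (IHm h _)) ?mul0r // (leq_trans (prank_min n_gt0 wh hg)).
Qed.

Definition flag_span P : 'M[F]_(#|P|, N) := \matrix_(i < #|P|) flag_basis (enum_val i).

Lemma flag_span_comb P (c : 'S_n -> F) : (forall g, c g != 0 -> g \in P) ->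
  \sum_g c g *: flag_basis g = (\row_i c (enum_val i)) *m flag_span P.
Proof.
move=> cP; rewrite mulmx_sum_row (bigID (mem P)) /= [X in _ + X]big1 ?addr0 => [|g].
  rewrite big_enum_val /=; apply: eq_bigr => i _; by rewrite mxE rowK.
by move=> gP; have [->|/cP] := eqVneq (c g) 0; rewrite ?scale0r // (negbTE gP).
Qed.

Lemma flag_span_free P : row_free (flag_span P).
Proof.
rewrite -kermx_eq0; apply/rowV0P => x /sub_kermxP x0.
pose c g := \sum_(i < #|P|) (if enum_val i == g then x 0 i else 0).
have cE i : c (enum_val i) = x 0 i.
  rewrite /c (bigD1 i) //= eqxx big1 ?addr0 // => j ji.
  by rewrite (inj_eq enum_val_inj) (negbTE ji).
have c0 : \sum_g c g *: flag_basis g = 0.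
  rewrite (@flag_span_comb P) => [|g].
    by rewrite -[RHS]x0; congr (_ *m _); apply/rowP => i; rewrite mxE cE.
  apply: contraR => gP; rewrite /c big1 // => i _; case: eqP => // ig.
  by rewrite -ig enum_valP in gP.
by apply/rowP => i; rewrite mxE -cE (flag_basis_indep c0).
Qed.

Lemma ex_flag_coef s g : exists c : 'S_n -> F, (forall h, c h != 0 -> leb (pdesc h) (pdesc g)) /\
  flag_basis g *m flag_mx s = \sum_h c h *: flag_basis h.
Proof.
apply: flag_expansion; first exact: size_pdesc.
apply/flag_constant_mx/flag_basis_constant.
by elim: (pdesc g) => //= b r ->; rewrite implybb.
Qed.

Definition flag_coef s g := projT1 (cid (ex_flag_coef s g)).
Lemma flag_coefP s g : (forall h, flag_coef s g h != 0 -> leb (pdesc h) (pdesc g)) /\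
  flag_basis g *m flag_mx s = \sum_h flag_coef s g h *: flag_basis h.
Proof. by rewrite /flag_coef; case: (cid _). Qed.

Definition desc_closed P := forall g h, g \in P -> leb (pdesc h) (pdesc g) -> h \in P.

Lemma flag_span_mx P s : desc_closed P ->
  flag_span P *m flag_mx s = (\matrix_(i, j) flag_coef s (enum_val i) (enum_val j)) *m flag_span P.
Proof.
move=> dP; apply/row_matrixP => i; rewrite !row_mul rowK.
have [c1 c2] := flag_coefP s (enum_val i); rewrite c2 (@flag_span_comb P).
  by congr (_ *m _); apply/rowP => j; rewrite !mxE.
by move=> h /c1; apply: dP; apply: enum_valP.
Qed.

Lemma trU_flag_span P s : desc_closed P -> trU (flag_mx s) (flag_span P) = \sum_(g in P) flag_coef s g g.
Proof.
move=> dP; rewrite (trU_basis (flag_span_free P) (eqmx_refl _) (flag_span_mx s dP)).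
by rewrite [RHS]big_enum_val; apply: eq_bigr => i _; rewrite mxE.
Qed.

Lemma flag_span_module P : desc_closed P -> mxmodule flag_repr <<flag_span P>>%MS.
Proof.
move=> dP; apply/mxmoduleP => s _; rewrite (eqmxMr _ (genmxE _)) genmxE /=.
by rewrite flag_span_mx // submxMl.
Qed.

Lemma leb_trans r1 r2 r3 : leb r1 r2 -> leb r2 r3 -> leb r1 r3.
Proof.
elim: r1 r2 r3 => [|a r1 IH] [|b r2] [|c r3] //= /andP[ab r12] /andP[bc r23].
by rewrite (IH _ _ r12 r23) andbT; apply/implyP => /(implyP ab)/(implyP bc).
Qed.

Lemma leb_anti r1 r2 : leb r1 r2 -> leb r2 r1 -> r1 = r2.
Proof.
elim: r1 r2 => [|a r1 IH] [|b r2] //= /andP[ab r12] /andP[ba r21].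
by rewrite (IH _ r12 r21); case: a b ab ba => -[].
Qed.

Definition desc_below K : {set 'S_n} := [set g | leb (pdesc g) K].
Definition desc_strictly_below K : {set 'S_n} := [set g | leb (pdesc g) K && (pdesc g != K)].

Lemma desc_below_closed K : desc_closed (desc_below K).
Proof. by move=> g h; rewrite !inE => gK hg; apply: leb_trans gK. Qed.

Lemma desc_strictly_below_closed K : desc_closed (desc_strictly_below K).
Proof.
move=> g h; rewrite !inE => /andP[gK nK] hg; rewrite (leb_trans hg gK); apply: contra nK => /eqP hK.
by rewrite -hK in gK *; rewrite (leb_anti gK hg).
Qed.

(** The span for descent sets inside [K] modulo the span for those strictly inside: the
    representation described by a ribbon Schur function. The permutation module on flags of type [r]
    is filtered with these quotients, one for each [K] below [r]. *)
Definition ribbon_repr K : representation F [set: 'S_n] :=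
  Representation (mxrepresentation.section_repr
    (flag_span_module (@desc_strictly_below_closed K)) (flag_span_module (@desc_below_closed K))).

Lemma mxtrace_ribbon K s : \tr (ribbon_repr K s) = \sum_(g | pdesc g == K) flag_coef s g g.
Proof.
have tr_ P : desc_closed P -> trU (flag_mx s) <<flag_span P>>%MS = \sum_(g in P) flag_coef s g g.
  move=> dP; rewrite -(trU_flag_span s dP); apply/esym/trU_eqmx; first exact/eqmx_sym/genmxE.
  by rewrite flag_span_mx // submxMl.
rewrite /= (mxtrace_section_trU _ (flag_span_module (@desc_below_closed K))) ?inE //.
  rewrite /= !tr_; [|exact: desc_strictly_below_closed|exact: desc_below_closed].
  rewrite (bigID (fun g => pdesc g == K)) /=; apply/eqP; rewrite subr_eq; apply/eqP; congr (_ + _).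
    apply: eq_bigl => g; rewrite inE; case: eqP => [->|]; rewrite ?andbF // andbT.
    by elim: (K) => //= b r ->; rewrite implybb.
  by apply: eq_bigl => g; rewrite !inE.
rewrite !genmxE; apply/row_subP => i; rewrite rowK.
have gB : enum_val i \in desc_below K by have := enum_valP i; rewrite !inE => /andP[].
have <- : row (enum_rank_in gB (enum_val i)) (flag_span (desc_below K)) = flag_basis (enum_val i).
  by rewrite rowK enum_rankK_in.
exact: row_sub.
Qed.

End RibbonRepresentations.

(** * Permutation characters on flags as sums of ribbon characters *)

Section FlagTraces.
Variables (F : fieldType) (n : nat).
Hypothesis n_gt0 : (0 < n)%N.
Local Notation N := #|{: 'S_n}|.
Implicit Types (g h s : 'S_n) (r K : bitseq).

(** By [flag_expansion] the span consists of the functions constant on flags of type [r]. The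
    indicators of the flags are another basis of it, and [s] permutes this one. *)
Lemma trU_desc_below r s : size r = n.-1 ->
  trU (flag_mx F s) (flag_span F (desc_below n r)) = (nflags s r setT)%:R.
Proof.
move=> sr; set C := flags r [set: 'I_n].
have rn : (size r < #|[set: 'I_n]|)%N by rewrite cardsT card_ord sr ltn_predL.
have inC g : wflag r (pword g) \in C.
  apply: wflag_flags; first exact: pword_uniq.
    by apply/setP => x; rewrite !inE pword_mem.
  by rewrite pword_size -[X in (_ < X)%N](card_ord n) -cardsT.
have exC (i : 'I_(size C)) : exists g, wflag r (pword g) = nth [::] C i.
  have [w pw <-] := flags_wflag rn (mem_nth [::] (ltn_ord i)).
  by rewrite perm_enumT in pw; have [g <-] := ex_pword n_gt0 pw; exists g.
pose rep i := projT1 (cid (exC i)); have repE i : wflag r (pword (rep i)) = nth [::] C i by rewrite /rep; case: cid.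
pose act (l : seq {set 'I_n}) := map (fun U : {set 'I_n} => s @: U) l.
have act_inj : injective act.
  by apply: inj_map; apply: imset_inj; apply: perm_inj.
pose ix g : 'I_(size C) := Ordinal (etrans (index_mem _ _) (inC g)).
have ixE g : nth [::] C (ix g) = wflag r (pword g) by rewrite /= nth_index ?inC.
have Ceq (i : 'I_(size C)) g : (wflag r (pword g) == nth [::] C i) = (i == ix g).
  apply/eqP/eqP => [E|->]; last by rewrite ixE.
  by apply: ord_inj; rewrite /= E (index_uniq [::] (ltn_ord i) (flags_uniq r setT)).
pose X : 'M[F]_(size C, N) := \matrix_(i, b) (wflag r (pword (enum_val b)) == nth [::] C i)%:R.
pose Y : 'M[F]_(size C) := \matrix_(i, j) (act (nth [::] C i) == nth [::] C j)%:R.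
have XE i g : fval (row i X) g = (i == ix g)%:R by rewrite /fval !mxE enum_rankK Ceq.
have uX (u : 'rV[F]_(size C)) g : fval (u *m X) g = u 0 (ix g).
  rewrite mulmx_sum_row fval_sum (bigD1 (ix g)) //= fvalZ XE eqxx mulr1 big1 ?addr0 // => i ig.
  by rewrite fvalZ XE (negbTE ig) mulr0.
have Xr i : flag_constant r (row i X).
  move=> g h gh; rewrite !XE; congr (_ == _)%:R; apply: val_inj; by rewrite /= gh.
have rX u : flag_constant r u -> (u <= X)%MS.
  move=> ur; apply/submxP; exists (\row_i fval u (rep i)); apply: fvalP => g.
  by rewrite uX mxE; apply: ur; rewrite repE ixE.
rewrite (@trU_basis _ _ _ _ _ _ X Y).
- rewrite /mxtrace nflags_flags natr_sum (big_nth [::]) big_mkord.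
  by apply: eq_bigr => i _; rewrite mxE.
- rewrite -kermx_eq0; apply/rowV0P => x /sub_kermxP x0; apply/rowP => i.
  have := uX x (rep i); rewrite x0 {1}/fval !mxE => ->; congr (x 0 _).
  by apply/eqP; rewrite -Ceq repE.
- apply/eqmxP/andP; split; apply/row_subP => i.
    have [c [cr ->]] := flag_expansion n_gt0 sr (Xr i).
    by rewrite (@flag_span_comb _ _ (desc_below n r)) ?submxMl // => g /cr; rewrite inE.
  apply: rX; rewrite rowK; apply: flag_basis_constant.
  by have := enum_valP i; rewrite inE.
apply/row_matrixP => i; rewrite !row_mul; apply: fvalP => g.
rewrite fval_flag_mx uX XE !mxE ixE; congr (nat_of_bool _)%:R.
rewrite -Ceq -(inj_eq act_inj) eq_sym; congr (_ == _).
by rewrite /act -wflag_map -pwordM mulgKV.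
Qed.

Lemma leb_size K r : leb K r -> size K = size r.
Proof. by elim: K r => [|a K IH] [|b r] //= /andP[_ /IH ->]. Qed.

Lemma sum_ribbon r s : size r = n.-1 ->
  \sum_(K <- bits n.-1 | leb K r) \tr (ribbon_repr F n_gt0 K s) = (nflags s r setT)%:R.
Proof.
move=> sr; rewrite -(trU_desc_below s sr) (trU_flag_span F n_gt0 s (@desc_below_closed n r)).
under eq_bigr do rewrite mxtrace_ribbon.
rewrite (exchange_big_dep xpredT) //= [RHS]big_mkcond; apply: eq_bigr => g _.
rewrite inE big_mkcond (bigD1_seq (pdesc g)) ?bits_uniq ?mem_bits ?size_pdesc //= eqxx andbT.
by rewrite big1 ?addr0 // => K gK; rewrite eq_sym (negbTE gK) andbF.
Qed.

End FlagTraces.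

(** * The local equivariant Gal phenomenon *)

Section GreprTraces.
Variables (F : fieldType) (gT : finGroupType) (G : {group gT}).
Implicit Types (rG : representation F G).

Lemma mxtrace_dadd_sum (I : Type) (t : seq I) (V : I -> representation F G) x :
  \tr ((\big[dadd_grepr/grepr0]_(i <- t) V i) x) = \sum_(i <- t) \tr (V i x).
Proof.
elim: t => [|i t IHt]; first by rewrite !big_nil /= mxtrace1.
by rewrite !big_cons /= mxtrace_block IHt.
Qed.

Lemma mxtrace_muln rG k x : \tr (muln_grepr rG k x) = k%:R * \tr (rG x).
Proof. by rewrite mxtrace_dadd_sum sumr_const card_ord mulr_natl. Qed.

End GreprTraces.

Section LocalGal.
Variables (R : realType) (n : nat) (F : fieldType) (iota : {rmorphism R -> F}).
Hypothesis prim : forall m, (0 < m)%N -> exists z : F, m.-primitive_root z.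
Hypothesis F0 : [pchar F] =i pred0.
Hypothesis n_gt0 : (0 < n)%N.

Lemma mxtrace_local_flags i (s : 'S_n) :
  \tr (local_face_repr iota (Kn n R) i s) =
  \sum_(r <- bits n.-1) (mrun ('X : {poly F}) r).1`_(i.*2) * (nflags s r setT)%:R.
Proof.
transitivity (fps_coef (lser iota s setT) i); first exact: mxtrace_local_face.
rewrite (lser_agree iota prim (setT_stable s) (ltnSn i)) -pser_explP.
rewrite [LHS]/= -(coef_gser_even F s setT (ltnSn i)).
have reg : GRing.lreg (1 - 'X : {poly F}).
  apply/mulfI; rewrite -opprB oppr_eq0 -size_poly_eq0 -[1]/(1%:P) size_XsubC //.
(* Precision [i.+1] in $t$ is precision [i.+1.*2] in $q$, beyond the coefficient [i.*2] that is
   read. *)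
have [z ->] := gser_flagsum reg i.+1.*2 (setT_stable s).
rewrite coefD coefXnM ltn_double ltnSn addr0 /flagsum.
rewrite -cards_eq0 cardsT card_ord (gtn_eqF n_gt0) coef_sum.
by apply: eq_bigr => r _; rewrite mulrC coef_natM mulrC.
Qed.

Lemma local_gal : local_equivariant_gal iota (Kn n R).
Proof.
pose e K := projT1 (cid (machine_nonneg ('X : {poly F}) K)).
have eE K : \sum_(r <- bits (size K) | leb K r) (mrun ('X : {poly F}) r).1 = hexp 'X (size K).+1 (e K).
  by rewrite /e; case: (cid _).
(* [M k] contains the ribbon of [K] as often as $q^{2k}(1+q^2)^{n-2k}$ occurs in the expansion of
   its coefficient. *)
exists (fun k => \big[dadd_grepr/grepr0]_(K <- bits n.-1) muln_grepr (ribbon_repr F n_gt0 K) (e K k.*2)).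
move=> i _; apply: (mx_rsim_trace F0) => s _.
rewrite mxtrace_dadd_sum mxtrace_local_flags.
under eq_big_seq => r; first rewrite mem_bits => /eqP sr.
  rewrite -(sum_ribbon F n_gt0 s sr) mulr_sumr; over.
rewrite (exchange_big_dep xpredT) //=.
under [RHS]eq_bigr => k _.
  rewrite mxtrace_muln mxtrace_dadd_sum mulr_sumr; over.
rewrite [RHS]exchange_big /=; apply: eq_big_seq => K; rewrite mem_bits => /eqP sK.
rewrite -mulr_suml -coef_sum -{1}sK eE coef_hexp sK prednK // mulr_suml.
by apply: eq_bigr => k _; rewrite mxtrace_muln mulrA -natrM mulnC.
Qed.

End LocalGal.

(** * Roots of unity, the denominator, and assembly of the theorem *)

Lemma closed_prim_root (F : closedFieldType) m : [pchar F] =i pred0 -> (0 < m)%N ->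
  exists z : F, m.-primitive_root z.
Proof.
move=> F0 m0; have [rs rsE] := closed_field_poly_normal ('X^m - 1 : {poly F}).
have mon : lead_coef ('X^m - 1 : {poly F}) = 1 by apply/monicP; rewrite monicXnsubC.
rewrite mon scale1r in rsE.
have un : uniq rs.
  by rewrite -separable_prod_XsubC -rsE separable_Xn_sub_1 ?((pcharf0P F).1 F0) -?lt0n.
have sz : size rs = m.
  by apply: succn_inj; rewrite -(size_prod_XsubC rs id) -rsE -(@size_XnsubC F m 1).
have /hasP[z _ pz] : has m.-primitive_root rs.
  apply: has_prim_root; rewrite ?sz //; apply/allP => z zr.
  by rewrite /root_of_unity rsE root_prod_XsubC.
by exists z.
Qed.

Lemma complex_pchar0 (R : realType) : [pchar R[i]] =i pred0.
Proof. by move=> p; rewrite (pchar_num R[i]). Qed.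

(** The constant term in $z$ is $1-t$, which is monic in $t$ up to sign and hence not a zero
    divisor. *)
Lemma denominator_lreg (F : fieldType) :
  GRing.lreg (Htz F ^+ 2 - fpsC 'X * Hz F ^+ 2 : fps {poly symfun F}).
Proof.
have h0 : sf_h F 0 = 1.
  apply: symfunP => N /=; apply/mpolyP => m; rewrite sf_h_coef mcoeff1.
  by rewrite mdeg_eq0.
have c0 : fps_coef (Htz F ^+ 2 - fpsC 'X * Hz F ^+ 2) 0 = 1 - 'X :> {poly symfun F}.
  by rewrite fps_coefB !expr2 !fps_coefM !big_ord1 /= big_ord1 /= h0 expr0 scale1r !mulr1.
apply: fps_lreg; rewrite c0 => p q /(congr1 -%R); rewrite -!mulNr opprB -polyC1.
by apply: monic_lreg; apply: monicXsubC.
Qed.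

Lemma Vseries0 (F : fieldType) : [pchar F] =i pred0 -> Vseries (0 : fps F) = 1.
Proof.
move=> F0; rewrite -(Hs0 (kapBE F0)); congr Hs; apply: funext => j.
by rewrite rmorph0 mul0r.
Qed.

Lemma VseriesN1 (F : fieldType) : [pchar F] =i pred0 -> Vseries (-1 : fps F) * bseries F = 1.
Proof.
move=> F0; rewrite -(HsNK (kapBE F0) (@psum F)); congr (Hs _ _ * _); apply: funext => j.
by rewrite rmorphN rmorph1 mulN1r.
Qed.

Section MorphismImages.
Variables (S S' : comNzRingType) (phi : {rmorphism S -> S'}) (a b t : S).

Lemma rmorph_linear : phi (a - t * b) = phi a - phi t * phi b.
Proof. by rewrite rmorphB rmorphM. Qed.

Lemma rmorph_quadratic : phi (a ^+ 2 - t * b ^+ 2) = phi a ^+ 2 - phi t * phi b ^+ 2.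
Proof. by rewrite rmorphB rmorphXn rmorphM rmorphXn. Qed.

End MorphismImages.

Section Quotients.
Variables (F : fieldType) (V : forall n, nat -> representation F [set: 'S_n]).
Hypothesis F0 : [pchar F] =i pred0.
Hypothesis V_vanish : forall n i s, (n < i)%N -> \tr (V n i s) = 0.
Local Notation H := (Hz F : fps {poly symfun F}).
Local Notation Ht := (Htz F : fps {poly symfun F}).
Local Notation t := (fpsC 'X : fps {poly symfun F}).
Let phi := fmap (@pser (symfun F)).

Lemma phi_denominator : phi (Ht ^+ 2 - t * H ^+ 2) =
  aseries F ^+ 2 - pser (pser 'X)%:P * bseries F ^+ 2.
Proof. by rewrite /phi rmorph_quadratic /= (fmap_Htz F0) (fmap_Hz F0) fmap_t. Qed.

Lemma phi_numerator : phi (Ht - t * H) = aseries F - pser (pser 'X)%:P * bseries F.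
Proof. by rewrite /phi rmorph_linear /= (fmap_Htz F0) (fmap_Hz F0) fmap_t. Qed.

(** The equation is checked after embedding polynomials in $t$ into power series in $t$, where the
    expansions in $t$ make sense; the embedding [phi] is injective. *)
Lemma ch_gf_is_quotient z (M : fps {poly symfun F}) :
    (forall n D s, agree D (Fps (fun i => \tr (V n i s))) (expl s D z setT)) ->
    Vseries z * bseries F = phi M ->
  is_quotient (ch_gf V) (M * (Ht - t * H)) (Ht ^+ 2 - t * H ^+ 2).
Proof.
move=> VE zM; split; first exact: denominator_lreg.
have phi_inj : injective phi by apply/fmap_inj/pser_inj.
have phiM (f g : fps {poly symfun F}) : phi (f * g) = phi f * phi g by apply: rmorphM.
apply: phi_inj; rewrite !phiM phi_denominator phi_numerator -zM.
by apply: (ch_gf_identity F0 V_vanish) => n D i s iD; apply: (VE n D s i iD).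
Qed.

End Quotients.

Theorem proposition5p2 (R : realType) :
  let C : fieldType := R[i] in
  let iota : {rmorphism R -> C} := real_complex R in
  let H : fps {poly symfun C} := Hz C in
  let Ht : fps {poly symfun C} := Htz C in
  let t : fps {poly symfun C} := fpsC 'X in
  [/\ is_quotient (ch_gf (fun n => face_quot_repr iota (Kn n R)))
        (H * (Ht - t * H)) (Ht ^+ 2 - t * H ^+ 2),
      is_quotient (ch_gf (fun n => local_face_repr iota (Kn n R)))
        (Ht - t * H) (Ht ^+ 2 - t * H ^+ 2)
    & forall n, (0 < n)%N -> local_equivariant_gal iota (Kn n R)].
Proof.
move=> C iota H Ht t.
have F0 : [pchar C] =i pred0 := @complex_pchar0 R.
have prim m : (0 < m)%N -> exists z : C, m.-primitive_root z by apply: closed_prim_root.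
split; last by move=> n n0; apply: local_gal.
  (* For [z = 0] the factor [Vseries] is 1, which leaves [H] in the numerator. *)
  apply: (@ch_gf_is_quotient C _ F0 _ 0) => [n i s|n D s i iD|].
  - exact: mxtrace_face_quot_vanish.
  - apply: etrans (mxtrace_face_quot iota i s) _; exact: (qser_agree iota prim (setT_stable s)).
  by rewrite Vseries0 // mul1r (fmap_Hz F0).
(* For [z = -1] the factor [Vseries] is the inverse of [H], so the extra factor of the numerator is
   1. *)
rewrite -[Ht - t * H]mul1r; apply: (@ch_gf_is_quotient C _ F0 _ (-1)) => [n i s|n D s i iD|].
- exact: mxtrace_local_face_vanish.
- apply: etrans (mxtrace_local_face iota i s) _; exact: (lser_agree iota prim (setT_stable s)).
by rewrite VseriesN1 // rmorph1.
Qed.
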